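(* Let $A$ be a commutative Noetherian Cohen-Macaulay ring containing a field $K$ of characteristic zero, let $m\ge 1$, let $G$ be a finite group and let $\Phi\colon G\to GL_m(A)$ be a group homomorphism. Let $R=A[X_1,\ldots,X_m]$ be graded with $\deg A=0$ and $\deg X_i=1$ for all $i$, let $G$ act linearly on $R$ via $\Phi$, fixing $A$, and let $S=R^G$. Let $I$ be a homogeneous ideal of $S$, let $i\ge 0$, and let $M=H^i_I(S)=\bigoplus_{n\in\mathbb{Z}}M_n$. If $M_j=0$ for all integers $j\in[-m-(|G|!-1)^m,\ (|G|!-1)^m]$, then $M=0$.
   Context: $G$ acting linearly on $R$ fixing $A$ via $\Phi$ means that $G$ acts by graded $A$-algebra automorphisms whose action on the free $A$-module $R_1=\bigoplus_i AX_i$ is given by $\Phi$. The ring of invariants $S=R^G$ is a graded subring of $R$ (in general not standard graded) with $S_0=A$. $H^i_I(S)$ denotes local cohomology of $S$ with support in $I$, with its natural $\mathbb{Z}$-grading; $M_n$ is its degree $n$ component. $|G|!$ is the factorial of the order of $G$. *)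

(* Defs.v *)
From HB Require Import structures.
From mathcomp Require Import all_boot all_order all_algebra all_fingroup.
From mathcomp Require Import mxrepresentation.
From mathcomp Require Import mpoly.

Set Implicit Arguments.
Unset Strict Implicit.
Unset Printing Implicit Defensive.

Import Order.TTheory GRing.Theory Num.Theory.
Local Open Scope ring_scope.

(* Ideals are Prop-valued predicates: the boolean predicates of ring_quotient
   only cover the decidable ones. *)
Section Ideals.
Variable A : comNzRingType.
Implicit Types (J P X : A -> Prop) (s : seq A).

Definition ideal J : Prop :=
  [/\ J 0, forall a b, J a -> J b -> J (a + b) & forall a b, J b -> J (a * b)].

Definition ideal_span X : A -> Prop := fun a =>
  exists (n : nat) (c x : 'I_n -> A),
    (forall k, X (x k)) /\ a = \sum_(k < n) c k * x k.

Definition seq_span s : A -> Prop := ideal_span (fun x => x \in s).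

Definition ideal_pow J (t : nat) : A -> Prop :=
  ideal_span (fun a => exists x : 'I_t -> A,
    (forall k, J (x k)) /\ a = \prod_(k < t) x k).

Definition noetherian : Prop :=
  forall J, ideal J -> exists s, forall a, J a <-> seq_span s a.

Definition prime_ideal P : Prop :=
  [/\ ideal P, ~ P 1 & forall a b, P (a * b) -> P a \/ P b].

Definition maximal_ideal P : Prop :=
  [/\ ideal P, ~ P 1 &
      forall J, ideal J -> ~ J 1 -> (forall a, P a -> J a) ->
                forall a, J a -> P a].

Definition prime_chain (n : nat) : Prop :=
  exists P : nat -> A -> Prop,
    (forall k, (k <= n)%N -> prime_ideal (P k)) /\
    (forall k, (k < n)%N ->
       (forall a, P k a -> P k.+1 a) /\ exists a, P k.+1 a /\ ~ P k a).

Definition krull_dim (n : nat) : Prop :=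
  prime_chain n /\ forall k, prime_chain k -> (k <= n)%N.

Definition regular_sequence s : Prop :=
  (forall k, (k < size s)%N -> forall a,
     seq_span (take k s) (s`_k * a) -> seq_span (take k s) a) /\
  ~ seq_span s 1.

(* The next two definitions are meant for a local ring, whose maximal ideal is
   the set of non-units. *)
Definition regular_length (n : nat) : Prop :=
  exists s, [/\ size s = n, regular_sequence s &
                forall x, x \in s -> ~ exists y, y * x = 1].

Definition depth (n : nat) : Prop :=
  regular_length n /\ forall k, regular_length k -> (k <= n)%N.

Definition cohen_macaulay_local : Prop := exists n, krull_dim n /\ depth n.

End Ideals.

(* [L], with the map [loc], is the localization of [A] at the prime ideal
   [P]. *)
Definition is_localization (A : comNzRingType) (P : A -> Prop)
    (L : comNzRingType) (loc : {rmorphism A -> L}) : Prop :=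
  [/\ forall s, ~ P s -> exists y, y * loc s = 1,
      forall y, exists a s, ~ P s /\ y * loc s = loc a &
      forall a, loc a = 0 -> exists s, ~ P s /\ s * a = 0].

Definition cohen_macaulay (A : comNzRingType) : Prop :=
  forall P : A -> Prop, maximal_ideal P ->
  forall (L : comNzRingType) (loc : {rmorphism A -> L}),
    is_localization P loc -> cohen_macaulay_local L.

(* [V] is the internal direct sum of the subgroups [D n], [n : int]. *)
Definition direct_sum (V : zmodType) (D : int -> V -> Prop) : Prop :=
  [/\ forall n, D n 0,
      forall n x y, D n x -> D n y -> D n (x - y),
      forall x, exists (r : seq int) (c : int -> V),
        [/\ uniq r, forall n, D n (c n) & x = \sum_(n <- r) c n] &
      forall (r : seq int) (c : int -> V), uniq r -> (forall n, D n (c n)) ->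
        \sum_(n <- r) c n = 0 -> forall n, n \in r -> c n = 0].

Record gradedRing := GradedRing {
  gring :> comNzRingType;
  rdeg : int -> gring -> Prop;
  rdeg_sum : direct_sum rdeg;
  rdeg1 : rdeg 0 1;
  rdegM : forall k l a b, rdeg k a -> rdeg l b -> rdeg (k + l) (a * b) }.

Definition homogeneous_ideal (S : gradedRing) (I : S -> Prop) : Prop :=
  ideal I /\
  forall (r : seq int) (c : int -> S), uniq r -> (forall n, rdeg n (c n)) ->
    I (\sum_(n <- r) c n) -> forall n, n \in r -> I (c n).

Record gradedMod (S : gradedRing) := GradedMod {
  gmod :> lmodType S;
  mdegree : int -> gmod -> Prop;
  mdegree_sum : direct_sum mdegree;
  mdegreeZ : forall k n (a : S) (x : gmod),
    rdeg k a -> mdegree n x -> mdegree (k + n) (a *: x) }.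

Definition regular_gmod (S : gradedRing) : gradedMod S :=
  @GradedMod S (GRing.regular S) (@rdeg S) (@rdeg_sum S) (@rdegM S).

Section LocalCohomology.
Variable S : gradedRing.
Implicit Types (U V M N E : gradedMod S) (I : S -> Prop).

Definition degree_preserving U V (f : U -> V) : Prop :=
  forall n x, mdegree n x -> mdegree n (f x).

(* Injective object of the category of graded modules and linear maps of
   degree 0. *)
Definition graded_injective E : Prop :=
  forall U V (f : {linear U -> V}) (g : {linear U -> E}),
    degree_preserving f -> degree_preserving g -> injective f ->
    exists h : {linear V -> E}, degree_preserving h /\ forall x, h (f x) = g x.

Record graded_injective_resolution N := GradedInjectiveResolution {
  res :> nat -> gradedMod S;
  res_d : forall k, {linear res k -> res k.+1};
  res_aug : {linear N -> res 0};
  res_inj : forall k, graded_injective (res k);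
  res_d_deg : forall k, degree_preserving (res_d k);
  res_aug_deg : degree_preserving res_aug;
  res_aug_inj : injective res_aug;
  res_exact0 : forall x, res_d 0 x = 0 <-> exists y, res_aug y = x;
  res_exactS : forall k x, res_d k.+1 x = 0 <-> exists y, res_d k y = x }.

(* The [I]-torsion submodule [Gamma_I M]. *)
Definition torsion I M (x : M) : Prop :=
  exists t, forall a, ideal_pow I t a -> a *: x = 0.

Definition cocycle I N (E : graded_injective_resolution N) i (x : E i) : Prop :=
  torsion I x /\ res_d E i x = 0.

Definition coboundary I N (E : graded_injective_resolution N) i :
    E i -> Prop :=
  match i with
  | 0 => fun x => x = 0
  | k.+1 => fun x => exists y, torsion I y /\ res_d E k y = x
  end.

(* [M] is the graded module [H^i_I(N)], the value at [N] of the [i]-th right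
   derived functor of [Gamma_I]: it is, through [pi], the cocycles modulo the
   coboundaries of [Gamma_I E], with the grading induced by that of [E i].  The
   values of [pi] outside the cocycles are irrelevant. *)
Definition is_local_cohomology I (i : nat) N M : Prop :=
  exists (E : graded_injective_resolution N) (pi : E i -> M),
    [/\ forall (a : S) x y, cocycle I x -> cocycle I y ->
          pi (a *: x + y) = a *: pi x + pi y,
        forall y, exists x, cocycle I x /\ pi x = y,
        forall x, cocycle I x -> (pi x = 0 <-> coboundary I x) &
        forall n y, mdegree n y <->
          exists x, [/\ cocycle I x, mdegree n x & pi x = y]].

End LocalCohomology.

Section Invariants.
Variables (A : comUnitRingType) (m : nat) (gT : finGroupType) (G : {group gT}).
Variable Phi : mx_representation A G m.

(* The [A]-algebra endomorphism whose matrix on the basis ['X_0, 'X_1, ...] of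
   the linear forms is [Phi g], with the coordinates of the image of ['X_j] in
   column [j]. *)
Definition linear_act (g : gT) (p : {mpoly A[m]}) : {mpoly A[m]} :=
  p \mPo [tuple \sum_(i < m) Phi g i j *: 'X_i | j < m].

Definition invariant : {pred {mpoly A[m]}} :=
  fun p => [forall g in G, linear_act g p == p].

Fact invariant_subring_closed : subring_closed invariant.
Proof.
split=> [|p q /forall_inP pG /forall_inP qG|p q /forall_inP pG /forall_inP qG];
  apply/forall_inP => g Gg; rewrite /linear_act.
- by rewrite comp_mpoly1.
- by rewrite comp_mpolyB -!/(linear_act g _) (eqP (pG g Gg)) (eqP (qG g Gg)).
- by rewrite rmorphM /= -!/(linear_act g _) (eqP (pG g Gg)) (eqP (qG g Gg)).
Qed.

HB.instance Definition _ :=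
  GRing.isSubringClosed.Build {mpoly A[m]} invariant invariant_subring_closed.

Record inv_ring := InvRing { inv_val : {mpoly A[m]}; _ : inv_val \in invariant }.

HB.instance Definition _ := [isSub for inv_val].
HB.instance Definition _ := [Choice of inv_ring by <:].
HB.instance Definition _ := [SubChoice_isSubComNzRing of inv_ring by <:].

Definition inv_deg (n : int) (p : inv_ring) : Prop :=
  match n with
  | Posz d => inv_val p \is d.-homog
  | Negz _ => p = 0
  end.

Fact linear_act_dhomogX g (u : 'X_{1..m}) :
  linear_act g 'X_[u] \is (mdeg u).-homog.
Proof.
rewrite /linear_act comp_mpolyX mdegE.
pose dt := [tuple u i | i < m].
pose mt := [tuple (\sum_(i < m) Phi g i j *: ('X_i : {mpoly A[m]})) ^+ u j | j < m].
rewrite [X in X \is _](_ : _ = \prod_(i <- mt) i); last first.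
  rewrite (eq_bigr (tnth mt)) ?big_tuple //.
  by move=> i _ /=; rewrite !tnth_mktuple.
rewrite [X in X.-homog](_ : _ = (\sum_(i <- dt) i)%N); last first.
  rewrite big_tuple (eq_bigr (tnth dt)) //.
  by move=> i _ /=; rewrite !tnth_mktuple.
apply/dhomog_prod => i; rewrite !tnth_mktuple.
rewrite -[X in X.-homog]mul1n; apply/dhomogMn/rpred_sum => j _.
by apply/rpredZ; rewrite dhomogX; apply/eqP/mdeg1.
Qed.

Fact pihomog_linear_act g d p :
  pihomog mdeg d (linear_act g p) = linear_act g (pihomog mdeg d p).
Proof.
rewrite /linear_act; elim/mpolyind: p; first by rewrite !linear0.
move=> c u p _ _ ihp; rewrite !linearP /= {}ihp.
congr (c *: _ + _).
have hu := linear_act_dhomogX g u; rewrite /linear_act in hu.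
case: (eqVneq (mdeg u) d) => ud.
  by rewrite -ud pihomog_dE // pihomog_dE // dhomogX.
by rewrite (pihomog_ne0 ud hu) (pihomog_ne0 ud) ?linear0 // dhomogX.
Qed.

Fact pihomog_invariant d p : p \in invariant -> pihomog mdeg d p \in invariant.
Proof.
move=> /forall_inP pG; apply/forall_inP => g Gg.
by rewrite -pihomog_linear_act (eqP (pG g Gg)).
Qed.

Fact inv_val_sum (T : Type) (r : seq T) (F : T -> inv_ring) :
  inv_val (\sum_(i <- r) F i) = \sum_(i <- r) inv_val (F i).
Proof. exact: (raddf_sum (val : inv_ring -> {mpoly A[m]})). Qed.

Fact inv_deg_sum : direct_sum inv_deg.
Proof.
split.
- by case=> d //=; rewrite dhomog0.
- case=> d p q /=; last by move=> -> ->; rewrite subr0.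
  by move=> hp hq; rewrite rpredB.
- move=> p; set N := mmeasure mdeg (inv_val p).
  pose c (n : int) : inv_ring :=
    if n is Posz d then InvRing (pihomog_invariant d (valP p)) else 0.
  exists [seq Posz d | d <- iota 0 N], c; split.
  + by rewrite map_inj_uniq ?iota_uniq // => x y [].
  + by case=> d //=; apply: pihomogP.
  + apply: val_inj; rewrite /= inv_val_sum big_map /=.
    have -> : iota 0 N = index_iota 0 N by rewrite /index_iota subn0.
    by rewrite big_mkord; apply: pihomog_partitionE.
- move=> r c r_uniq c_deg sum0 n n_r.
  case: n n_r (c_deg n) => d n_r; last by [].
  move=> /= c_d; apply: val_inj => /=.
  have /(congr1 (pihomog mdeg d)) : inv_val (\sum_(n <- r) c n) = 0.
    by rewrite sum0.
  rewrite inv_val_sum linear_sum linear0 (bigD1_seq (Posz d)) //=.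
  rewrite big1_seq ?addr0; first by rewrite pihomog_dE.
  case=> e /andP[ne _]; last by have /= -> := c_deg (Negz e); rewrite linear0.
  by have /= := c_deg (Posz e); apply: pihomog_ne0.
Qed.

Fact inv_deg1 : inv_deg 0 1.
Proof. exact: dhomog1. Qed.

Fact inv_degM k l p q : inv_deg k p -> inv_deg l q -> inv_deg (k + l) (p * q).
Proof.
case: k => k; last first.
  move=> /= ->; rewrite mul0r => _.
  by case: inv_deg_sum => + _ _ _; apply.
case: l => l /= hp; last first.
  move=> ->; rewrite mulr0.
  by case: inv_deg_sum => + _ _ _; apply.
by move=> hq; apply: dhomogM.
Qed.

Definition invariant_ring : gradedRing :=
  GradedRing inv_deg_sum inv_deg1 inv_degM.

End Invariants.

(* Main.v *)
Require Import Defs.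
From HB Require Import structures.
From mathcomp Require Import all_boot all_order all_algebra all_fingroup.
From mathcomp Require Import mxrepresentation.
From mathcomp Require Import mpoly.
From mathcomp Require Import generic_quotient boolp.
From mathcomp Require Import zify ring.

Import Order.TTheory GRing.Theory Num.Theory.
Local Open Scope ring_scope.
Set Implicit Arguments.
Unset Strict Implicit.
Unset Printing Implicit Defensive.

(** Write [R] for the polynomial ring and [S] for its invariants.  The bound in
    the statement is far from sharp: with [N = #|G|], vanishing of [M_n] for
    [-m - (N - 1) <= n <= N - 1] already forces [M = 0].

    Local cohomology is first made concrete.  Since [A] is noetherian, so are
    [R] (Hilbert) and [S] (the Reynolds operator splits [S] off [R]), and [I] is
    generated by finitely many homogeneous elements.  Over a noetherian ring a
    graded injective module [E] is divisible enough
    ([graded_injective_soft]) for [E -> E_f], and the same map on the torsion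
    submodules of [E], to be surjective on homogeneous elements.  Therefore
    the [I]-torsion of an injective resolution of [S] is quasi-isomorphic to
    the Cech complex of that resolution ([cech_acyc_gamma]), which is
    quasi-isomorphic to the Cech complex of [S] because localization is exact
    ([cone_map_quasi_iso]).  The Cech complex is built by iterating the cone of
    [C -> C_f].  It is a functor for all differential operators over [S], not
    only for linear maps, since a differential operator extends uniquely to a
    localization ([order_lt_ext_exists], [diffop_loc_ext]).

    Hence the operators on [R], namely multiplication by the variables ['X_j],
    the partial derivatives [d_j], the action of [G] and the Reynolds operator,
    act on the Cech complex of [R], which contains that of [S] as a direct
    factor, and every relation between them persists.  In particular the Euler
    operator [\sum_j 'X_j d_j] is multiplication by [n] in internal degree [n].

    The last step is a descent.  Let [x] be an invariant cocycle of degree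
    [n >= N] and assume that the cohomology of [S] vanishes in the degrees
    [n - 1, ..., n - N].  For [h] in [G], the product over [g] in [G] of the
    operators [d_(h g, j_g) - d_(1, j_g)], where [d_(g, j)] is the conjugate of
    [d_j] by [g], is zero, because it has a zero factor at [g = h^-1].
    Expanding the sum over [h] of these products, as in Benson's proof of the
    Fogarty-Benson theorem on invariants, writes [N] times any monomial of
    degree [N] in the [d_j] as a combination of invariant operators of positive
    degree, composed with other operators; so each such monomial sends [x] to a
    coboundary.  The Euler relation then lowers the degree of the monomials one
    by one: if all [d_j w] are coboundaries, so is [\sum_j 'X_j d_j w], a nonzero
    multiple of [w].  At the end [x] is a coboundary.  In the degrees
    [n <= -m - N] the same argument applies with ['X_j] and [d_j] exchanged, as
    [\sum_j d_j 'X_j] is multiplication by [n + m] ([descent],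
    [window_acyc]). *)

(** * Localization of a module at an element *)

Section Localization.
Variables (S : comNzRingType) (f : S) (V : lmodType S).

(** The pair [(n, x)] stands for the fraction [x / f ^+ n]. *)
Definition frac_rel (a b : nat * V) : bool :=
  `[< exists k, f ^+ (k + b.1) *: a.2 = f ^+ (k + a.1) *: b.2 >].

Fact frac_rel_equiv : equiv_class_of frac_rel.
Proof.
split=> [a|a b|b a c]; first by apply/asboolP; exists 0%N.
- by apply/asboolP/asboolP => -[k e]; exists k.
move=> /asboolP[k e] /asboolP[l e']; apply/asboolP.
exists (k + l + b.1)%N.
transitivity (f ^+ (l + c.1) *: (f ^+ (k + b.1) *: a.2)).
  by rewrite scalerA -exprD; congr (f ^+ _ *: _); lia.
rewrite e scalerA mulrC -scalerA e' scalerA -exprD.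
by congr (f ^+ _ *: _); lia.
Qed.

Canonical frac_equiv := EquivRelPack frac_rel_equiv.

(** The localization of the module [V] at the powers of [f]. *)
Definition Loc := {eq_quot frac_equiv}%qT.
HB.instance Definition _ := Choice.on Loc.

(** The fraction [x / f ^+ n]. *)
Definition frac (n : nat) (x : V) : Loc := (\pi_({eq_quot frac_equiv}) (n, x))%qT.

Lemma frac_eqP n k x y :
  frac n x = frac k y <-> exists l, f ^+ (l + k) *: x = f ^+ (l + n) *: y.
Proof.
rewrite /frac; split.
  by move/eqquotP => /asboolP.
by move=> h; apply/eqquotP/asboolP.
Qed.

Lemma fracW (a : Loc) : exists n x, a = frac n x.
Proof.
exists (repr a).1, (repr a).2; rewrite /frac -surjective_pairing.
by rewrite reprK.
Qed.

Lemma frac_expand k n x : frac n x = frac (n + k) (f ^+ k *: x).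
Proof.
by apply/frac_eqP; exists 0%N; rewrite scalerA -exprD.
Qed.

Lemma frac2W (a b : Loc) : exists n x y, a = frac n x /\ b = frac n y.
Proof.
have [n [x ->]] := fracW a; have [k [y ->]] := fracW b.
exists (n + k)%N, (f ^+ k *: x), (f ^+ n *: y).
by rewrite -frac_expand addnC -frac_expand.
Qed.

Definition loc_add (a b : Loc) : Loc :=
  frac ((repr a).1 + (repr b).1)
       (f ^+ (repr b).1 *: (repr a).2 + f ^+ (repr a).1 *: (repr b).2).
Definition loc_scale (s : S) (a : Loc) : Loc :=
  frac (repr a).1 (s *: (repr a).2).

Lemma frac_repr n x :
  exists l, f ^+ (l + n) *: (repr (frac n x)).2 = f ^+ (l + (repr (frac n x)).1) *: x.
Proof.
have : frac (repr (frac n x)).1 (repr (frac n x)).2 = frac n x.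
  by rewrite /frac -surjective_pairing reprK.
by move/frac_eqP.
Qed.

Lemma loc_addE n x y : loc_add (frac n x) (frac n y) = frac n (x + y).
Proof.
rewrite /loc_add.
have [l] := frac_repr n x; have [k] := frac_repr n y.
case: (repr (frac n x)) => n1 x1; case: (repr (frac n y)) => n2 y2 /= ey ex.
apply/frac_eqP; exists (l + k + n)%N; rewrite !scalerDr !scalerA -!exprD.
congr (_ + _).
- transitivity (f ^+ (k + n + n2) *: (f ^+ (l + n) *: x1)).
    by rewrite scalerA -exprD; congr (f ^+ _ *: _); lia.
  by rewrite ex scalerA -exprD; congr (f ^+ _ *: _); lia.
- transitivity (f ^+ (l + n + n1) *: (f ^+ (k + n) *: y2)).
    by rewrite scalerA -exprD; congr (f ^+ _ *: _); lia.
  by rewrite ey scalerA -exprD; congr (f ^+ _ *: _); lia.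
Qed.

Lemma loc_scaleE s n x : loc_scale s (frac n x) = frac n (s *: x).
Proof.
rewrite /loc_scale; have [l] := frac_repr n x.
case: (repr (frac n x)) => n1 x1 /= ex.
by apply/frac_eqP; exists l; rewrite scalerA mulrC -scalerA ex scalerA mulrC -scalerA.
Qed.

Lemma loc_addA : associative loc_add.
Proof.
move=> a b c; have [n [x [y [-> ->]]]] := frac2W a b.
have [k [z ->]] := fracW c.
rewrite (frac_expand k n x) (frac_expand k n y) (frac_expand n k z) (addnC k).
by rewrite !loc_addE addrA.
Qed.
Lemma loc_addC : commutative loc_add.
Proof.
by move=> a b; have [n [x [y [-> ->]]]] := frac2W a b; rewrite !loc_addE addrC.
Qed.
Lemma loc_add0 : left_id (frac 0 0) loc_add.
Proof.
move=> a; have [n [x ->]] := fracW a.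
by rewrite (frac_expand n 0) scaler0 add0n loc_addE add0r.
Qed.
Lemma loc_addN : left_inverse (frac 0 0) (loc_scale (-1)) loc_add.
Proof.
move=> a; have [n [x ->]] := fracW a; rewrite loc_scaleE loc_addE scaleN1r addNr.
by rewrite (frac_expand n 0) scaler0.
Qed.
HB.instance Definition _ :=
  GRing.isZmodule.Build Loc loc_addA loc_addC loc_add0 loc_addN.

Lemma loc_scaleA s t a : loc_scale s (loc_scale t a) = loc_scale (s * t) a.
Proof. by have [n [x ->]] := fracW a; rewrite !loc_scaleE scalerA. Qed.
Lemma loc_scale1 : left_id 1 loc_scale.
Proof. by move=> a; have [n [x ->]] := fracW a; rewrite !loc_scaleE scale1r. Qed.
Lemma loc_scaleDr : right_distributive loc_scale +%R.
Proof.
move=> s a b; have [n [x [y [-> ->]]]] := frac2W a b.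
by rewrite [LHS](congr1 (loc_scale s) (loc_addE n x y)) !loc_scaleE scalerDr
  -[RHS]/(loc_add _ _) loc_addE.
Qed.
Lemma loc_scaleDl a : {morph loc_scale^~ a : s t / s + t}.
Proof.
move=> s t; have [n [x ->]] := fracW a.
by rewrite !loc_scaleE scalerDl -[RHS]/(loc_add _ _) loc_addE.
Qed.
HB.instance Definition _ := GRing.Zmodule_isLmodule.Build S Loc
  loc_scaleA loc_scale1 loc_scaleDr loc_scaleDl.

Lemma fracD n x y : frac n x + frac n y = frac n (x + y).
Proof. exact: loc_addE. Qed.
Lemma fracZ s n x : s *: frac n x = frac n (s *: x).
Proof. exact: loc_scaleE. Qed.
Lemma frac0 n : frac n 0 = 0.
Proof.
have := fracZ 0 n (0 : V); rewrite scaler0 => <-; exact: scale0r.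
Qed.

(** The localization map, [x] to [x / 1]. *)
Definition eta (x : V) : Loc := frac 0 x.
Fact eta_linear : linear eta.
Proof. by move=> s x y; rewrite /eta fracZ fracD. Qed.
HB.instance Definition _ := GRing.isLinear.Build S V Loc _ eta eta_linear.

Lemma etaD x y : eta (x + y) = eta x + eta y. Proof. exact: linearD. Qed.
Lemma etaB x y : eta (x - y) = eta x - eta y. Proof. exact: linearB. Qed.
Lemma etaZ s x : eta (s *: x) = s *: eta x. Proof. exact: linearZ. Qed.
Lemma eta0 : eta 0 = 0. Proof. exact: linear0. Qed.

Lemma eta_eq0 x : eta x = 0 <-> exists k, f ^+ k *: x = 0.
Proof.
rewrite -(frac0 0) /eta; split=> [/frac_eqP[k]|[k e]].
  by rewrite addn0 scaler0; exists k.
by apply/frac_eqP; exists k; rewrite addn0 scaler0.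
Qed.

Lemma frac_div n x : f ^+ n *: frac n x = eta x.
Proof.
by rewrite fracZ /eta; apply/frac_eqP; exists 0%N; rewrite addn0 expr0 scale1r.
Qed.

Lemma fracS n x : f *: frac n.+1 x = frac n x.
Proof. by rewrite fracZ (frac_expand 1 n) addn1. Qed.

Lemma locW (a : Loc) : exists k x, f ^+ k *: a = eta x.
Proof. by have [n [x ->]] := fracW a; exists n, x; rewrite frac_div. Qed.

Lemma locf_inj (a : Loc) : f *: a = 0 -> a = 0.
Proof.
have [n [x ->]] := fracW a; rewrite fracZ => h.
have : eta (f *: x) = 0 by rewrite -(frac_div n) h scaler0.
move=> /eta_eq0[k e]; rewrite -(frac0 n); apply/frac_eqP; exists k.+1.
by rewrite scaler0 addSn addnC exprSr -scalerA exprD -scalerA e scaler0.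
Qed.

Lemma locfX_inj k (a : Loc) : f ^+ k *: a = 0 -> a = 0.
Proof.
by elim: k a => [|k IH] a; rewrite ?expr0 ?scale1r // exprSr -scalerA => /IH/locf_inj.
Qed.

(** The inverse of the multiplication by [f], which is bijective on [Loc]. *)
Definition locdiv (a : Loc) : Loc :=
  frac (repr a).1.+1 (repr a).2.
Lemma locdivK (a : Loc) : f *: locdiv a = a.
Proof. by rewrite /locdiv fracS /frac -surjective_pairing reprK. Qed.
End Localization.

(** * Differential operators *)

Lemma subrACA (V : zmodType) (a b c d : V) : a - b - (c - d) = a - c - (b - d).
Proof. by rewrite !opprB addrACA [RHS]addrACA (addrC (- b)). Qed.

Section DiffOp.
Variable S : comNzRingType.

(** [phi] is an additive differential operator of order less than [k] over [S]:
    zero for [k = 0]; for [k + 1], additive with all commutators with the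
    scalars of [S] of order less than [k].  Order less than 1 means linear. *)
Fixpoint order_lt (k : nat) (V W : lmodType S) (phi : V -> W) : Prop :=
  if k is k'.+1 then
    (forall x y, phi (x + y) = phi x + phi y) /\
    forall s, order_lt k' (fun x => phi (s *: x) - s *: phi x)
  else forall x, phi x = 0.

Lemma order_ltD_arg k (V W : lmodType S) (phi : V -> W) : order_lt k phi ->
  forall x y, phi (x + y) = phi x + phi y.
Proof. by case: k => [|k] /= => [h x y|[]//]; rewrite !h addr0. Qed.

Lemma order_lt_S k (V W : lmodType S) (phi : V -> W) : order_lt k phi ->
  order_lt k.+1 phi.
Proof.
elim: k phi => [|k IH] phi.
  move=> h; split=> [x y|s x] /=; first by rewrite !h addr0.
  by rewrite !h scaler0 subr0.
by case=> hD h; split=> [|s]; [exact: hD|apply: IH; exact: h].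
Qed.

Lemma order_lt_leq k l (V W : lmodType S) (phi : V -> W) :
  (k <= l)%N -> order_lt k phi -> order_lt l phi.
Proof.
move=> /subnKC <-; elim: (l - k)%N => [|n IH]; first by rewrite addn0.
by rewrite addnS => h; apply/order_lt_S/IH.
Qed.

Lemma order_lt_lincomb k (V W : lmodType S) (a : S) (phi psi : V -> W) :
  order_lt k phi -> order_lt k psi -> order_lt k (fun x => phi x + a *: psi x).
Proof.
elim: k phi psi => [|k IH] phi psi /=.
  by move=> h h' x; rewrite h h' scaler0 addr0.
move=> [D1 h1] [D2 h2]; split=> [x y|s].
  by rewrite D1 D2 scalerDr addrACA.
have := IH _ _ (h1 s) (h2 s); congr order_lt; apply: funext => x.
rewrite !scalerBr scalerDr opprD addrACA; congr (_ + (_ - _)).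
by rewrite !scalerA mulrC.
Qed.

Lemma order_lt_comp k l (U V W : lmodType S) (psi : V -> W) (phi : U -> V) :
  order_lt k psi -> order_lt l phi -> order_lt (k + l) (psi \o phi).
Proof.
have [n] := ubnP (k + l); elim: n k l psi phi => // n IH k l psi phi.
case: k => [_ h _|k]; first by apply: (@order_lt_leq 0) => // x; rewrite /= h.
case: l => [_ hpsi hphi|l].
  rewrite addn0; apply: (@order_lt_leq 0) => // x /=; rewrite hphi.
  by apply: (@addIr _ (psi 0)); rewrite -(order_ltD_arg hpsi) !add0r.
rewrite addSn addnS => lt_n [D1 h1] [D2 h2].
split=> [x y|s] /=; first by rewrite D2 D1.
have lt1 : (k + l.+1 < n)%N by lia.
have lt2 : (k.+1 + l < n)%N by lia.
have a1 := IH k l.+1 _ _ lt1 (h1 s) (conj D2 h2).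
have a2 := IH k.+1 l _ _ lt2 (conj D1 h1) (h2 s).
rewrite addnS in a1; rewrite addSn in a2.
have h := order_lt_lincomb 1 a1 a2.
move: h; congr (order_lt _ _); apply: funext => x /=.
rewrite scale1r addrAC -D1; congr (psi _ - _).
by rewrite addrC subrK.
Qed.

Lemma order_lt_linear (V W : lmodType S) (phi : {linear V -> W}) : order_lt 1 phi.
Proof. by split=> [x y|s x] /=; rewrite ?linearD // linearZ subrr. Qed.

(** Differential operators of some finite order. *)
Definition diffop (V W : lmodType S) (phi : V -> W) := exists k, order_lt k phi.

Lemma diffop_comp (U V W : lmodType S) (psi : V -> W) (phi : U -> V) :
  diffop psi -> diffop phi -> diffop (psi \o phi).
Proof. by move=> [k h] [l h']; exists (k + l)%N; apply: order_lt_comp. Qed.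

Lemma diffop_lincomb (V W : lmodType S) (a : S) (phi psi : V -> W) :
  diffop phi -> diffop psi -> diffop (fun x => phi x + a *: psi x).
Proof.
move=> [k h] [l h']; exists (k + l)%N.
by apply: order_lt_lincomb; [apply: order_lt_leq h|apply: order_lt_leq h']; lia.
Qed.

Lemma diffop_linear (V W : lmodType S) (phi : {linear V -> W}) : diffop phi.
Proof. by exists 1%N; apply: order_lt_linear. Qed.

Lemma diffopD (V W : lmodType S) (phi : V -> W) : diffop phi ->
  {morph phi : x y / x + y}.
Proof. by case=> k /order_ltD_arg. Qed.
Lemma diffop0 (V W : lmodType S) (phi : V -> W) : diffop phi -> phi 0 = 0.
Proof.
by move=> /diffopD D; apply: (@addIr _ (phi 0)); rewrite -D !add0r.
Qed.

Lemma diffop_comm (V W : lmodType S) (phi : V -> W) s : diffop phi ->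
  diffop (fun x => phi (s *: x) - s *: phi x).
Proof.
by case=> k /order_lt_S[_ h]; exists k; exact: h.
Qed.

Section LocMap.
Variable f : S.

Lemma loc_comm0 (V W : lmodType S) (w : Loc f V -> W) :
  (forall y, f *: y = 0 :> W -> y = 0) -> (forall a, w (f *: a) = f *: w a) ->
  (forall x, w (eta f x) = 0) -> forall a, w a = 0.
Proof.
move=> inj wf w0 a; have [n [x e]] := locW a.
move: e; elim: n a => [|n IHn] a; first by rewrite scale1r => ->.
by rewrite exprSr -scalerA => /IHn; rewrite wf; apply: inj.
Qed.

(** Uniqueness of the extension of a differential operator to a localization:
    the commutator of [w] with [f] has lower order and also vanishes on the
    image of [eta], so [w] commutes with [f]. *)
Lemma order_lt_loc0 k (V W : lmodType S) (w : Loc f V -> W) :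
  (forall y, f *: y = 0 :> W -> y = 0) -> order_lt k w ->
  (forall x, w (eta f x) = 0) -> forall a, w a = 0.
Proof.
move=> inj; elim: k w => [|k IH] w //= [D h] w0.
apply: loc_comm0 => // a.
apply/eqP; rewrite -subr_eq0; apply/eqP; apply: (IH _ (h f)) => x /=.
by rewrite w0 scaler0 subr0 -linearZ w0.
Qed.

Lemma diffop_loc_ext (V W : lmodType S) (p q : Loc f V -> Loc f W) :
  diffop p -> diffop q -> (forall x, p (eta f x) = q (eta f x)) -> p =1 q.
Proof.
move=> hp hq e a.
have [k h] := diffop_lincomb (-1) hp hq.
apply/eqP; rewrite -subr_eq0 -scaleN1r; apply/eqP.
apply: (order_lt_loc0 _ h) => [y|x]; first exact: locf_inj.
by rewrite scaleN1r e subrr.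
Qed.

Lemma locdivD (V : lmodType S) (a b : Loc f V) : locdiv (a + b) = locdiv a + locdiv b.
Proof.
apply/eqP; rewrite -subr_eq0; apply/eqP/locf_inj.
by rewrite scalerBr scalerDr !locdivK subrr.
Qed.

Lemma locdiv_eq (V : lmodType S) (a b : Loc f V) : f *: a = b -> a = locdiv b.
Proof.
move=> <-; apply/eqP; rewrite -subr_eq0; apply/eqP/locf_inj.
by rewrite scalerBr !locdivK subrr.
Qed.

(** Existence, by induction on the order: the extension has to satisfy
    [phi' (f b) = f phi' b + psi_f b], where [psi_f] extends the commutator of
    [phi] with [f], and this determines it on [x / f ^+ n] by recursion on
    [n]. *)
Lemma order_lt_ext_exists k (V W : lmodType S) (phi : V -> W) : order_lt k phi ->
  exists phi' : Loc f V -> Loc f W, order_lt k phi' /\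
     forall x, phi' (eta f x) = eta f (phi x).
Proof.
elim: k V W phi => [|k IH] V W phi.
  by move=> h; exists (fun=> 0); split=> // x; rewrite h linear0.
move=> [D h].
have [psi psiP] := choice (fun s => IH _ _ _ (h s)).
have psid s : diffop (psi s) by exists k; case: (psiP s).
have psie s x : psi s (eta f x) = eta f (phi (s *: x) - s *: phi x).
  by case: (psiP s).
(* [F n x] is the value at [x / f ^+ n] *)
pose F := fix F (n : nat) (x : V) {struct n} : Loc f W := if n is n'.+1
  then locdiv (F n' x - psi f (frac f n'.+1 x)) else eta f (phi x).
have FS n x : F n.+1 (f *: x) = F n x.
  elim: n => [|n IHn].
    symmetry; apply: locdiv_eq => /=.
    have -> : frac f 1 (f *: x) = eta f x by rewrite -fracZ fracS.
    by rewrite psie -linearB opprB addrC subrK linearZ.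
  by rewrite [LHS]/= -/(F n.+1 (f *: x)) IHn -fracZ fracS.
have FX n k' x : F (k' + n)%N (f ^+ k' *: x) = F n x.
  elim: k' => [|k' IHk]; first by rewrite scale1r.
  by rewrite exprS -scalerA addSn FS.
have FD n x y : F n (x + y) = F n x + F n y.
  elim: n => [|n IHn] /=; first by rewrite D linearD.
  rewrite IHn -fracD (diffopD (psid f)) -locdivD; congr locdiv.
  by rewrite opprD addrACA.
pose phi' (a : Loc f V) := F (repr a).1 (repr a).2.
have phi'E n x : phi' (frac f n x) = F n x.
  rewrite /phi'; have [l] := frac_repr f n x.
  set n1 := (repr _).1; set x1 := (repr _).2 => e.
  by rewrite -(FX n1 (l + n)%N) e addnAC -(FX n (l + n1)%N).
have phi'D a b : phi' (a + b) = phi' a + phi' b.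
  by have [n [x [y [-> ->]]]] := frac2W a b; rewrite fracD !phi'E FD.
have phi'e x : phi' (eta f x) = eta f (phi x) by rewrite phi'E.
have phi'f a : phi' (f *: a) = f *: phi' a + psi f a.
  have [n [x ->]] := fracW a.
  rewrite (frac_expand f 1 n) addn1 expr1 fracS !phi'E /= locdivK.
  by rewrite subrK.
exists phi'; split=> //.
split=> // s.
(* [w] vanishes on the image of [eta] and commutes with [f] *)
pose w a := phi' (s *: a) - s *: phi' a - psi s a.
suff w0 a : w a = 0.
  case: (psiP s) => + _; congr order_lt; apply: funext => a.
  by apply/esym/eqP; rewrite -subr_eq0; apply/eqP/w0.
apply: loc_comm0; first exact: locf_inj.
  (* the commutators of [psi f] with [s] and of [psi s] with [f] agree *)
  have comm : (fun a => psi f (s *: a) - s *: psi f a) =1 (fun a =>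
    psi s (f *: a) - f *: psi s a).
    apply: diffop_loc_ext => [||x]; [exact: diffop_comm|exact: diffop_comm|].
    rewrite /= -!linearZ !psie -!linearZ -!linearB !scalerBr !scalerA.
    by rewrite (mulrC f s) subrACA /= !scalerA (mulrC s f).
  move=> b; rewrite /w scalerA mulrC -scalerA !phi'f.
  have -> : psi f (s *: b) = s *: psi f b + (psi s (f *: b) - f *: psi s b).
    by rewrite -(comm b) addrC subrK.
  rewrite !scalerBr scalerDr (scalerA s) (mulrC s) -scalerA.
  move: (f *: phi' _) (s *: psi f b) (psi s _) (f *: (s *: _)) (f *: psi s b).
  move=> p q r t u.
  rewrite opprD !addrA [LHS](ACl (1*5*4*(2*6)*(3*7)))%AC /=.
  by rewrite !subrr !addr0.
by move=> x; rewrite /w psie -etaZ !phi'e etaB etaZ subrr.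
Qed.
End LocMap.
End DiffOp.

(** * Extension of differential operators to localizations *)

Section LocMapDef.
Variables (S : comNzRingType) (f : S).

(** The extension of a differential operator to the localizations; it has no
    meaning for maps that are not differential operators. *)
Definition locmap (V W : lmodType S) (phi : V -> W) : Loc f V -> Loc f W :=
  if pselect (exists phi' : Loc f V -> Loc f W,
     diffop phi' /\ forall x, phi' (eta f x) = eta f (phi x)) is left h
  then projT1 (cid h) else fun=> 0.

Lemma locmapP (V W : lmodType S) (phi : V -> W) : diffop phi ->
  diffop (locmap phi) /\ forall x, locmap phi (eta f x) = eta f (phi x).
Proof.
move=> [k /order_lt_ext_exists-/(_ f)[phi' [h e]]]; rewrite /locmap.
case: pselect => [h'|[]]; first exact: (projT2 (cid h')).
by exists phi'; split=> //; exists k.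
Qed.

Lemma diffop_locmap (V W : lmodType S) (phi : V -> W) : diffop phi -> diffop (locmap phi).
Proof. by case/locmapP. Qed.
Lemma locmap_eta (V W : lmodType S) (phi : V -> W) : diffop phi ->
  forall x, locmap phi (eta f x) = eta f (phi x).
Proof. by case/locmapP. Qed.

Lemma diffop_id (V : lmodType S) : diffop (@id V).
Proof. by exists 1%N; split=> // s x; rewrite subrr. Qed.

Lemma locmap_id (V : lmodType S) : locmap (@id V) =1 id.
Proof.
apply: diffop_loc_ext; [exact/diffop_locmap/diffop_id|exact: diffop_id|].
by move=> x; rewrite locmap_eta //; apply: diffop_id.
Qed.

Lemma locmap_comp (U V W : lmodType S) (psi : V -> W) (phi : U -> V) :
  diffop psi -> diffop phi -> locmap (psi \o phi) =1 locmap psi \o locmap phi.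
Proof.
move=> h h'; apply: diffop_loc_ext.
- exact/diffop_locmap/diffop_comp.
- by apply: diffop_comp; apply: diffop_locmap.
by move=> x; rewrite /= !locmap_eta //; apply: diffop_comp.
Qed.

Lemma locmap_lincomb (V W : lmodType S) a (phi psi : V -> W) :
  diffop psi -> diffop phi -> locmap (fun x => phi x + a *: psi x) =1
    fun x => locmap phi x + a *: locmap psi x.
Proof.
move=> h h'; apply: diffop_loc_ext.
- exact/diffop_locmap/diffop_lincomb.
- by apply: diffop_lincomb; apply: diffop_locmap.
by move=> x; rewrite /= !locmap_eta // ?etaD ?etaZ //; apply: diffop_lincomb.
Qed.

Lemma eq_locmap (V W : lmodType S) (phi psi : V -> W) :
  phi =1 psi -> locmap phi =1 locmap psi.
Proof. by move=> /funext ->. Qed.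

Lemma order_lt1P (V W : lmodType S) (phi : V -> W) : order_lt 1 phi <-> linear phi.
Proof.
split=> [[D h] a x y|h].
  by rewrite D; congr (_ + _); apply/eqP; rewrite -subr_eq0 h.
have D x y : phi (x + y) = phi x + phi y by have := h 1 x y; rewrite !scale1r.
have p0 : phi 0 = 0 by apply: (@addIr _ (phi 0)); rewrite -D !add0r.
by split=> // s x; have := h s x 0; rewrite p0 !addr0 => ->; rewrite subrr.
Qed.

Lemma order_lt1_diffop (V W : lmodType S) (phi : V -> W) : order_lt 1 phi -> diffop phi.
Proof. by exists 1%N. Qed.
Lemma order_lt1Z (V W : lmodType S) (phi : V -> W) : order_lt 1 phi ->
  forall s x, phi (s *: x) = s *: phi x.
Proof.
by move=> [_ h] s x; apply/eqP; rewrite -subr_eq0 h.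
Qed.

Lemma locmap_order_lt1 (V W : lmodType S) (phi : V -> W) : order_lt 1 phi ->
  order_lt 1 (locmap phi).
Proof.
move=> h; have [phi' [h' e]] := order_lt_ext_exists f h.
suff /funext -> : locmap phi =1 phi' by [].
have hd := order_lt1_diffop h.
apply: diffop_loc_ext; [exact: diffop_locmap|exact: order_lt1_diffop|].
by move=> x; rewrite e locmap_eta.
Qed.
End LocMapDef.
Arguments locmap {S} f {V W} phi.
Arguments locmapP {S} f {V W phi}.
Arguments diffop_locmap {S} f {V W phi}.
Arguments locmap_order_lt1 {S} f {V W phi}.

(** * Bigraded complexes *)

(** A homogeneous element, together with its degree. *)
Record homElt (S : gradedRing) := HomElt {
  elt_val :> S;
  elt_deg : int;
  elt_degP : rdeg elt_deg elt_val }.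

(** A complex of graded modules, presented as one module [cV] with a
    differential [cd].  [cdeg p n] holds for the elements of cohomological
    degree [p] and internal degree [n].  The module need not be the sum of these
    pieces, and only bihomogeneous elements matter, so that a subcomplex
    is obtained by shrinking [cdeg] without changing the module. *)
Record cplx (S : gradedRing) := Cplx {
  cV :> lmodType S;
  cd : {linear cV -> cV};
  cdeg : int -> int -> cV -> Prop;
  cdd : forall x, cd (cd x) = 0;
  cdeg0 : forall p n, cdeg p n 0;
  cdegB : forall p n x y, cdeg p n x -> cdeg p n y -> cdeg p n (x - y);
  cdegZ : forall p n k s x, rdeg k s -> cdeg p n x -> cdeg p (n + k) (s *: x);
  cdegd : forall p n x, cdeg p n x -> cdeg (p + 1) n (cd x)
}.
Arguments cd {S C} : rename.
Arguments cdeg {S} C p n : rename.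

Section Cplx.
Variable S : gradedRing.
Implicit Types (C D : cplx S) (f : homElt S).

Lemma cdegN C p n x : cdeg C p n x -> cdeg C p n (- x).
Proof. by rewrite -sub0r; apply/cdegB/cdeg0. Qed.
Lemma rdegX k (s : S) j : rdeg k s -> rdeg (j%:Z * k) (s ^+ j).
Proof.
move=> h; elim: j => [|j IH]; first by rewrite mul0r expr0; apply: rdeg1.
by rewrite exprS intS mulrDl mul1r; apply: rdegM.
Qed.

Lemma cdegX C p n f j x : cdeg C p n x ->
  cdeg C p (n + j%:Z * elt_deg f) (elt_val f ^+ j *: x).
Proof. by move=> h; apply: cdegZ => //; apply/rdegX/elt_degP. Qed.

(** Bidegrees in the localization: [y = x / f ^+ k] with [x] of the right degree. *)
Definition ldeg f C p n (y : Loc f C) : Prop :=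
  exists k x, cdeg C p (n + k%:Z * elt_deg f) x /\ elt_val f ^+ k *: y = eta f x.

Lemma ldeg_raise f C p n y k j x :
  cdeg C p (n + k%:Z * elt_deg f) x -> elt_val f ^+ k *: y = eta f x ->
  cdeg C p (n + (j + k)%:Z * elt_deg f) (elt_val f ^+ j *: x) /\ elt_val f ^+ (j + k)
    *: y = eta f (elt_val f ^+ j *: x).
Proof.
move=> h e; split; last by rewrite exprD -scalerA e etaZ.
by rewrite PoszD mulrDl addrA addrAC; apply: cdegX.
Qed.

Lemma ldeg0 f C p n : ldeg p n (0 : Loc f C).
Proof. by exists 0%N, 0; split; [apply: cdeg0|rewrite scaler0 eta0]. Qed.

Lemma ldegB f C p n (y z : Loc f C) : ldeg p n y -> ldeg p n z -> ldeg p n (y - z).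
Proof.
move=> [k [x [h e]]] [l [w [h' e']]].
have [a1 a2] := ldeg_raise l h e; have [b1 b2] := ldeg_raise k h' e'.
exists (l + k)%N, (elt_val f ^+ l *: x - elt_val f ^+ k *: w); split.
  by apply: cdegB => //; rewrite addnC.
by rewrite scalerBr a2 etaB addnC b2.
Qed.

Lemma ldegN f C p n (y : Loc f C) : ldeg p n y -> ldeg p n (- y).
Proof. by move=> h; rewrite -[- y]sub0r; apply: ldegB => //; apply: ldeg0. Qed.

Lemma ldegZ f C p n k s (y : Loc f C) :
  rdeg k s -> ldeg p n y -> ldeg p (n + k) (s *: y).
Proof.
move=> hs [l [w [h' e']]]; exists l, (s *: w); split.
  by rewrite addrAC; apply: cdegZ.
by rewrite scalerA mulrC -scalerA e' etaZ.
Qed.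

Lemma ldeg_eta f C p n x : cdeg C p n x -> ldeg p n (eta f x : Loc f C).
Proof. by move=> h; exists 0%N, x; rewrite mul0r addr0 scale1r. Qed.

Lemma ldeg_f f C p n (y : Loc f C) : ldeg p (n + elt_deg f) (elt_val f *: y) ->
  ldeg p n y.
Proof.
move=> [k [x [h e]]]; exists k.+1, x; split; last by rewrite exprSr -scalerA.
by rewrite intS mulrDl mul1r addrA.
Qed.

(** Differential operators of internal degree [e] that commute with the
    differentials. *)
Definition graded_op C D (e : int) (phi : C -> D) : Prop :=
  [/\ diffop phi, forall x, phi (cd x) = cd (phi x) &
      forall p n x, cdeg C p n x -> cdeg D p (n + e) (phi x)].

(** The extension to the localization keeps the degree: by induction on the
    order, [f phi' y = phi' (f y) - psi' y] where the commutator [psi] of [phi]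
    with [f] has lower order and degree [e + deg f]. *)
Lemma locmap_deg f C D p p' e k (phi : C -> D) : order_lt k phi ->
  (forall n x, cdeg C p n x -> cdeg D p' (n + e) (phi x)) ->
  forall n (y : Loc (elt_val f) C), ldeg p n y ->
    ldeg p' (n + e) (locmap (elt_val f) phi y).
Proof.
elim: k phi e => [|k IH] phi e h hdg n y.
  move=> _; have [_ e'] := locmapP (elt_val f) (ex_intro _ 0%N h).
  suff -> : locmap (elt_val f) phi y = 0 by apply: ldeg0.
  have : locmap (elt_val f) phi =1 fun=> 0.
    apply: diffop_loc_ext; [by apply: diffop_locmap; exists 0%N|by exists 0%N|].
    by move=> x; rewrite e' h eta0.
  by move=> ->.
have hd : diffop phi by exists k.+1.
move=> [l [x [hx ex]]]; elim: l n y hx ex => [|l IHl] n y.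
  rewrite mul0r addr0 scale1r => hx ->; rewrite locmap_eta //.
  exact/ldeg_eta/hdg.
move=> hx ex; apply: ldeg_f.
pose psi x := phi (elt_val f *: x) - elt_val f *: phi x.
have hpsi : diffop psi by apply: diffop_comm.
have -> : elt_val f *: locmap (elt_val f) phi y = locmap (elt_val f) phi (elt_val f *:
  y) - locmap (elt_val f) psi y.
  apply/eqP; rewrite -subr_eq0 -scaleN1r; apply/eqP.
  have : (fun y => elt_val f *: locmap (elt_val f) phi y - (locmap (elt_val f) phi
    (elt_val f *: y) + -1 *: locmap (elt_val f) psi y))
    =1 fun=> 0; last by move=> /(_ y); rewrite scaleN1r.
  have z : diffop (fun y => elt_val f *: locmap (elt_val f) phi y).
    apply: (diffop_comp (psi := fun z => elt_val f *: z)); last exact: diffop_locmap.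
    exact: (diffop_linear (GRing.scale (elt_val f))).
  have z' : diffop (fun y => locmap (elt_val f) phi (elt_val f *: y)).
    apply: (diffop_comp (phi := fun z => elt_val f *: z)); first exact: diffop_locmap.
    exact: (diffop_linear (GRing.scale (elt_val f))).
  have z2 := diffop_lincomb (-1) z' (diffop_locmap (elt_val f) hpsi).
  have z3 := diffop_lincomb (-1) z z2.
  apply: diffop_loc_ext; last first.
  - move=> w; rewrite scaleN1r -etaZ !locmap_eta // -etaB -etaZ -etaB /psi.
    by rewrite subKr subrr eta0.
  - by exists 0%N.
  by move: z3; congr diffop; apply: funext => w; rewrite scaleN1r.
apply: ldegB.
  rewrite -addrA (addrC e) addrA; apply: IHl.
    by move: hx; rewrite intS mulrDl mul1r addrA.
  by rewrite scalerA -exprSr.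
rewrite -addrA. apply: (IH psi (e + elt_deg f)).
- by case: h => _ /(_ (elt_val f)).
- move=> n' x' h'; rewrite addrA; apply: cdegB.
    by rewrite addrAC; apply/hdg/cdegZ => //; apply: elt_degP.
  by apply: cdegZ; [apply: elt_degP|apply: hdg].
by exists l.+1, x.
Qed.
End Cplx.

(** * The cone of a complex over its localization *)

Section Cone.
Variables (S : gradedRing) (f : homElt S) (C : cplx S).
Notation LC := (Loc (elt_val f) C).

Definition cone_car : lmodType S := (C * LC)%type.
(** The differential of the localized complex. *)
Definition locd : LC -> LC := locmap (elt_val f) cd.
Lemma order_lt_cd : order_lt 1 (cd : C -> C). Proof. exact: order_lt_linear. Qed.
Lemma locd_linear : linear locd.
Proof. exact/order_lt1P/locmap_order_lt1/order_lt_cd. Qed.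
Lemma locd_eta x : locd (eta (elt_val f) x) = eta (elt_val f) (cd x).
Proof. exact/locmap_eta/order_lt1_diffop/order_lt_cd. Qed.
Lemma locdd y : locd (locd y) = 0.
Proof.
rewrite -[LHS]/((locd \o locd) y) -(locmap_comp (f := elt_val f));
  try exact/order_lt1_diffop/order_lt_cd.
have -> : cd \o cd = (fun _ => 0) :> (C -> C) by apply: funext => x; apply: cdd.
have h : diffop (fun _ : C => 0 : C) by exists 0%N.
suff -> : locmap (elt_val f) (fun _ : C => 0 : C) y = 0 by [].
have /(_ y) -> // : locmap (elt_val f) (fun _ : C => 0 : C) =1 fun=> 0.
apply: diffop_loc_ext; [exact: diffop_locmap|by exists 0%N|].
by move=> x; rewrite locmap_eta // eta0.
Qed.
HB.instance Definition _ := GRing.isLinear.Build S LC LC _ locd locd_linear.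

Lemma locdZ s y : locd (s *: y) = s *: locd y. Proof. exact: linearZ. Qed.
Lemma locdB y z : locd (y - z) = locd y - locd z. Proof. exact: linearB. Qed.
Lemma locdN y : locd (- y) = - locd y. Proof. exact: linearN. Qed.
Lemma locd0 : locd 0 = 0. Proof. exact: linear0. Qed.
Lemma cdZ s x : @cd _ C (s *: x) = s *: cd x. Proof. exact: linearZ. Qed.
Lemma cdB x y : @cd _ C (x - y) = cd x - cd y. Proof. exact: linearB. Qed.
(** The cone of [C -> C_f], shifted so that [C] keeps its cohomological degrees. *)
Definition cone_d (u : cone_car) : cone_car := (cd u.1, eta (elt_val f) u.1 - locd u.2).
Fact cone_d_linear : linear cone_d.
Proof.
move=> a [x y] [z w]; rewrite /cone_d /=; congr (_, _); first by rewrite linearP.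
by rewrite /= etaD etaZ locd_linear scalerBr opprD addrACA.
Qed.
HB.instance Definition _ :=
  GRing.isLinear.Build S cone_car cone_car _ cone_d cone_d_linear.

Definition cone_deg p n (u : cone_car) := cdeg C p n u.1 /\ ldeg (p - 1) n u.2.

Fact cone_dd u : cone_d (cone_d u) = 0.
Proof.
case: u => x y; rewrite /cone_d /= cdd; congr (_, _).
by rewrite linearB /= locd_eta locdd subr0 subrr.
Qed.
Fact cone_deg0 p n : cone_deg p n 0. Proof. by split; [apply: cdeg0|apply: ldeg0]. Qed.
Fact cone_degB p n x y : cone_deg p n x -> cone_deg p n y -> cone_deg p n (x - y).
Proof. by move=> [a b] [c d]; split; [apply: cdegB|apply: ldegB]. Qed.
Fact cone_degZ p n k s x : rdeg k s -> cone_deg p n x -> cone_deg p (n + k) (s *: x).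
Proof. by move=> h [a b]; split; [apply: cdegZ|apply: ldegZ]. Qed.
Lemma ldegd p n y : ldeg p n y -> ldeg (p + 1) n (locd y).
Proof.
rewrite -{2}(addr0 n); apply: (locmap_deg order_lt_cd) => k x h.
by rewrite addr0; apply: cdegd.
Qed.
Fact cone_degd p n x : cone_deg p n x -> cone_deg (p + 1) n (cone_d x).
Proof.
move=> [a b]; split; first exact: cdegd.
apply: ldegB; first by rewrite addrK; apply: ldeg_eta.
by rewrite -addrA (addrC 1) addrA; apply: ldegd.
Qed.

Definition cone : cplx S := Cplx cone_dd cone_deg0 cone_degB cone_degZ cone_degd.
End Cone.

Lemma diffopB (S : comNzRingType) (V W : lmodType S) (phi : V -> W) : diffop phi ->
  {morph phi : x y / x - y}.
Proof. by move=> h x y; apply/eqP; rewrite eq_sym subr_eq -diffopD // subrK. Qed.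
Section ConeMap.
Variables (S : gradedRing) (f : homElt S).
Implicit Types C D : cplx S.

(** The action of a differential operator on the cones. *)
Definition cone_map C D (phi : C -> D) (u : cone f C) : cone f D :=
  (phi u.1, locmap (elt_val f) phi u.2).

Lemma cone_map_id C : @cone_map C C id =1 id.
Proof. by case=> x y; rewrite /cone_map /= locmap_id. Qed.

Lemma cone_map_comp C D (E : cplx S) (psi : D -> E) (phi : C -> D) : diffop psi ->
  diffop phi ->
  cone_map (psi \o phi) =1 cone_map psi \o cone_map phi.
Proof. by move=> h h' [x y]; rewrite /cone_map /= locmap_comp. Qed.

Lemma cone_map_lincomb C D a (phi psi : C -> D) : diffop psi -> diffop phi ->
  cone_map (fun x => phi x + a *: psi x) =1 fun u => cone_map phi u + a *: cone_map psi u.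
Proof. by move=> h h' [x y]; rewrite /cone_map /= locmap_lincomb. Qed.

Lemma order_lt_pair k (V V' W W' : lmodType S) (p : V -> W) (q : V' -> W') :
  order_lt k p -> order_lt k q -> order_lt k (fun u : V * V' => (p u.1, q u.2) :
    (W * W')%type).
Proof.
elim: k p q => [|k IH] p q; first by move=> h h' [x y] /=; rewrite h h'.
move=> [D1 h] [D2 h']; split=> [[x y] [z w]|s] /=; first by rewrite D1 D2.
exact: (IH _ _ (h s) (h' s)).
Qed.

Lemma diffop_cone_map C D (phi : C -> D) : diffop phi -> diffop (cone_map phi).
Proof.
move=> h; have [k h1] := h; have [l h2] := diffop_locmap (elt_val f) h.
exists (k + l)%N.
by apply: order_lt_pair; [apply: order_lt_leq h1|apply: order_lt_leq h2]; lia.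
Qed.

Lemma order_lt1_cone_map C D (phi : C -> D) : order_lt 1 phi -> order_lt 1 (cone_map phi).
Proof. by move=> h; apply: order_lt_pair => //; apply: locmap_order_lt1. Qed.

Lemma graded_op_cone_map C D e (phi : C -> D) : graded_op e phi ->
  graded_op e (cone_map phi).
Proof.
move=> [h hd hdg]; split; first exact: diffop_cone_map.
  case=> x y; rewrite /cone_map /= /cone_d /=; congr (_, _); first exact: hd.
  rewrite (diffopB (diffop_locmap (elt_val f) h)) locmap_eta //; congr (_ - _).
  have hc (E : cplx S) : diffop (cd : E -> E) by apply/order_lt1_diffop/order_lt_cd.
  rewrite -[LHS]/((_ \o locmap _ _) y) -locmap_comp // -[RHS]/((_ \o _) y).
  rewrite -[RHS]locmap_comp //.
  exact: eq_locmap.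
move=> p n [x y] [a b]; split; first exact: hdg.
by have [k hk] := h; apply: (locmap_deg hk) b => n' x' /hdg.
Qed.

(** An operator that multiplies each element of internal degree [n] by [n], and
    acts on scalars as a derivation would, extends to one with the same
    properties. *)
Lemma cone_map_euler C (E : C -> C) : diffop E ->
  (forall p n x, cdeg C p n x -> E x = x *~ n) ->
  (forall k s x, rdeg k s -> E (s *: x) = s *: E x + (s *: x) *~ k) ->
  (forall p n u, cdeg (cone f C) p n u -> cone_map E u = u *~ n) /\
  (forall k s u, rdeg k s -> cone_map E (s *: u) = s *: cone_map E u + (s *: u) *~ k).
Proof.
move=> hE hn hs; pose E' := locmap (elt_val f) E.
have hE' : diffop E' by apply: diffop_locmap.
have E'e x : E' (eta (elt_val f) x) = eta (elt_val f) (E x) by apply: locmap_eta.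
have E'S k s y : rdeg k s -> E' (s *: y) = s *: E' y + (s *: y) *~ k.
  move=> hk; rewrite -scaler_int scalerA; move: y.
  have dS (V : lmodType S) (t : S) : diffop ( *:%R t : V -> V).
    exact: (diffop_linear (GRing.scale t)).
  apply: diffop_loc_ext.
  - exact: (diffop_comp hE' (dS _ s)).
  - have := diffop_lincomb 1 (diffop_comp (dS _ s) hE') (dS _ (k%:~R * s)).
    by congr diffop; apply: funext => y /=; rewrite scale1r.
  by move=> x; rewrite -!etaZ !E'e (hs k) // etaD -scaler_int scalerA !etaZ.
split=> [p n [x y] [/= h [l [z [hz e]]]]|k s [x y] hk]; last first.
  have -> : (s *: (x, y) : C * Loc (elt_val f) C) *~ k = (s *: x *~ k, s *: y *~ k).
    by rewrite -!scaler_int.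
  by congr (_, _); [apply: hs|apply: E'S].
have -> : ((x, y) : C * Loc (elt_val f) C) *~ n = (x *~ n, y *~ n).
  by rewrite -!scaler_int.
congr (_, _); first exact: hn h.
apply/eqP; rewrite -subr_eq0; apply/eqP/(@locfX_inj _ (elt_val f) _ l).
have := congr1 E' e; rewrite E'e (hn _ _ _ hz) (E'S _ _ _ (rdegX l (elt_degP f))).
have -> : eta (elt_val f) (z *~ (n + l%:Z * elt_deg f)) =
    eta (elt_val f) z *~ n + eta (elt_val f) z *~ (l%:Z * elt_deg f).
  by rewrite -!scaler_int etaZ intrD scalerDl.
rewrite e => /addIr h1;
  rewrite scalerBr -[locmap _ _ _]/(E' y) h1 -e -!scaler_int !scalerA.
by rewrite mulrC subrr.
Qed.
End ConeMap.
Arguments cone_map {S} f {C D} phi.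

(** * Quasi-isomorphisms, the Cech complex and torsion subcomplexes *)

Section Qis.
Variable S : gradedRing.
Implicit Types (C D : cplx S) (f : homElt S) (fs : seq (homElt S)).

(** The cohomology of [C] vanishes in bidegree [(p, n)]. *)
Definition acyc C p n := forall x, cdeg C p n x -> cd x = 0 ->
  exists2 y, cdeg C (p - 1) n y & x = cd y.

(** The mapping cone of [phi] is exact on bihomogeneous elements. *)
Definition qis C D (phi : C -> D) := forall p n x x',
  cdeg C (p + 1) n x -> cdeg D p n x' -> cd x = 0 -> phi x = cd x' ->
  exists y y', [/\ cdeg C p n y, cdeg D (p - 1) n y', x = cd y & x' = phi y - cd y'].

(** Quasi-isomorphisms: linear, of degree 0 and compatible with the differentials
    on bihomogeneous elements. *)
Definition quasi_iso C D (phi : C -> D) := [/\ order_lt 1 phi,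
  forall p n x, cdeg C p n x -> phi (cd x) = cd (phi x),
  forall p n x, cdeg C p n x -> cdeg D p n (phi x) & qis phi].

Lemma quasi_iso_acyc C D (phi : C -> D) p n : quasi_iso phi -> acyc C p n <-> acyc D p n.
Proof.
move=> [h hc hdg hq]; have hd := order_lt1_diffop h.
split=> [hC x' hx' dx'|hD x hx dx].
  have [||||y [y' [hy hy' ey ex]]] := hq p n 0 x'; rewrite ?linear0 ?diffop0 //.
    exact: cdeg0.
  have [z hz ez] := hC y hy (esym ey).
  exists (phi z - y'); first by apply: cdegB => //; apply: hdg.
  by rewrite cdB -(hc _ _ _ hz) -ez.
have [||y' hy' ey'] := hD (phi x); first exact: hdg.
  by rewrite -(hc _ _ _ hx) dx diffop0.
have hx1 : cdeg C (p - 1 + 1) n x by rewrite subrK.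
have [y [z [hy _ ex _]]] := hq _ _ _ _ hx1 hy' dx ey'.
by exists y.
Qed.

(** Localization is exact: denominators are cleared on cocycles. *)
Lemma loc_qis f C D (phi : C -> D) : quasi_iso phi -> forall p n (a :
  Loc (elt_val f) C) a',
  ldeg (p + 1) n a -> ldeg p n a' -> locd a = 0 -> locmap (elt_val f) phi a = locd a' ->
  exists (b : Loc (elt_val f) C) (b' : Loc (elt_val f) D),
    [/\ ldeg p n b, ldeg (p - 1) n b',
      a = locd b & a' = locmap (elt_val f) phi b - locd b'].
Proof.
move=> [h hc hdg hq] p n a a' [k [x [hx ex]]] [k' [x' [hx' ex']]] da ea.
have hd := order_lt1_diffop h; pose F := elt_val f; pose M := locmap F phi.
have Me z : M (eta F z) = eta F (phi z) by apply: locmap_eta.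
have M1 : order_lt 1 M by apply: locmap_order_lt1.
have MZ := order_lt1Z M1; have PZ := order_lt1Z h.
have /eta_eq0[l e1] : eta F (cd x) = 0.
  by rewrite -locd_eta -ex locdZ da scaler0.
have /eta_eq0[l' e2] : eta F (F ^+ k' *: phi x - F ^+ k *: cd x') = 0.
  rewrite etaB !etaZ -Me -ex MZ [M a]ea -locd_eta -ex' locdZ.
  rewrite !scalerA mulrC. by rewrite subrr.
have [hx1 ex1] := ldeg_raise (l + l' + k') hx ex.
have [hx1' ex1'] := ldeg_raise (l + l' + k) hx' ex'.
set x1 := _ *: x in hx1 ex1; set x1' := _ *: x' in hx1' ex1'.
have eK : (l + l' + k + k' = l + l' + k' + k)%N by lia.
rewrite eK in hx1' ex1'; set N := (l + l' + k' + k)%N in hx1 ex1 hx1' ex1'.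
have dx1 : cd x1 = 0.
  rewrite cdZ; have -> : (l + l' + k' = l' + k' + l)%N by lia.
  by rewrite exprD -scalerA e1 scaler0.
have px1 : phi x1 = cd x1'.
  rewrite PZ cdZ; apply/eqP; rewrite -subr_eq0.
  rewrite (exprD _ _ k') (exprD _ _ k) -2!scalerA.
  by rewrite -!scalerBr exprD -scalerA e2 scaler0.
have [y [y' [hy hy' ey ey']]] := hq _ _ _ _ hx1 hx1' dx1 px1.
exists (frac F N y), (frac F N y'); split.
- by exists N, y; rewrite frac_div.
- by exists N, y'; rewrite frac_div.
- apply/eqP; rewrite -subr_eq0; apply/eqP/(@locfX_inj _ F _ N).
  by rewrite scalerBr ex1 -locdZ frac_div locd_eta ey subrr.
apply/eqP; rewrite -subr_eq0; apply/eqP/(@locfX_inj _ F _ N).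
rewrite !scalerBr ex1' -MZ -locdZ !frac_div Me locd_eta ey' etaB.
by rewrite subrr.
Qed.

Lemma cone_map_quasi_iso f C D (phi : C -> D) : quasi_iso phi ->
  quasi_iso (cone_map f phi).
Proof.
move=> hw; have [h hc hdg hq] := hw; have hd := order_lt1_diffop h.
have hl := diffop_locmap (elt_val f) hd.
have hZ := order_lt1Z (locmap_order_lt1 (elt_val f) h).
split; first exact: order_lt1_cone_map.
- move=> p n [x y] [/= hx [k [z [hz ez]]]]; rewrite /cone_map /= /cone_d /=.
  congr (_, _); first exact: hc hx.
  rewrite (diffopB hl) locmap_eta //; congr (_ - _).
  apply/eqP; rewrite -subr_eq0; apply/eqP/(@locfX_inj _ (elt_val f) _ k).
  rewrite scalerBr -hZ -!locdZ -hZ ez !locmap_eta // !locd_eta.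
  by rewrite locmap_eta // (hc _ _ _ hz) subrr.
- move=> p n [x y] [hx hy]; split; first exact: hdg.
  rewrite -(addr0 n); apply: (locmap_deg h) hy => n' x'.
  by rewrite addr0; apply: hdg.
move=> p n [x a] [x' a'] [/= hx ha] [/= hx' ha'] [/= dx da] [/= px pa].
have [y [y' [hy hy' ey ey']]] := hq _ _ _ _ hx hx' dx px.
have [||||b [b' [hb hb' eb eb']]] :=
  loc_qis hw (p := p - 1) (n := n) (a := a - eta (elt_val f) y) (a' :=
    - eta (elt_val f) y' - a').
- rewrite subrK; rewrite addrK in ha.
  exact/ldegB/ldeg_eta.
- by apply: ldegB => //; apply/ldegN/ldeg_eta.
- rewrite locdB locd_eta -ey; apply/eqP; rewrite subr_eq0 eq_sym -subr_eq0.
  exact/eqP.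
- rewrite (diffopB hl) locmap_eta // pa ey' etaB locdB locdN locd_eta.
  by rewrite addrAC [_ - _ - eta _ (phi y)]addrAC subrr sub0r.
exists (y, - b), (y', b'); split; [split=> //|split=> //|congr (_, _)|congr (_, _)] =>
  //=.
- exact: ldegN.
- by rewrite locdN opprK -eb addrC subrK.
have -> : a' = - eta (elt_val f) y' - (locmap (elt_val f) phi b - locd b').
  by rewrite -eb' subKr.
rewrite -(sub0r b) (diffopB hl) (diffop0 hl) sub0r !opprB addrCA [RHS]addrCA.
by congr (_ + _); rewrite addrC.
Qed.

(** Conditions that cut out a subcomplex. *)
Definition sub_closed C (P : C -> Prop) :=
  [/\ P 0, forall x y, P x -> P y -> P (x - y), forall s x, P x -> P (s *: x) &
      forall x, P x -> P (cd x)].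

Section Restr.
Variables (C : cplx S) (P : C -> Prop) (hPc : sub_closed P).
Definition rsdeg p n x := cdeg C p n x /\ P x.
Fact rsdeg0 p n : rsdeg p n 0.
Proof. by case: hPc => h _ _ _; split; [apply: cdeg0|]. Qed.
Fact rsdegB p n x y : rsdeg p n x -> rsdeg p n y -> rsdeg p n (x - y).
Proof. by case: hPc => _ h _ _ [a b] [c d]; split; [apply: cdegB|apply: h]. Qed.
Fact rsdegZ p n k s x : rdeg k s -> rsdeg p n x -> rsdeg p (n + k) (s *: x).
Proof. by case: hPc => _ _ h _ hs [a b]; split; [apply: cdegZ|apply: h]. Qed.
Fact rsdegd p n x : rsdeg p n x -> rsdeg (p + 1) n (cd x).
Proof. by case: hPc => _ _ _ h [a b]; split; [apply: cdegd|apply: h]. Qed.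
(** The subcomplex cut out by [P], on the same module. *)
Definition restr := Cplx (@cdd S C) rsdeg0 rsdegB rsdegZ rsdegd.
End Restr.

(** [x] is killed by a power of [f]. *)
Definition torsf f (V : lmodType S) (x : V) := exists k, elt_val f ^+ k *: x = 0.
Lemma torsf_closed f C : sub_closed (@torsf f C).
Proof.
split=> [|x y [k e] [l e']|s x [k e]|x [k e]].
- by exists 0%N; rewrite scaler0.
- exists (k + l)%N; rewrite scalerBr {2}exprD -scalerA e'.
  by rewrite addnC exprD -scalerA e !scaler0 subrr.
- by exists k; rewrite scalerA mulrC -scalerA e scaler0.
by exists k; rewrite -linearZ e linear0.
Qed.
(** The subcomplex of the [f]-torsion elements. *)
Definition gamma1 f C := restr (torsf_closed f C).

(** The localization map at [f] is onto on bihomogeneous elements. *)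
Definition loc_surj f C := forall p n (y : Loc (elt_val f) C), ldeg p n y ->
  exists2 x, cdeg C p n x & y = eta (elt_val f) x.

Definition gamma1_in f C (x : gamma1 f C) : cone f C := (x, 0).

(** If [C -> C_f] is onto, its cone is the complex of its kernel. *)
Lemma gamma1_quasi_iso f C : loc_surj f C -> quasi_iso (@gamma1_in f C).
Proof.
move=> hs.
have h1 : order_lt 1 (@gamma1_in f C).
  apply/order_lt1P => s x y; rewrite /gamma1_in; congr (_, _).
  by rewrite /= scaler0 addr0.
split=> //.
- move=> p n x [_ /eta_eq0 tx]; rewrite /gamma1_in; congr (_, _).
  by rewrite /= tx locd0 subrr.
- by move=> p n x [a b]; split=> //; apply: ldeg0.
move=> p n x [x' a'] [hx tx] [/= hx' ha'] dx [/= ex ea].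
have [z hz ez] := hs _ _ _ ha'.
exists (x' - cd z), (- z, 0); split.
- split.
    by apply: cdegB => //; have := cdegd hz; rewrite subrK.
  by apply/eta_eq0; rewrite etaB -locd_eta -ez; apply/esym.
- by split; [apply: cdegN|apply: ldeg0].
- by rewrite cdB cdd subr0.
rewrite /gamma1_in; congr (_, _) => /=; rewrite linearN /= ?opprK ?subrK //.
by rewrite linear0 subr0 linearN opprK add0r.
Qed.

(** The (extended) Cech complex of [fs], as an iterated cone. *)
Fixpoint cech fs C : cplx S := if fs is f :: fs' then cech fs' (cone f C) else C.
Fixpoint cech_map fs C D (phi : C -> D) : cech fs C -> cech fs D :=
  if fs is f :: fs' then @cech_map fs' _ _ (cone_map f phi) else phi.
(** The subcomplex of the elements that are torsion for each element of [fs]. *)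
Fixpoint gamma fs C : cplx S := if fs is f :: fs' then gamma fs' (gamma1 f C) else C.

Lemma cech_map_quasi_iso fs C D (phi : C -> D) : quasi_iso phi ->
  quasi_iso (cech_map (fs := fs) phi).
Proof.
by elim: fs C D phi => //= f fs IH C D phi h; apply/IH/cone_map_quasi_iso.
Qed.

(** Divisibility up to torsion, within the submodules annihilated by finitely
    many homogeneous elements.  The annihilators make the property pass to
    torsion subcomplexes. *)
Definition soft C := forall (gs : seq (homElt S)) f p n x,
  cdeg C p (n + elt_deg f) x -> (forall g, g \in map (@elt_val S) gs -> g *: x = 0) ->
  exists k y, [/\ cdeg C p n y, forall g, g \in map (@elt_val S) gs -> g *: y = 0 &
     elt_val f ^+ k.+1 *: y = elt_val f ^+ k *: x].

Lemma soft_gamma1 f C : soft C -> soft (gamma1 f C).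
Proof.
move=> h gs g p n x [hx [t et]] hg.
have [|k [y [hy hgy e]]] := h (HomElt (rdegX t (elt_degP f)) :: gs) g p n x hx.
  by move=> g'; rewrite inE => /predU1P[->|/hg].
exists k, y; split=> //.
  by split=> //; exists t; apply: hgy; rewrite inE eqxx.
by move=> g' hg'; apply: hgy; rewrite inE hg' orbT.
Qed.

Lemma soft_loc_surj f C : soft C -> loc_surj f C.
Proof.
move=> h p n y [k [x [hx ex]]]; elim: k x hx ex => [|k IH] x.
  by rewrite mul0r addr0 scale1r => hx ->; exists x.
rewrite intS mulrDl mul1r addrA addrAC => hx ex.
have [//|j [z [hz _ ez]]] := h [::] f p _ x hx.
apply: (IH z hz); apply/eqP; rewrite -subr_eq0; apply/eqP/(@locfX_inj _ _ _ j.+1).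
rewrite scalerBr -[elt_val f ^+ j.+1 *: eta _ z]etaZ ez etaZ -ex scalerA scalerA.
by rewrite -!exprD addSnnS subrr.
Qed.

(** On a soft complex, the Cech complex computes the cohomology of the torsion. *)
Lemma cech_acyc_gamma fs C p n : soft C -> acyc (cech fs C) p n <-> acyc (gamma fs C) p n.
Proof.
elim: fs C => //= f fs IH C hC.
have hw : quasi_iso (cech_map (fs := fs) (@gamma1_in f C)).
  exact/cech_map_quasi_iso/gamma1_quasi_iso/soft_loc_surj.
rewrite -(quasi_iso_acyc p n hw); exact/IH/soft_gamma1.
Qed.
End Qis.

(** * Ideals, chain conditions and homogeneous components *)

Section IdealTheory.
Variable A : comNzRingType.
Implicit Types (J X : A -> Prop).

Lemma idealD J a b : ideal J -> J a -> J b -> J (a + b).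
Proof. by case=> _ h _; apply: h. Qed.
Lemma idealM J a b : ideal J -> J b -> J (a * b). Proof. by case=> _ _; apply. Qed.
Lemma ideal0 J : ideal J -> J 0. Proof. by case. Qed.
Lemma idealN J b : ideal J -> J b -> J (- b).
Proof. by move=> h hb; rewrite -mulN1r; apply: idealM. Qed.
Lemma idealB J a b : ideal J -> J a -> J b -> J (a - b).
Proof. by move=> h ha hb; apply: idealD => //; apply: idealN. Qed.
Lemma ideal_sum J (T : Type) (r : seq T) (P : pred T) (F : T -> A) : ideal J ->
  (forall i, P i -> J (F i)) -> J (\sum_(i <- r | P i) F i).
Proof. by case=> h0 hD _ h; elim/big_ind: _. Qed.

Lemma ideal_span_min X J : ideal J -> (forall a, X a -> J a) ->
  forall a, ideal_span X a -> J a.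
Proof.
by move=> hJ hX a [n [c [x [hx ->]]]]; apply: ideal_sum => // k _; apply: idealM => //;
  apply: hX.
Qed.

Lemma ideal_span_sub X a : X a -> ideal_span X a.
Proof.
by move=> h; exists 1%N, (fun=> 1), (fun=> a); split=> //; rewrite big_ord1 mul1r.
Qed.

Lemma ideal_span_ideal X : ideal (ideal_span X).
Proof.
split=> [|a b [n [c [x [hx ->]]]] [k [d [y [hy ->]]]]|a b [n [c [x [hx ->]]]]].
- by exists 0%N, (fun=> 0), (fun=> 0); split=> [[]//|]; rewrite big_ord0.
- exists (n + k)%N, (fun i => match split i with inl i => c i | inr i => d i end),
    (fun i => match split i with inl i => x i | inr i => y i end).
  split=> [i|]; first by case: split.
  rewrite big_split_ord; congr (_ + _); apply: eq_bigr => i _.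
    by rewrite (unsplitK (inl i)).
  by rewrite (unsplitK (inr i)).
exists n, (fun i => a * c i), x; split=> //.
by rewrite mulr_sumr; apply: eq_bigr => i _; rewrite mulrA.
Qed.

Lemma seq_span_ideal (s : seq A) : ideal (seq_span s).
Proof. exact: ideal_span_ideal. Qed.
Lemma seq_span_mem (s : seq A) a : a \in s -> seq_span s a.
Proof. exact: ideal_span_sub. Qed.
Lemma seq_span_min (s : seq A) J : ideal J -> (forall a, a \in s -> J a) ->
  forall a, seq_span s a -> J a.
Proof. exact: ideal_span_min. Qed.
Lemma seq_span_sub (s t : seq A) : {subset s <= t} ->
  forall a, seq_span s a -> seq_span t a.
Proof.
by move=> h; apply: seq_span_min => [|a /h]; [apply: seq_span_ideal|apply: seq_span_mem].
Qed.

Lemma seq_span_cons (s : seq A) b a :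
  seq_span (b :: s) a -> exists c, seq_span s (a - c * b).
Proof.
move: a; apply: (@seq_span_min _ (fun a => exists c, seq_span s (a - c * b))) => [|a].
  have hs := seq_span_ideal s; split=> [|x y [c hc] [d hd]|x y [c hc]].
  - by exists 0; rewrite mul0r subr0; apply: ideal0.
  - by exists (c + d); rewrite mulrDl opprD addrACA; apply: idealD.
  - by exists (x * c); rewrite -mulrA -mulrBr; apply: idealM.
rewrite inE => /predU1P[->|ha]; first by exists 1; rewrite mul1r subrr;
  exact: ideal0 (seq_span_ideal _).
by exists 0; rewrite mul0r subr0; apply: seq_span_mem.
Qed.

Lemma span_finite X (s : seq A) : (forall a, a \in s -> ideal_span X a) ->
  exists l : seq A, (forall a, a \in l -> X a) /\ forall a, a \in s -> seq_span l a.
Proof.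
elim: s => [|b s IH] h; first by exists [::]; split.
have [|l [hl hs]] := IH; first by move=> a ha; apply: h; rewrite inE ha orbT.
have [n [c [x [hx eb]]]] := h b (mem_head _ _).
exists (codom x ++ l); split=> a; first by rewrite mem_cat => /orP[/codomP[i ->]|/hl].
rewrite inE => /predU1P[->|/hs].
  rewrite eb; apply: ideal_sum; first exact: seq_span_ideal.
  move=> i _; apply: idealM; first exact: seq_span_ideal.
  by apply: seq_span_mem; rewrite mem_cat codom_f.
by apply: seq_span_sub => z; rewrite mem_cat => ->; rewrite orbT.
Qed.

(** The finite set of generators can be taken in any given generating set. *)
Lemma noetherian_span X : noetherian A -> exists l : seq A,
  (forall a, a \in l -> X a) /\ forall a, ideal_span X a <-> seq_span l a.
Proof.
move=> hA; have [s hs] := hA _ (ideal_span_ideal X).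
have [|l [hl hl']] := @span_finite X s.
  by move=> a ha; apply/hs/seq_span_mem.
exists l; split=> // a; split.
  by move=> /hs; apply: seq_span_min => //; apply: seq_span_ideal.
by apply: seq_span_min; [apply: ideal_span_ideal|move=> b /hl/ideal_span_sub].
Qed.

Lemma noetherian_acc (U : nat -> A -> Prop) : noetherian A ->
  (forall k, ideal (U k)) -> (forall k a, U k a -> U k.+1 a) ->
  exists N, forall k a, U k a -> U N a.
Proof.
move=> hA hU hS.
have mono k l a : (k <= l)%N -> U k a -> U l a.
  by move=> /subnK <-; elim: (l - k)%N => // j IH /IH/hS.
have hI : ideal (fun a => exists k, U k a).
  split=> [|a b [k hk] [l hl]|a b [k hk]].
  - by exists 0%N; apply: ideal0.
  - exists (maxn k l); apply: idealD => //; [apply: mono hk|apply: mono hl];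
      by rewrite ?leq_maxl ?leq_maxr.
  - by exists k; apply: idealM.
have [s hs] := hA _ hI.
have [N hN] : exists N, forall a, a \in s -> U N a.
  have : forall a, a \in s -> exists k, U k a.
    by move=> a ha; apply/hs/seq_span_mem.
  elim: s {hs} => [|b s IH] h; first by exists 0%N.
  have [|N hN] := IH; first by move=> a ha; apply: h; rewrite inE ha orbT.
  have [k hk] := h b (mem_head _ _); exists (maxn k N) => a.
  rewrite inE => /predU1P[->|/hN]; first by apply: mono hk; rewrite leq_maxl.
  by apply: mono; rewrite leq_maxr.
exists N => k a hk; apply: (seq_span_min (hU N) hN); apply/hs.
by exists k.
Qed.
End IdealTheory.

Section Proj.
Variables (V : zmodType) (D : int -> V -> Prop) (hD : direct_sum D).

Lemma sum_support (F : int -> V) (s t : seq int) : uniq s -> uniq t -> {subset s <= t} ->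
  (forall k, k \notin s -> F k = 0) -> \sum_(k <- s) F k = \sum_(k <- t) F k.
Proof.
move=> us ut ss F0; rewrite [RHS](bigID (mem s)) /= [X in _ = _ + X]big1 ?addr0.
  rewrite -[in RHS]big_filter; apply: perm_big; apply: uniq_perm => //.
    by rewrite filter_uniq.
  by move=> k; rewrite mem_filter; case: (boolP (k \in s)) => // /ss ->.
by move=> k; apply: F0.
Qed.

Lemma dsum0 n : D n 0. Proof. by case: hD. Qed.
Lemma dsumB n x y : D n x -> D n y -> D n (x - y).
Proof. by case: hD => _ h _ _; apply: h. Qed.
Lemma dsumN n x : D n x -> D n (- x). Proof. by rewrite -sub0r; apply/dsumB/dsum0. Qed.
Lemma dsumD n x y : D n x -> D n y -> D n (x + y).
Proof. by move=> h /dsumN; rewrite -[y in x + y]opprK; apply: dsumB. Qed.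

Lemma dsum_decomp x : exists c : int -> V, (forall n, D n (c n)) /\
  exists r : seq int, [/\ uniq r, forall n, n \notin r ->
    c n = 0 & x = \sum_(n <- r) c n].
Proof.
have [_ _ h _] := hD; have [r [c [ur hc ex]]] := h x.
exists (fun n => if n \in r then c n else 0); split.
  by move=> n; case: ifP => _ //; apply: dsum0.
exists r; split=> // [n /negPf -> //|].
by rewrite ex; apply: eq_big_seq => n ->.
Qed.

(** The component of degree [n] of [x] in a direct sum decomposition. *)
Definition proj n x : V := projT1 (cid (dsum_decomp x)) n.

Lemma projD n x : D n (proj n x).
Proof. by rewrite /proj; case: cid => c [h _] /=. Qed.

Lemma proj_sum x : exists r : seq int,
  [/\ uniq r, forall n, n \notin r -> proj n x = 0 & x = \sum_(n <- r) proj n x].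
Proof. by rewrite /proj; case: cid => c [h r] /=. Qed.

Lemma proj_uniq (c : int -> V) r x : uniq r -> (forall n, D n (c n)) ->
  (forall n, n \notin r -> c n = 0) -> x = \sum_(n <- r) c n ->
  forall n, proj n x = c n.
Proof.
move=> ur hc c0 ex n; have [r' [ur' p0 ex']] := proj_sum x.
have [_ _ _ hI] := hD.
have h := hI (undup (r ++ r')) (fun k => proj k x - c k) (undup_uniq _) _ _ n.
case: (boolP (n \in undup (r ++ r'))) => [hn|].
  apply/eqP; rewrite -subr_eq0; apply/eqP/h => //.
    by move=> k; apply: dsumB => //; apply: projD.
  have sr : {subset r <= undup (r ++ r')} by move=> k hk; rewrite mem_undup mem_cat hk.
  have sr' : {subset r' <= undup (r ++ r')}.
    by move=> k hk; rewrite mem_undup mem_cat hk orbT.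
  rewrite sumrB -(sum_support ur' (undup_uniq _) sr' p0).
  by rewrite -(sum_support ur (undup_uniq _) sr c0) -ex -ex' subrr.
by rewrite mem_undup mem_cat negb_or => /andP[/c0 -> /p0 ->].
Qed.

Lemma proj_id n x : D n x -> proj n x = x.
Proof.
move=> h; rewrite (@proj_uniq (fun k => if k == n then x else 0) [:: n]) ?eqxx //.
- by move=> k; case: eqP => [->//|_]; apply: dsum0.
- by move=> k; rewrite inE => /negPf ->.
by rewrite big_seq1 eqxx.
Qed.

Lemma proj_ne n k x : D k x -> n != k -> proj n x = 0.
Proof.
move=> h /negPf nk; rewrite (@proj_uniq (fun n => if n == k then x else 0) [:: k]) ?nk //.
- by move=> j; case: eqP => [->//|_]; apply: dsum0.
- by move=> j; rewrite inE => /negPf ->.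
by rewrite big_seq1 eqxx.
Qed.

Lemma projB n x y : proj n (x - y) = proj n x - proj n y.
Proof.
have [r [ur r0 er]] := proj_sum x; have [s [us s0 es]] := proj_sum y.
apply: (@proj_uniq (fun n => proj n x - proj n y) (undup (r ++ s))).
- exact: undup_uniq.
- by move=> k; apply: dsumB; apply: projD.
- by move=> k; rewrite mem_undup mem_cat negb_or => /andP[/r0 -> /s0 ->]; rewrite subrr.
have sr : {subset r <= undup (r ++ s)} by move=> k hk; rewrite mem_undup mem_cat hk.
have ss : {subset s <= undup (r ++ s)}.
  by move=> k hk; rewrite mem_undup mem_cat hk orbT.
rewrite sumrB -(sum_support ur (undup_uniq _) sr r0).
by rewrite -(sum_support us (undup_uniq _) ss s0) -er -es.
Qed.

Lemma proj0 n : proj n 0 = 0. Proof. exact/proj_id/dsum0. Qed.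
Lemma projN n x : proj n (- x) = - proj n x.
Proof. by rewrite -sub0r projB proj0 sub0r. Qed.
Lemma projDr n x y : proj n (x + y) = proj n x + proj n y.
Proof. by rewrite -[y in x + y]opprK projB projN opprK. Qed.
Lemma proj_bigsum n (T : Type) (r : seq T) (F : T -> V) :
  proj n (\sum_(i <- r) F i) = \sum_(i <- r) proj n (F i).
Proof. by elim/big_rec2: _ => [|i x y _ <-]; rewrite ?proj0 // projDr. Qed.

Lemma proj_all0 x : (forall n, proj n x = 0) -> x = 0.
Proof.
by move=> h; have [r [_ _ ->]] := proj_sum x; apply: big1 => n _; rewrite h.
Qed.
End Proj.

Section GradedProj.
Variable S : gradedRing.
Implicit Types M : gradedMod S.
Notation rproj := (proj (@rdeg_sum S)).
(** The components in a graded module. *)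
Definition mproj M := proj (@mdegree_sum S M).

Lemma mproj_scale M n k (s : S) (x : M) : rdeg k s ->
  mproj n (s *: x) = s *: mproj (n - k) x.
Proof.
move=> hs; have [r [ur r0 er]] := proj_sum (@mdegree_sum S M) x.
rewrite {1}er scaler_sumr /mproj proj_bigsum.
have hd j : mdegree (k + j) (s *: mproj j x) by apply: mdegreeZ => //; apply: projD.
case: (boolP ((n - k) \in r)) => h; last first.
  rewrite [in RHS]r0 // scaler0 big1_seq // => j /= hj.
  apply: proj_ne (hd j) _; apply: contra h => /eqP ->.
  by rewrite addrAC subrr add0r.
rewrite (bigD1_seq _ h ur) /= big1_seq ?addr0 => [|j /andP[hj _]].
  by apply: proj_id; rewrite -{1}(subrK k n) addrC; apply: hd.
apply: proj_ne (hd j) _; apply: contra hj => /eqP ->.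
by rewrite addrAC subrr add0r.
Qed.

Lemma rproj_mul n k (s x : S) : rdeg k s -> rproj n (s * x) = s * rproj (n - k) x.
Proof. exact: (mproj_scale (M := regular_gmod S)). Qed.

(** Homogeneous elements. *)
Definition ishomog (s : S) := exists k, rdeg k s.

Lemma span_homog (X : S -> Prop) : (forall a, X a -> ishomog a) ->
  forall u, ideal_span X u -> forall n, ideal_span X (rproj n u).
Proof.
move=> hX u [N [c [x [hx ->]]]] n; rewrite proj_bigsum.
apply: ideal_sum; first exact: ideal_span_ideal.
move=> i _; have [k hk] := hX _ (hx i).
rewrite mulrC (rproj_mul _ _ hk) mulrC; apply: idealM; first exact: ideal_span_ideal.
exact: ideal_span_sub.
Qed.

Lemma homog_gens (I : S -> Prop) : noetherian S -> homogeneous_ideal I ->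
  exists fs : seq (homElt S), forall a, I a <-> seq_span (map (@elt_val S) fs) a.
Proof.
move=> hS [hI hh].
have [l [hl hl']] := noetherian_span (fun a => I a /\ ishomog a) hS.
have [fs efs] : exists fs : seq (homElt S), map (@elt_val S) fs = l.
  elim: l hl {hl'} => [|a l IH] h; first by exists [::].
  have [|fs e] := IH; first by move=> b hb; apply: h; rewrite inE hb orbT.
  have [_ [k hk]] := h a (mem_head _ _).
  by exists (HomElt hk :: fs); rewrite /= e.
exists fs => a; rewrite efs; split; last first.
  by apply: seq_span_min => // b /hl[].
move=> ha; apply/hl'.
have [r [ur r0 er]] := proj_sum (@rdeg_sum S) a.
rewrite er; rewrite big_seq_cond; apply: ideal_sum; first exact: ideal_span_ideal.
move=> k; rewrite andbT => hk; apply: ideal_span_sub; split.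
  by apply: (hh r (fun k => rproj k a)) hk => //; [move=> n; apply: projD|rewrite -er].
by exists k; apply: projD.
Qed.
End GradedProj.

(** * Divisibility in graded injective modules *)

Section Shift.
Variables (S : gradedRing) (c : int).

Definition shdeg (q : int) (s : GRing.regular S) : Prop := rdeg (q - c) (s : S).
Fact shdeg_sum : direct_sum shdeg.
Proof.
split=> [n|n x y|x|r d ur hd sum0 n hn]; first exact: (dsum0 (@rdeg_sum S)).
- exact: (dsumB (@rdeg_sum S)).
- have [r [ur r0 er]] := proj_sum (@rdeg_sum S) x.
  exists (map (+%R^~ c) r), (fun n => proj (@rdeg_sum S) (n - c) x).
  split; [by rewrite map_inj_uniq // => a b /addIr|by move=> n; apply: projD|].
  by rewrite big_map {1}er; apply: eq_bigr => n _; rewrite addrK.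
have [_ _ _ h] := @rdeg_sum S.
have /(_ _ _ _ (n - c)) := h (map (+%R^~ (- c)) r) (fun n => d (n + c)).
rewrite subrK; apply.
- by rewrite map_inj_uniq // => a b /addIr.
- by move=> k; have := hd (k + c); rewrite /shdeg addrK.
- by rewrite big_map -[RHS]sum0; apply: eq_bigr => k _; rewrite subrK.
by apply/mapP; exists n.
Qed.
Fact shdegZ k n (a : S) (x : GRing.regular S) :
  rdeg k a -> shdeg n x -> shdeg (k + n) (a *: x).
Proof. by rewrite /shdeg -addrA => h h'; apply: rdegM. Qed.
(** The free module of rank 1 with its generator in degree [c]. *)
Definition shiftM : gradedMod S := GradedMod shdeg_sum shdegZ.
Lemma mproj_shift q (x : shiftM) : mproj q x = proj (@rdeg_sum S) (q - c) x.
Proof.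
have [r [ur r0 er]] := proj_sum (@rdeg_sum S) x.
apply: (@proj_uniq _ _ _ (fun n => proj (@rdeg_sum S) (n - c) x) (map (+%R^~ c) r)).
- by rewrite map_inj_uniq // => a b /addIr.
- by move=> n; apply: projD.
- move=> n hn; apply: r0; apply: contra hn => hn; apply/mapP.
  by exists (n - c); rewrite ?subrK.
by rewrite big_map {1}er; apply: eq_bigr => n _; rewrite addrK.
Qed.
End Shift.

Section SubM.
Variables (S : gradedRing) (M : gradedMod S) (P : M -> Prop).
Hypothesis P0 : P 0.
Hypothesis PL : forall (a : S) x y, P x -> P y -> P (a *: x + y).
Hypothesis Pproj : forall n x, P x -> P (mproj n x).

Definition subP : {pred M} := fun x => `[< P x >].
Fact subP_closed : submod_closed subP.
Proof.
split; first exact/asboolP.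
by move=> a x y /asboolP hx /asboolP hy; apply/asboolP/PL.
Qed.
HB.instance Definition _ := GRing.isSubmodClosed.Build S M subP subP_closed.
Record subT := SubT { sub_val : M; _ : sub_val \in subP }.
HB.instance Definition _ := [isSub for sub_val].
HB.instance Definition _ := [Choice of subT by <:].
HB.instance Definition _ := [SubChoice_isSubLmodule of subT by <:].

Lemma sub_valP (x : subT) : P (sub_val x).
Proof. by case: x => x /= /asboolP. Qed.
Fact sub_val_linear : linear (sub_val : subT -> M).
Proof. by move=> a x y. Qed.
HB.instance Definition _ := GRing.isLinear.Build S subT M _ sub_val sub_val_linear.

Definition subdeg n (x : subT) := mdegree n (sub_val x).
Fact subdeg_sum : direct_sum subdeg.
Proof.
pose hM := @mdegree_sum S M.
split=> [n|n x y h h'|x|r d ur hd sum0 n hn].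
- exact: (dsum0 hM).
- exact: (dsumB hM).
- have [r [ur r0 er]] := proj_sum hM (sub_val x).
  have hp n : mproj n (sub_val x) \in subP by apply/asboolP/Pproj/sub_valP.
  exists r, (fun n => SubT (hp n)); split=> //.
    by move=> n; apply: projD.
  apply: val_inj; rewrite (raddf_sum (sub_val : {linear subT -> M})) /=. exact: er.
have [_ _ _ h] := hM; apply: val_inj.
apply: (h r (fun n => sub_val (d n)) ur) => //.
by rewrite -(raddf_sum sub_val) sum0.
Qed.
Fact subdegZ k n (a : S) (x : subT) : rdeg k a -> subdeg n x -> subdeg (k + n) (a *: x).
Proof. by move=> h h'; apply: mdegreeZ. Qed.
(** The graded submodule of a graded module defined by a predicate that is stable
    under homogeneous components. *)
Definition subM : gradedMod S := GradedMod subdeg_sum subdegZ.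
End SubM.

Lemma mem_elt_val (S : gradedRing) (gs : seq (homElt S)) a :
  a \in map (@elt_val S) gs -> ishomog a.
Proof.
elim: gs => //= g gs IH; rewrite inE => /predU1P[->|/IH //].
by exists (elt_deg g); apply: elt_degP.
Qed.

Section Soft.
Variables (S : gradedRing) (hS : noetherian S).

(** Let [J] be generated by [gs] and choose [k] with [(J : f^(k+1)) = (J : f^k)],
    by noetherianity.  When [J] kills [x], the map [f^(k+1) s + j] to [f^k s x]
    is well defined on the ideal generated by [f^(k+1)] and [J]; an extension of
    it to the whole ring sends 1 to the required [y]. *)
Lemma graded_injective_soft (E : gradedMod S) : graded_injective E ->
  forall (gs : seq (homElt S)) (f : homElt S) n (x : E), mdegree (n + elt_deg f) x ->
  (forall g, g \in map (@elt_val S) gs -> g *: x = 0) ->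
  exists k y, [/\ mdegree n y, forall g, g \in map (@elt_val S) gs -> g *: y = 0 &
     elt_val f ^+ k.+1 *: y = elt_val f ^+ k *: x].
Proof.
move=> hE gs f n x hx hgx.
set F := elt_val f; set gl := map _ gs in hgx *.
have hJ := seq_span_ideal gl.
have [k hk] : exists k, forall s, seq_span gl (F ^+ k.+1 * s) -> seq_span gl (F ^+ k * s).
  have [||N hN] := noetherian_acc (U := fun k s => seq_span gl (F ^+ k * s)) hS.
  - move=> k; split=> [|a b ha hb|a b ha]; first by rewrite mulr0; apply: ideal0.
      by rewrite mulrDr; apply: idealD.
    by rewrite mulrCA; apply: idealM.
  - by move=> k a; rewrite exprS -mulrA; apply: idealM.
  by exists N => s; apply: (hN N.+1).
have Jx s : seq_span gl s -> s *: x = 0.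
  apply: (@seq_span_min _ gl (fun s => s *: x = 0)) => //.
  by split=> [|a b ha hb|a b hb];
    rewrite ?scale0r // ?scalerDl ?ha ?hb ?addr0 // -scalerA hb scaler0.
pose h := F ^+ k.+1; pose V := shiftM S n.
pose P (u : V) := seq_span (h :: gl) (u : S).
have P0 : P 0 by exact: (ideal0 (seq_span_ideal _)).
have PL (a : S) (u v : V) : P u -> P v -> P (a *: u + v).
  have hI := seq_span_ideal (h :: gl).
  by move=> hu hv; apply: idealD => //; apply: idealM.
have Pproj q u : P u -> P (mproj q u).
  move=> hu; rewrite /P mproj_shift; apply: span_homog hu _ => a.
  rewrite inE => /predU1P[->|]; last first.
    exact: mem_elt_val.
  by exists (k.+1%:Z * elt_deg f); apply/rdegX/elt_degP.
pose U := subM P0 PL Pproj.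
pose val_U : {linear U -> V} := @sub_val S V P.
have sP (u : U) : exists s : S, seq_span gl ((sub_val u : S) - s * h).
  exact: seq_span_cons (sub_valP u).
pose sol (u : U) : S := projT1 (cid (sP u)).
pose g0 (u : U) : E := (F ^+ k * sol u) *: x.
have g0E (u : U) s : seq_span gl ((sub_val u : S) - s * h) -> g0 u = (F ^+ k * s) *: x.
  rewrite /g0 /sol; case: cid => t ht /= hs.
  apply/eqP; rewrite -subr_eq0 -scalerBl -mulrBr; apply/eqP/Jx/hk.
  rewrite mulrC -/h mulrBl.
  have := idealB hJ hs ht; congr (seq_span gl _).
  by rewrite opprB addrC addrA subrK.
have solP (u : U) : seq_span gl ((sub_val u : S) - sol u * h).
  by rewrite /sol; case: cid.
have g_lin : linear g0.
  move=> a u v; rewrite (g0E (a *: u + v) (a * sol u + sol v)).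
    by rewrite /g0 mulrDr scalerDl scalerA mulrCA.
  rewrite mulrDl opprD [sub_val _]/(a * sub_val u + sub_val v) addrACA.
  by rewrite -mulrA -mulrBr; apply: idealD => //; apply: idealM.
pose gM := GRing.isLinear.Build S U E _ g0 g_lin.
pose g : {linear U -> E} := HB.pack g0 gM.
have g_deg : degree_preserving g.
  move=> q u hu; have hu' : rdeg (q - n) (sub_val u : S) := hu.
  have hh : rdeg (k.+1%:Z * elt_deg f) h by apply/rdegX/elt_degP.
  set s' := proj (@rdeg_sum S) (q - n - k.+1%:Z * elt_deg f) (sol u).
  have hs' : seq_span gl ((sub_val u : S) - s' * h).
    have hom a : a \in gl -> ishomog a.
      exact: mem_elt_val.
    have := span_homog hom (solP u) (q - n).
    by rewrite projB (proj_id _ hu') mulrC (rproj_mul _ _ hh) mulrC.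
  rewrite [g u](g0E _ _ hs').
  have -> : q = (k%:Z * elt_deg f + (q - n - k.+1%:Z * elt_deg f)) + (n + elt_deg f).
    by rewrite intS; ring.
  apply: mdegreeZ => //; apply: rdegM; first exact/rdegX/elt_degP.
  exact: projD.
have val_deg : degree_preserving val_U by [].
have val_injU : injective val_U by move=> u v /val_inj.
have [h' [h'd h'e]] := hE U V val_U g val_deg g_deg val_injU.
exists k, (h' (1 : S)); split.
- by apply: h'd; rewrite /= /shdeg subrr; apply: rdeg1.
- move=> a ha; rewrite -linearZ /= -[X in h' X]/((a * 1) : S) mulr1.
  have aP : (a : V) \in subP P by apply/asboolP/seq_span_mem; rewrite inE ha orbT.
  rewrite -[a]/(val_U (SubT aP)) h'e [g _](g0E _ 0); first by rewrite mulr0 scale0r.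
  by rewrite mul0r subr0; apply: seq_span_mem.
rewrite -linearZ /= -[X in h' X]/((F ^+ k.+1 * 1) : S) mulr1.
have aP : (F ^+ k.+1 : V) \in subP P.
  by apply/asboolP/seq_span_mem; rewrite inE eqxx.
rewrite -[F ^+ k.+1]/(val_U (SubT aP)) h'e [g _](g0E _ 1); first by rewrite mulr1.
by rewrite mul1r subrr; apply: ideal0.
Qed.
End Soft.

(** * Torsion and the complex of an injective resolution *)

Section TorsionPow.
Variables (S : gradedRing) (M : gradedMod S) (I : S -> Prop) (L : seq S).
Hypothesis hL : forall a, I a <-> seq_span L a.

(** All products of [t] elements of [I] kill [x]. *)
Definition killed t (x : M) := forall z : 'I_t -> S, (forall k, I (z k)) ->
  (\prod_(k < t) z k) *: x = 0.

Lemma torsion_killed (x : M) : torsion I x <-> exists t, killed t x.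
Proof.
split=> -[t h]; exists t.
  by move=> z hz; apply: h; apply: ideal_span_sub; exists z.
move=> a [n [c [y [hy ->]]]]; rewrite scaler_suml big1 // => k _.
have [z [hz ->]] := hy k; rewrite -scalerA (h _ hz) scaler0 //.
Qed.

Lemma killedZ t a x : killed t x -> killed t (a *: x).
Proof. by move=> h z hz; rewrite scalerA mulrC -scalerA h // scaler0. Qed.

Lemma killed_step t x : (forall f, f \in L -> killed t (f *: x)) -> killed t.+1 x.
Proof.
move=> h z hz; rewrite big_ord_recr /= -scalerA.
have hJ : ideal (fun a => killed t (a *: x)).
  split=> [y hy|a b ha hb y hy|a b hb]; first by rewrite scale0r scaler0.
    by rewrite scalerDl scalerDr ha // hb // addr0.
  by rewrite -scalerA; apply: killedZ.
by apply: (seq_span_min hJ h) => //; apply/hL.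
Qed.

Lemma killed_leq t t' x : (t <= t')%N -> killed t x -> killed t' x.
Proof.
move=> /subnK <-; elim: (t' - t)%N => // n IH h.
by rewrite addSn; apply: killed_step => f _; apply/killedZ/IH.
Qed.

(** Induction on the sum of the exponents. *)
Lemma killed_exp n (e : S -> nat) x : (\sum_(f <- L) e f <= n)%N ->
  (forall f, f \in L -> f ^+ e f *: x = 0) -> exists t, killed t x.
Proof.
elim: n e x => [|n IH] e x hn hx.
  exists 1%N; apply: killed_step => f hf z hz.
  have e0 : e f = 0%N.
    by move: hn; rewrite leqn0 (big_rem f) //= addn_eq0 => /andP[/eqP].
  by have := hx f hf; rewrite e0 scale1r => ->; rewrite !scaler0.
have [t ht] : exists t, forall f, f \in L -> killed t (f *: x).
  have : forall f, f \in L -> exists t, killed t (f *: x).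
    move=> f hf; case ef : (e f) => [|k].
      by exists 0%N => z hz; have := hx f hf; rewrite ef scale1r => ->; rewrite !scaler0.
    apply: (IH (fun g => if g == f then k else e g)).
      move: hn; rewrite !(big_rem f hf) /= eqxx ef addSn ltnS; apply: leq_trans.
      rewrite leq_add2l; apply: leq_sum => g _; case: eqP => // ->; rewrite ef;
        exact: leqnSn.
    move=> g hg; case: eqP => [->|_]; first by rewrite scalerA -exprSr -ef hx.
    by rewrite scalerA mulrC -scalerA hx // scaler0.
  elim: L => [|f l IHl] h; first by exists 0%N.
  have [|t ht] := IHl; first by move=> g hg; apply: h; rewrite inE hg orbT.
  have [t' ht'] := h f (mem_head _ _); exists (maxn t t') => g.
  rewrite inE => /predU1P[->|/ht]; first by apply: killed_leq ht'; apply: leq_maxr.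
  by apply: killed_leq; apply: leq_maxl.
by exists t.+1; apply: killed_step.
Qed.

(** Torsion for an ideal is torsion for each of its generators. *)
Lemma torsionP (x : M) : torsion I x <-> forall f, f \in L -> exists k, f ^+ k *: x = 0.
Proof.
split=> [/torsion_killed[t ht] f hf|h].
  exists t; have := ht (fun=> f); rewrite prodr_const card_ord; apply => _.
  by apply/hL/seq_span_mem.
have [e he] : exists e : S -> nat, forall f, f \in L -> f ^+ e f *: x = 0.
  have : forall f, exists k, f \in L -> f ^+ k *: x = 0.
    move=> f; case: (boolP (f \in L)) => [/h[k hk]|_]; first by exists k.
    by exists 0%N.
  by move=> /choice[e he]; exists e.
by apply/torsion_killed/(killed_exp (leqnn _) he).
Qed.
End TorsionPow.

Section TorsL.
Variable S : gradedRing.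
Implicit Types (C : cplx S) (fs : seq (homElt S)).
(** [x] is torsion for each element of [fs]. *)
Fixpoint tors fs (V : lmodType S) (x : V) : Prop :=
  if fs is f :: fs' then torsf f x /\ tors fs' x else True.

(** The cohomology of the [fs]-torsion of [C] vanishes in bidegree [(p, n)]. *)
Definition gamma_acyc fs C p n := forall x, cdeg C p n x -> tors fs x -> cd x = 0 ->
  exists2 y, cdeg C (p - 1) n y /\ tors fs y & x = cd y.

Lemma gamma_acycE fs C p n : acyc (gamma fs C) p n <-> gamma_acyc fs C p n.
Proof.
elim: fs C => [|f fs IH] C /=.
  split=> h x hx; first by move=> _ dx; have [y] := h x hx dx; exists y.
  by move=> dx; have [//|y []] := h x hx _ dx; exists y.
rewrite IH; split=> h x.
  move=> hx [tf ts] dx; have [|y [[hy ty] tsy] ey] := h x _ ts dx; first by [].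
  by exists y.
move=> [hx tf] ts dx; have [|y [hy [ty tsy]] ey] := h x hx _ dx; first by split.
by exists y.
Qed.

Lemma torsP fs (V : lmodType S) (x : V) :
  tors fs x <-> forall f, f \in map (@elt_val S) fs -> exists k, f ^+ k *: x = 0.
Proof.
elim: fs => [|f fs IH] /=; first by split.
split=> [[hf /IH h] g|h]; first by rewrite inE => /predU1P[->|/h].
split; first by apply: h; rewrite inE eqxx.
by apply/IH => g hg; apply: h; rewrite inE hg orbT.
Qed.
End TorsL.

Section Tot.
Variables (S : gradedRing) (N : gradedMod S) (E : graded_injective_resolution N).

(** The product of the terms of the resolution; its bihomogeneous elements are
    concentrated in a single term. *)
Definition tot := forall p : nat, E p.
HB.instance Definition _ := gen_eqMixin tot.
HB.instance Definition _ := gen_choiceMixin tot.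
Definition tot_add (u v : tot) : tot := fun p => u p + v p.
Definition tot_opp (u : tot) : tot := fun p => - u p.
Definition tot_scale (s : S) (u : tot) : tot := fun p => s *: u p.
Lemma tot_ext (u v : tot) : (forall p, u p = v p) -> u = v.
Proof. exact: functional_extensionality_dep. Qed.
Fact tot_addA : associative tot_add.
Proof. by move=> u v w; apply: tot_ext => p; apply: addrA. Qed.
Fact tot_addC : commutative tot_add.
Proof. by move=> u v; apply: tot_ext => p; apply: addrC. Qed.
Fact tot_add0 : left_id (fun p => 0 : E p) tot_add.
Proof. by move=> u; apply: tot_ext => p; apply: add0r. Qed.
Fact tot_addN : left_inverse (fun p => 0 : E p) tot_opp tot_add.
Proof. by move=> u; apply: tot_ext => p; apply: addNr. Qed.
HB.instance Definition _ := GRing.isZmodule.Build tot tot_addA tot_addC tot_add0 tot_addN.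
Fact tot_scaleA s t u : tot_scale s (tot_scale t u) = tot_scale (s * t) u.
Proof. by apply: tot_ext => p; apply: scalerA. Qed.
Fact tot_scale1 : left_id 1 tot_scale.
Proof. by move=> u; apply: tot_ext => p; apply: scale1r. Qed.
Fact tot_scaleDr : right_distributive tot_scale +%R.
Proof. by move=> s u v; apply: tot_ext => p; apply: scalerDr. Qed.
Fact tot_scaleDl u : {morph tot_scale^~ u : s t / s + t}.
Proof. by move=> s t; apply: tot_ext => p; apply: scalerDl. Qed.
HB.instance Definition _ := GRing.Zmodule_isLmodule.Build S tot
  tot_scaleA tot_scale1 tot_scaleDr tot_scaleDl.

Definition totd (u : tot) : tot :=
  fun p => match p with 0 => 0 | p'.+1 => res_d E p' (u p') end.
Fact totd_linear : linear totd.
Proof.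
move=> a u v; apply: tot_ext => -[|p] /=; last exact: linearP.
by rewrite -[RHS]/(a *: (0 : E 0%N) + 0) scaler0 addr0.
Qed.
HB.instance Definition _ := GRing.isLinear.Build S tot tot _ totd totd_linear.
Definition totdeg (p n : int) (u : tot) :=
  (forall q : nat, q%:Z != p -> u q = 0) /\ forall q, mdegree n (u q).

Fact totdd u : totd (totd u) = 0.
Proof.
apply: tot_ext => -[|[|p]] //=; first exact: linear0.
by apply/res_exactS; exists (u p).
Qed.
Fact totdeg0 p n : totdeg p n 0.
Proof. by split=> // q; apply: (dsum0 (@mdegree_sum _ _)). Qed.
Fact totdegB p n x y : totdeg p n x -> totdeg p n y -> totdeg p n (x - y).
Proof.
move=> [a b] [c d]; split=> [q hq|q]; last exact: (dsumB (@mdegree_sum _ _)).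
by rewrite -[LHS]/(x q - y q) a // c // subrr.
Qed.
Fact totdegZ p n k s x : rdeg k s -> totdeg p n x -> totdeg p (n + k) (s *: x).
Proof.
move=> hs [a b]; split=> [q hq|q]; last by rewrite addrC; apply: mdegreeZ.
by rewrite -[LHS]/(s *: x q) a // scaler0.
Qed.
Fact totdegd p n x : totdeg p n x -> totdeg (p + 1) n (totd x).
Proof.
move=> [a b]; split=> [[|q] hq|[|q]] //=.
- rewrite a ?linear0 //; apply: contra hq => /eqP <-.
  by rewrite -PoszD addn1.
- exact: (dsum0 (@mdegree_sum _ _)).
by apply: res_d_deg.
Qed.
(** The resolution as a complex. *)
Definition Tot := Cplx totdd totdeg0 totdegB totdegZ totdegd.

(** The inclusion of the term of index [p]. *)
Definition tin p (x : E p) : tot := dfwith (fun q => 0 : E q) x.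
Lemma tin_in p (x : E p) : tin x p = x. Proof. exact: dfwith_in. Qed.
Lemma tin_out p (x : E p) q : p != q -> tin x q = 0. Proof. exact: dfwith_out. Qed.
Lemma tin_deg p n (x : E p) : mdegree n x -> totdeg p n (tin x).
Proof.
move=> hx; split=> [q hq|q]; first by rewrite tin_out // eq_sym.
have [<-|hpq] := eqVneq p q; first by rewrite tin_in.
by rewrite tin_out //; apply: (dsum0 (@mdegree_sum _ _)).
Qed.
Lemma tinZ p s (x : E p) : s *: tin x = tin (s *: x).
Proof.
apply: tot_ext => q; rewrite -[LHS]/(s *: tin x q).
have [<-|hpq] := eqVneq p q; first by rewrite !tin_in.
by rewrite !tin_out // scaler0.
Qed.
Lemma tin0 p : tin (0 : E p) = 0.
Proof. by have := tinZ 0 (0 : E p); rewrite scale0r => ->; rewrite scale0r. Qed.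
Lemma tinE (p : nat) n (u : tot) : totdeg p n u -> u = tin (u p).
Proof.
move=> [h _]; apply: tot_ext => q.
have [<-|hpq] := eqVneq p q; first by rewrite !tin_in.
by rewrite tin_out // h // eqz_nat eq_sym.
Qed.
Lemma totd_tin p (x : E p) : totd (tin x) = tin (res_d E p x).
Proof.
apply: tot_ext => -[|q] /=; first by rewrite tin_out.
have [<-|hpq] := eqVneq p q; first by rewrite !tin_in.
by rewrite !tin_out // linear0.
Qed.
Lemma totdeg_neg k n u : totdeg (Negz k) n u -> u = 0.
Proof. by move=> [h _]; apply: tot_ext => q; apply: h. Qed.

Lemma cd_tin p (x : E p) : cd (tin x : Tot) = tin (res_d E p x).
Proof. exact: totd_tin. Qed.

Lemma Tot_soft : noetherian S -> soft Tot.
Proof.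
move=> hS gs f [p|p] n x hx hg; last first.
  exists 0%N, 0; split=> [|g _|]; [exact: cdeg0|exact: scaler0|].
  by rewrite (totdeg_neg hx) !scaler0.
have hxp : mdegree (n + elt_deg f) (x p) by case: hx.
have hgp g : g \in map (@elt_val S) gs -> g *: x p = 0.
  by move=> /hg /(congr1 (fun u : tot => u p)).
have [k [y [hy hgy ey]]] := graded_injective_soft hS (@res_inj _ _ E p) hxp hgp.
exists k, (tin y); split; first exact: tin_deg.
  by move=> g /hgy e; rewrite tinZ e tin0.
by rewrite (tinE hx) !tinZ ey.
Qed.
End Tot.

(** * Local cohomology as the cohomology of a torsion subcomplex *)

Lemma mproj_map (S : gradedRing) (M N : gradedMod S) (f : {linear M -> N}) :
  degree_preserving f -> forall n x, f (mproj n x) = mproj n (f x).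
Proof.
move=> hf n x; have [r [ur r0 er]] := proj_sum (@mdegree_sum S M) x.
apply/esym/(@proj_uniq _ _ _ (fun n => f (mproj n x)) r) => //.
- by move=> k; apply: hf; apply: projD.
- by move=> k /r0; rewrite /mproj => ->; rewrite linear0.
by rewrite {1}er linear_sum.
Qed.

Section Coh.
Variables (S : gradedRing) (N : gradedMod S) (E : graded_injective_resolution N).
Variables (I : S -> Prop) (fs : seq (homElt S)).
Hypothesis hfs : forall a, I a <-> seq_span (map (@elt_val S) fs) a.

Lemma torsion_tors p (x : E p) : torsion I x <-> tors fs x.
Proof. by rewrite (torsionP hfs) torsP. Qed.

Lemma tors_tin p (x : E p) : tors fs (tin x) <-> tors fs x.
Proof.
rewrite !torsP; split=> h f /h[k e]; exists k; last by rewrite tinZ e tin0.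
by have := congr1 (fun u : tot E => u p) e; rewrite tinZ tin_in.
Qed.

Lemma tors_proj p n (x : E p) : tors fs x -> tors fs (mproj n x).
Proof.
rewrite !torsP => h f hf; have [k e] := h f hf; exists k.
have [d hd] := mem_elt_val hf.
have := congr1 (mproj (n + k%:Z * d)) e.
by rewrite (mproj_scale _ _ (rdegX k hd)) addrK => ->; apply/proj0.
Qed.

Variables (M : gradedMod S) (i : nat) (pi : E i -> M).
Hypothesis pi_ker : forall x, cocycle I x -> (pi x = 0 <-> coboundary I x).
Hypothesis pi_deg : forall n y, mdegree n y <->
          exists x, [/\ cocycle I x, mdegree n x & pi x = y].

(** [M] is the [i]-th cohomology of the [I]-torsion of [E], so vanishing passes
    from [M_j] to that cohomology in degree [j].  The next lemma is the converse, for
    all degrees together. *)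
Lemma coh_gamma_acyc j : (forall x : M, mdegree j x -> x = 0) ->
  gamma_acyc fs (Tot E) i j.
Proof.
move=> hM u hu tu du; have eu := tinE hu; set x := u i in eu.
have cx : cocycle I x.
  split; first by apply/torsion_tors/tors_tin; rewrite -eu.
  have := du; rewrite eu cd_tin => /(congr1 (fun u : tot E => u i.+1)).
  by rewrite tin_in.
have xj : mdegree j x by case: hu.
have /pi_ker : pi x = 0 by apply/hM/pi_deg; exists x.
move=> /(_ cx); rewrite {}eu; case: (i) (x) xj => [|k] /= z zj.
  move=> ->; exists 0; last by rewrite tin0 linear0.
  split; first exact: totdeg0.
  by apply/torsP => f _; exists 0%N; rewrite scaler0.
move=> [y [/torsion_tors ty ey]]; exists (tin (mproj j y)).
  split; last exact/tors_tin/tors_proj.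
  by rewrite intS addrAC subrr add0r; apply: tin_deg; apply: projD.
rewrite totd_tin (mproj_map (@res_d_deg _ _ E k)) ey.
by rewrite /mproj proj_id.
Qed.

Lemma gamma_acyc_coh : (forall j, gamma_acyc fs (Tot E) i j) -> forall x : M, x = 0.
Proof.
move=> h x; apply: (proj_all0 (hD := @mdegree_sum S M)) => n.
have /pi_deg[z [cz hz <-]] := projD (@mdegree_sum S M) n x.
apply/pi_ker => //; have [tz dz] := cz.
have [|||y [hy ty] ey] := h n (tin z).
- exact: tin_deg.
- exact/tors_tin/torsion_tors.
- by rewrite cd_tin dz tin0.
have := congr1 (fun u : tot E => u i) ey; rewrite tin_in.
move: hy; case: (i) (z) => [|k] w /= hy ->.
  by [].
exists (y k); split=> //; apply/torsion_tors/tors_tin.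
suff <- : y = tin (y k) by [].
by apply: (@tinE _ _ _ _ n); move: hy; rewrite intS addrAC subrr add0r.
Qed.
End Coh.

Section Base.
Variables (S : gradedRing) (V : lmodType S) (D : int -> V -> Prop).
Hypothesis D0 : forall n, D n 0.
Hypothesis DB : forall n x y, D n x -> D n y -> D n (x - y).
Hypothesis DZ : forall n k s x, rdeg k s -> D n x -> D (n + k) (s *: x).

Definition zmap (x : V) : V := 0.
Fact zmap_linear : linear zmap. Proof. by move=> a x y; rewrite /zmap scaler0 addr0. Qed.
HB.instance Definition _ := GRing.isLinear.Build S V V _ zmap zmap_linear.
(** The module [V], with [D] as its grading, in cohomological degree 0. *)
Definition bdeg (p n : int) (x : V) := if p == 0 then D n x else x = 0.
Fact bdd x : zmap (zmap x) = 0. Proof. by []. Qed.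
Fact bdeg0 p n : bdeg p n 0. Proof. by rewrite /bdeg; case: ifP. Qed.
Fact bdegB p n x y : bdeg p n x -> bdeg p n y -> bdeg p n (x - y).
Proof. by rewrite /bdeg; case: ifP => _; [apply: DB|move=> -> ->; rewrite subrr]. Qed.
Fact bdegZ p n k s x : rdeg k s -> bdeg p n x -> bdeg p (n + k) (s *: x).
Proof. by rewrite /bdeg; case: ifP => _; [apply: DZ|move=> _ ->; rewrite scaler0]. Qed.
Fact bdegd p n x : bdeg p n x -> bdeg (p + 1) n (zmap x).
Proof. by move=> _; apply: bdeg0. Qed.
Definition base := Cplx bdd bdeg0 bdegB bdegZ bdegd.

Variables (N : gradedMod S) (E : graded_injective_resolution N) (phi : V -> N).
Hypothesis phi_lin : linear phi.
Hypothesis phi_deg : forall n x, D n x -> mdegree n (phi x).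
Hypothesis phi_surj : forall n y, mdegree n y -> exists2 x, D n x & phi x = y.
Hypothesis phi_inj : forall n x, D n x -> phi x = 0 -> x = 0.

(** The augmentation of a resolution of [N], preceded by a map [phi] that identifies
    the homogeneous elements of [base] with those of [N]. *)
Definition aug_map (x : base) : Tot E := tin (res_aug E (phi x)).

Lemma aug_quasi_iso : quasi_iso aug_map.
Proof.
have phi0 : phi 0 = 0.
  by have := phi_lin (-1) 0 0; rewrite scaler0 addr0 scaleN1r addNr.
have aug0 : aug_map 0 = 0 by rewrite /aug_map phi0 linear0 tin0.
split.
- apply/order_lt1P => a x y; apply: tot_ext => q; rewrite /aug_map.
  rewrite -[RHS]/(a *: tin (res_aug E (phi x)) q + tin (res_aug E (phi y)) q).
  have [<-|h] := eqVneq 0%N q; first by rewrite !tin_in phi_lin linearP.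
  by rewrite !tin_out // scaler0 addr0.
- move=> p n x; rewrite [cd x]/(0 : V) aug0 cd_tin => hx.
  have -> : res_d E 0 (res_aug E (phi x)) = 0 by apply/res_exact0; exists (phi x).
  by rewrite tin0.
- move=> p n x; rewrite /= /bdeg; case: eqP => [->|_]; last first.
    by move=> ->; rewrite aug0; apply: totdeg0.
  by move=> hx; apply: tin_deg; apply: res_aug_deg; apply: phi_deg.
move=> p n x u /= hx hu _ eu.
have triv : x = 0 -> u = 0 -> exists (y : base) (y' : Tot E),
   [/\ cdeg base p n y, totdeg (p - 1) n y', x = zmap y & u = aug_map y - totd y'].
  move=> -> ->; exists 0, 0; split=> //; [exact: bdeg0|exact: totdeg0|].
  by rewrite aug0 sub0r; symmetry; rewrite linear0 oppr0.
move: p hx hu triv => [[|k]|[|k]] hx hu triv.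
- have ex : x = 0 by [].
  have hu0 := tinE hu.
  have hd : res_d E 0 (u 0%N) = 0.
    have := congr1 (fun u : tot E => u 1%N) eu; rewrite ex aug0 /=.
    by move=> <-.
  have [y ey] := (res_exact0 (u 0%N)).1 hd.
  have uj : mdegree n (u 0%N) by case: hu.
  have ey' : res_aug E (mproj n y) = u 0%N.
    by rewrite (mproj_map (@res_aug_deg _ _ E)) ey /mproj proj_id.
  have [x' hx' ex'] := phi_surj (projD (@mdegree_sum S N) n y).
  exists x', 0; split=> //; first exact: totdeg0.
  by rewrite linear0 subr0 /aug_map ex' [res_aug E _]ey'.
- have ex : x = 0 by [].
  have hu0 := tinE hu.
  have hd : res_d E k.+1 (u k.+1) = 0.
    have := congr1 (fun u : tot E => u k.+2) eu; rewrite ex aug0 /=.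
    by move=> <-.
  have [w ew] := (res_exactS (u k.+1)).1 hd.
  have uj : mdegree n (u k.+1) by case: hu.
  exists 0, (- tin (mproj n w)); split=> //.
    rewrite intS addrAC subrr add0r -[- _]sub0r; apply: totdegB; first exact: totdeg0.
    apply: tin_deg; apply: projD.
  rewrite aug0 sub0r linearN opprK /= totd_tin (mproj_map (@res_d_deg _ _ E k)) ew.
  by rewrite /mproj proj_id.
- have eu0 := totdeg_neg hu; apply: triv => //.
  apply: phi_inj hx _; apply: (@res_aug_inj _ _ E); rewrite linear0.
  have := congr1 (fun u : tot E => u 0%N) eu; rewrite /aug_map tin_in eu0 => ->.
  by rewrite linear0.
by apply: triv => //; apply: (totdeg_neg hu).
Qed.
End Base.

(** * Noetherian rings *)

Section Hilbert.

Lemma noetherian_surj (A B : comNzRingType) (f : {rmorphism A -> B}) :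
  (forall b, exists a, f a = b) -> noetherian A -> noetherian B.
Proof.
move=> fs hA J hJ.
have hI : ideal (fun a => J (f a)).
  split=> [|a b|a b]; first by rewrite rmorph0; apply: ideal0.
    by rewrite rmorphD; apply: idealD.
  by rewrite rmorphM; apply: idealM.
have [s hs] := hA _ hI; exists (map f s) => b; split.
  have [a <-] := fs b; move=> /hs.
  apply: (@seq_span_min _ _ (fun a => seq_span (map f s) (f a))) => [|c hc].
    have h := seq_span_ideal (map f s).
    split=> [|c d|c d]; first by rewrite rmorph0; apply: ideal0.
      by rewrite rmorphD; apply: idealD.
    by rewrite rmorphM; apply: idealM.
  by apply/seq_span_mem/map_f.
apply: seq_span_min => // c /mapP[a ha ->].
by apply/(hs a)/seq_span_mem.
Qed.

Variable A : comNzRingType.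

(** Choice of one related polynomial for each element of a sequence. *)
Lemma lift_span (s : seq A) (L : A -> {poly A} -> Prop) :
  (forall a, a \in s -> exists p, L a p) ->
  exists l : seq {poly A}, (forall p, p \in l -> exists2 a, a \in s & L a p) /\
    (forall a, a \in s -> exists2 p, p \in l & L a p).
Proof.
elim: s => [|a s IH] h; first by exists [::].
have [|l [hl hl']] := IH; first by move=> b hb; apply: h; rewrite inE hb orbT.
have [p hp] := h a (mem_head _ _).
exists (p :: l); split=> [q|b]; rewrite inE => /predU1P[->|].
- by exists a; rewrite ?mem_head.
- by move=> /hl[b hb hbq]; exists b; rewrite // inE hb orbT.
- by exists p; rewrite ?mem_head.
by move=> /hl'[q hq hbq]; exists q; rewrite // inE hq orbT.
Qed.

(** Hilbert's basis theorem.  [L d] is the ideal of the coefficients of degree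
    [d] of the elements of [J] of degree at most [d]; this chain stops at some
    [N], and lifts of generators of [L 0, ..., L N] generate [J]. *)
Lemma noetherian_poly : noetherian A -> noetherian {poly A}.
Proof.
move=> hA J hJ.
pose L d a := exists p : {poly A}, [/\ J p, (size p <= d.+1)%N & p`_d = a].
have hL d : ideal (L d).
  split=> [|a b [p [hp sp ep]] [q [hq sq eq]]|a b [p [hp sp ep]]].
  - by exists 0; rewrite size_poly0 coef0; split=> //; apply: ideal0.
  - exists (p + q); split; first exact: idealD.
      by rewrite (leq_trans (size_polyD _ _)) // geq_max sp.
    by rewrite coefD ep eq.
  - exists (a%:P * p); split; first exact: idealM.
      by rewrite mul_polyC (leq_trans (size_scale_leq _ _)).
    by rewrite coefCM ep.
have LS d a : L d a -> L d.+1 a.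
  move=> [p [hp sp ep]]; exists ('X * p); split; first exact: idealM.
    by rewrite (leq_trans (size_polyMleq _ _)) // size_polyX.
  by rewrite coefXM.
have [N hN] := noetherian_acc hA hL LS.
have gen d : exists l : seq {poly A}, (forall p, p \in l -> J p /\ (size p <= d.+1)%N) /\
    forall a, L d a -> exists2 p, seq_span l p & (size p <= d.+1)%N /\ p`_d = a.
  have [s hs] := hA _ (hL d).
  have [|l [hl hl']] := @lift_span s (fun a p => [/\ J p, (size p <= d.+1)%N & p`_d = a]).
    by move=> a ha; apply/hs/seq_span_mem.
  exists l; split; first by move=> p /hl[a _ [h1 h2 _]].
  move=> a /hs; apply: (@seq_span_min _ s (fun a => exists2 p,
    seq_span l p & (size p <= d.+1)%N /\ p`_d = a)).
    have hl0 := seq_span_ideal l.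
    split=> [|b c [p hp [sp ep]] [q hq [sq eq]]|b c [p hp [sp ep]]].
    - by exists 0; [apply: ideal0|rewrite size_poly0 coef0].
    - exists (p + q); first exact: idealD.
      by rewrite (leq_trans (size_polyD _ _)) ?geq_max ?sp // coefD ep eq.
    - exists (b%:P * p); first exact: idealM.
      by rewrite mul_polyC (leq_trans (size_scale_leq _ _)) // coefZ ep.
  by move=> b /hl'[p hp [h1 h2 h3]]; exists p; [apply: seq_span_mem|].
have [G hG] := choice gen.
pose l := flatten (map G (iota 0 N.+1)).
have lG d p : (d <= N)%N -> seq_span (G d) p -> seq_span l p.
  move=> hd; apply: seq_span_sub => q hq; apply/flattenP; exists (G d) => //.
  by apply: map_f; rewrite mem_iota.
have hl0 := seq_span_ideal l.
exists l => p; split; last first.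
  apply: seq_span_min => // q /flattenP[_ /mapP[d _ ->]].
  by have [h _] := hG d => /h[].
have [n] := ubnP (size p); elim: n p => // n IH p; rewrite ltnS => sn hp.
case: (posnP (size p)) => [/eqP|sp].
  by rewrite size_poly_eq0 => /eqP ->; apply: ideal0.
(* a span element with the same leading term *)
suff [q hq [sq eq]] : exists2 q, seq_span l q &
    (size q <= size p)%N /\ q`_(size p).-1 = p`_(size p).-1.
  have hJq : J q.
    apply: seq_span_min hq => // r /flattenP[_ /mapP[d _ ->]].
    by have [h _] := hG d => /h[].
  rewrite -(subrK q p); apply: idealD => //; apply: IH; last exact: idealB.
  apply: leq_trans sn; rewrite -(prednK sp) ltnS; apply/leq_sizeP => j.
  rewrite leq_eqVlt => /predU1P[<-|hj]; first by rewrite coefB eq subrr.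
  rewrite (prednK sp) in hj.
  by rewrite coefB !nth_default ?subrr // (leq_trans sq).
set d := (size p).-1.
have hLd : L d p`_d by exists p; split=> //; rewrite /d prednK.
have [dN|Nd] := leqP d N.
  have [_ h] := hG d; have [q hq [sq eq]] := h _ hLd.
  by exists q; [apply: lG hq|split=> //; rewrite -(prednK sp)].
have [_ h] := hG N; have [q hq [sq eq]] := h _ (hN _ _ hLd).
exists ('X^(d - N) * q); first by apply: idealM => //; apply: lG hq.
split.
  rewrite (leq_trans (size_polyMleq _ _)) // size_polyXn -(prednK sp) -/d; lia.
by rewrite coefXnM ltnNge leq_subr /= subKn ?eq // ltnW.
Qed.
End Hilbert.

Lemma noetherian_mpoly (A : comNzRingType) n : noetherian A -> noetherian {mpoly A[n]}.
Proof.
move=> hA; elim: n => [|n IH].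
  apply: (noetherian_surj (f := @mpolyC 0 A)) hA => p.
  exists p@_0%MM; apply/mpolyP => u; rewrite mcoeffC.
  have -> : u = 0%MM by apply/mnmP => -[].
  by rewrite eqxx mulr1.
pose X : {mpoly A[n.+1]} := 'X_ord_max.
have cX : commr_rmorph (@mwiden n A) X by move=> x; apply: mulrC.
pose f : {rmorphism {poly {mpoly A[n]}} -> {mpoly A[n.+1]}} := horner_morph cX.
apply: (noetherian_surj (f := f)) (noetherian_poly IH).
have fC p : f p%:P = mwiden p by apply: horner_morphC.
have fX : f 'X = X by apply: horner_morphX.
elim/mpolyind => [|c u p _ _ [q <-]]; first by exists 0; rewrite rmorph0.
suff [r er] : exists r, f r = c *: 'X_[u] by exists (r + q); rewrite rmorphD er.
have fx i : exists r, f r = 'X_i.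
  have [->|hi] := eqVneq i ord_max; first by exists 'X.
  have hj : (i < n)%N.
    by rewrite ltn_neqAle -ltnS ltn_ord andbT; apply: contra hi => /eqP e;
      apply/eqP/val_inj.
  exists ('X_(Ordinal hj))%:P; rewrite fC mwidenX mnmwiden1; congr 'X_[U_(_)].
  exact: val_inj.
rewrite -mul_mpolyC mpolyXE_id.
have [g hg] := choice fx.
exists ((c%:MP)%:P * \prod_(i < n.+1) g i ^+ u i).
rewrite rmorphM fC mwidenC rmorph_prod; congr (_ * _).
by apply: eq_bigr => i _; rewrite rmorphXn hg.
Qed.

(** A subring that is a direct factor, as a module over itself, is noetherian. *)
Lemma noetherian_retract (B R : comNzRingType) (f : {rmorphism B -> R}) (rho : R -> B) :
  (forall x y, rho (x + y) = rho x + rho y) -> (forall b r, rho (f b * r) = b * rho r) ->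
  rho 1 = 1 -> noetherian R -> noetherian B.
Proof.
move=> rD rM r1 hR J hJ.
pose X (r : R) := exists2 b, J b & r = f b.
have [l [hl hl']] := noetherian_span X hR.
have [s [hs es]] : exists s, (forall b, b \in s -> J b) /\ map f s = l.
  elim: l hl {hl'} => [|r l IH] h; first by exists [::].
  have [|s [hs es]] := IH; first by move=> b hb; apply: h; rewrite inE hb orbT.
  have [b hb eb] := h r (mem_head _ _); exists (b :: s); split; last by rewrite /= es eb.
  by move=> c; rewrite inE => /predU1P[->|/hs].
exists s => b; split; last by apply: seq_span_min.
move=> hb; have : seq_span l (f b) by apply/hl'/ideal_span_sub; exists b.
rewrite -es => h.
suff: seq_span s (rho (1 * f b)) by rewrite mulrC rM r1 mulr1.
have h0 : rho 0 = 0 by apply: (@addIr _ (rho 0)); rewrite -rD !add0r.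
have hI := seq_span_ideal s.
move: (1 : R); apply: (@seq_span_min _ (map f s) (fun r => forall t,
  seq_span s (rho (t * r)))) h.
  split=> [t|a c ha hc t|a c hc t]; first by rewrite mulr0 h0; apply: ideal0.
    by rewrite mulrDr rD; apply: idealD.
  by rewrite mulrA; apply: hc.
move=> _ /mapP[c hc ->] t; rewrite mulrC rM mulrC; apply: idealM => //.
exact: seq_span_mem.
Qed.

(** * Functoriality of the Cech complex, and the descent argument *)

Section CechFunctoriality.
Variable S : gradedRing.
Implicit Types (C D : cplx S) (fs : seq (homElt S)).

Lemma cech_map_id fs C : cech_map (fs := fs) (@id C) =1 id.
Proof.
elim: fs C => //= f fs IH C x.
have -> : cone_map f (@id C) = id by apply: funext; apply: cone_map_id.
exact: IH.
Qed.

Lemma cech_map_comp fs C D (E : cplx S) (psi : D -> E) (phi : C -> D) :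
  diffop psi -> diffop phi -> cech_map (fs :=
    fs) (psi \o phi) =1 cech_map psi \o cech_map phi.
Proof.
elim: fs C D E psi phi => //= f fs IH C D E psi phi h h' x.
have -> : cone_map f (psi \o phi) = cone_map f psi \o cone_map f phi.
  by apply: funext; apply: cone_map_comp.
by apply: IH; apply: diffop_cone_map.
Qed.

Lemma cech_map_lincomb fs C D a (phi psi : C -> D) : diffop psi -> diffop phi ->
  cech_map (fs := fs) (fun x => phi x + a *: psi x) =1
  fun u => cech_map phi u + a *: cech_map psi u.
Proof.
elim: fs C D phi psi => //= f fs IH C D phi psi h h' x.
have -> : cone_map f (fun x => phi x + a *: psi x) = fun u =>
  cone_map f phi u + a *: cone_map f psi u.
  by apply: funext; apply: cone_map_lincomb.
by apply: IH; apply: diffop_cone_map.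
Qed.

Lemma diffop_cech_map fs C D (phi : C -> D) : diffop phi -> diffop (cech_map (fs :=
  fs) phi).
Proof. by elim: fs C D phi => //= f fs IH C D phi h; apply/IH/diffop_cone_map. Qed.

Lemma graded_op_cech_map fs C D e (phi : C -> D) : graded_op e phi ->
  graded_op e (cech_map (fs := fs) phi).
Proof. by elim: fs C D phi => //= f fs IH C D phi h; apply/IH/graded_op_cone_map. Qed.

Lemma cech_map_euler fs C (E : C -> C) : diffop E ->
  (forall p n x, cdeg C p n x -> E x = x *~ n) ->
  (forall k s x, rdeg k s -> E (s *: x) = s *: E x + (s *: x) *~ k) ->
  forall p n u, cdeg (cech fs C) p n u -> cech_map E u = u *~ n.
Proof.
elim: fs C E => //= f fs IH C E h hn hs.
have [hn' hs'] := @cone_map_euler _ f _ _ h hn hs.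
exact: IH (diffop_cone_map f h) hn' hs'.
Qed.

Lemma cech_mapD fs C D (phi psi : C -> D) : diffop psi -> diffop phi ->
  cech_map (fs := fs) (fun x => phi x + psi x) =1 fun u =>
    cech_map phi u + cech_map psi u.
Proof.
move=> h h' u; have := cech_map_lincomb (fs := fs) 1 h h' u; rewrite scale1r => <-.
by congr (cech_map _ u); apply: funext => x; rewrite scale1r.
Qed.

Lemma cech_map_zero fs C D : cech_map (fs := fs) (fun _ : C => 0 : D) =1 fun=> 0.
Proof.
have h : diffop (fun _ : C => 0 : D) by exists 0%N.
move=> u; have := cech_mapD (fs := fs) h h u.
have -> : (fun _ : C => (0 : D) + 0) = (fun _ : C => 0) by apply: funext => x;
  rewrite addr0.
by move=> /eqP; rewrite addrC -subr_eq subrr => /eqP.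
Qed.

Lemma diffop_add C D (phi psi : C -> D) : diffop psi -> diffop phi -> diffop (fun x =>
  phi x + psi x).
Proof.
move=> h h'; have := diffop_lincomb 1 h' h; congr diffop.
by apply: funext => x; rewrite scale1r.
Qed.

Lemma diffop_zero C D : diffop (fun _ : C => 0 : D). Proof. by exists 0%N. Qed.

Lemma diffop_sum (T : Type) (r : seq T) (P : pred T) C D (F : T -> C -> D) :
  (forall i, P i -> diffop (F i)) -> diffop (fun x => \sum_(i <- r | P i) F i x).
Proof.
move=> h; elim: r => [|i r IH].
  by have := diffop_zero C D; congr diffop; apply: funext => x; rewrite big_nil.
have -> : (fun x => \sum_(j <- i :: r | P j) F j x) =
    if P i then fun x => F i x + \sum_(j <- r | P j) F j x
    else fun x => \sum_(j <- r | P j) F j x.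
  by apply: funext => x; rewrite big_cons; case: (P i).
by case: ifP => // hi; apply: diffop_add => //; apply: h.
Qed.

Lemma cech_map_sum fs (T : Type) (r : seq T) (P : pred T) C D (F : T -> C -> D) :
  (forall i, P i -> diffop (F i)) ->
  cech_map (fs := fs) (fun x => \sum_(i <- r | P i) F i x) =1
  fun u => \sum_(i <- r | P i) cech_map (F i) u.
Proof.
move=> h u; elim: r => [|i r IH].
  rewrite big_nil -[RHS](@cech_map_zero fs C D u).
  by congr (cech_map _ u); apply: funext => x; rewrite big_nil.
have -> : (fun x => \sum_(j <- i :: r | P j) F j x) =
    if P i then fun x => F i x + \sum_(j <- r | P j) F j x
    else fun x => \sum_(j <- r | P j) F j x.
  by apply: funext => x; rewrite big_cons; case: (P i).
rewrite big_cons; case: ifP => // hi.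
by rewrite cech_mapD ?IH //; [apply: diffop_sum|apply: h].
Qed.

Lemma cone_map_agree (f : homElt S) C D (phi psi : C -> D) : order_lt 1 phi ->
  order_lt 1 psi ->
  (forall p n x, cdeg C p n x -> phi x = psi x) ->
  forall p n u, cdeg (cone f C) p n u -> cone_map f phi u = cone_map f psi u.
Proof.
move=> h h' e p n [x y] [/= hx [k [z [hz ez]]]]; congr (_, _); first exact: e hx.
apply/eqP; rewrite -subr_eq0; apply/eqP/(@locfX_inj _ (elt_val f) _ k).
rewrite scalerBr -(order_lt1Z (locmap_order_lt1 _ h)) -(order_lt1Z (locmap_order_lt1 _
  h')) /= ez.
rewrite !locmap_eta; [|exact: order_lt1_diffop|exact: order_lt1_diffop].
by rewrite (e _ _ _ hz) subrr.
Qed.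

(** Linear maps that agree on bihomogeneous elements still do so on the Cech
    complexes. *)
Lemma cech_map_agree fs C D (phi psi : C -> D) : order_lt 1 phi -> order_lt 1 psi ->
  (forall p n x, cdeg C p n x -> phi x = psi x) ->
  forall p n u, cdeg (cech fs C) p n u -> cech_map phi u = cech_map psi u.
Proof.
elim: fs C D phi psi => [|f fs IH] C D phi psi h h' e p n u; first exact: e.
apply: (IH _ _ (cone_map f phi) (cone_map f psi));
  [exact: order_lt1_cone_map|exact: order_lt1_cone_map|].
exact: cone_map_agree.
Qed.
End CechFunctoriality.

Section Benson.
Variables (S : gradedRing) (C C0 : cplx S) (iota : C0 -> C) (rho : C -> C0).
Variables (gT : finGroupType) (G : {group gT}) (J : finType).
Variables (gam : gT -> C -> C) (Y : gT -> J -> C -> C) (Y' : J -> C -> C).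
Variables (eps c p : int).
(** [C0] is a direct factor of [C], cut out by the averaging operator of a group
    [G] acting on [C] by [gam].  The operators [Y g j], of degree [eps], commute,
    and [G] permutes them by translation of [g]; [\sum_j Y' j (Y 1 j x)] is
    [n + c] times [x] when [x] has internal degree [n]. *)
Hypothesis iota_graded_op : graded_op 0 iota.
Hypothesis rho_graded_op : graded_op 0 rho.
Hypothesis rhoK : forall n z, cdeg C0 p n z -> rho (iota z) = z.
Hypothesis gam_iota : forall g z, g \in G -> gam g (iota z) = iota z.
Hypothesis gam_diffop : forall g, g \in G -> diffop (gam g).
Hypothesis gam_rho : forall x, iota (rho x) *+ #|G| = \sum_(g in G) gam g x.
Hypothesis Y_graded_op : forall g j, g \in G -> graded_op eps (Y g j).
Hypothesis Y'_graded_op : forall j, graded_op (- eps) (Y' j).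
Hypothesis YC : forall g h i j x, g \in G -> h \in G -> Y g i (Y h j x) = Y h j (Y g i x).
Hypothesis gamY : forall g h j x, g \in G -> h \in G ->
  gam h (Y g j x) = Y (h * g)%g j (gam h x).
Hypothesis euler : forall n x, cdeg C p n x -> \sum_j Y' j (Y 1%g j x) = x *~ (n + c).
Hypothesis divS : forall n : nat, (0 < n)%N -> exists s : S, rdeg 0 s /\ s * n%:R = 1.

(* cocycles and coboundaries of cohomological degree [p] *)
Let Z n x := cdeg C p n x /\ cd x = 0.
Let B n x := exists2 y, cdeg C (p - 1) n y & x = cd y.

Lemma Bd_sub n x y : B n x -> B n y -> B n (x - y).
Proof.
move=> [a ha ->] [b hb ->]; exists (a - b); first exact: cdegB.
by rewrite linearB.
Qed.
Lemma Bd_0 n : B n 0. Proof. by exists 0; [apply: cdeg0|rewrite linear0]. Qed.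
Lemma Bd_N n x : B n (- x) -> B n x.
Proof. by move=> /(Bd_sub (Bd_0 n)); rewrite sub0r opprK. Qed.
Lemma Bd_add n x y : B n x -> B n y -> B n (x + y).
Proof. by move=> h h'; rewrite -[y]opprK; apply: Bd_sub => //; rewrite -sub0r;
  apply: Bd_sub => //; apply: Bd_0. Qed.
Lemma Bd_sum n (T : finType) (P : pred T) (F : T -> C) :
  (forall i, P i -> B n (F i)) -> B n (\sum_(i | P i) F i).
Proof. by move=> h; elim/big_ind: _ => //; [apply: Bd_0|apply: Bd_add]. Qed.
Lemma Bd_op n e (psi : C -> C) x : graded_op e psi -> B n x -> B (n + e) (psi x).
Proof. by move=> [_ hc hd] [y hy ->]; exists (psi y); rewrite ?hc //; apply: hd. Qed.
Lemma Z_op n e (psi : C -> C) x : graded_op e psi -> Z n x -> Z (n + e) (psi x).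
Proof. by move=> [hd hc hdg] [a b]; split; [apply: hdg|rewrite -hc b (diffop0 hd)]. Qed.
Lemma Z_sub n x y : Z n x -> Z n y -> Z n (x - y).
Proof. by move=> [a b] [d e]; split; [apply: cdegB|rewrite linearB /= b e subrr]. Qed.
Lemma Z_0 n : Z n 0. Proof. by split; [apply: cdeg0|apply: linear0]. Qed.
Lemma Z_add n x y : Z n x -> Z n y -> Z n (x + y).
Proof. by move=> h h'; rewrite -[y]opprK; apply: Z_sub => //; rewrite -sub0r;
  apply: Z_sub => //; apply: Z_0. Qed.
Lemma Bd_div n x k : (0 < k)%N -> B n (x *+ k) -> B n x.
Proof.
move=> /divS[s [hs es]] [y hy ey]; exists (s *: y).
  by have := cdegZ hs hy; rewrite addr0.
by rewrite linearZ /= -ey -scaler_nat scalerA es scale1r.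
Qed.
Lemma Bd_divz n x (k : int) : k != 0 -> B n (x *~ k) -> B n x.
Proof.
case: k => k hk; first by apply: Bd_div; rewrite lt0n.
by rewrite NegzE mulrNz -pmulrn => /Bd_N; apply: Bd_div.
Qed.

(** An invariant cocycle comes from [C0]. *)
Lemma inv_Bd n x : acyc C0 p n -> Z n x -> (forall g, g \in G -> gam g x = x) -> B n x.
Proof.
move=> h [hx dx] gx; apply: (@Bd_div _ _ #|G|) => //.
have -> : x *+ #|G| = iota (rho x) *+ #|G|.
  by rewrite gam_rho -sumr_const; apply: eq_bigr => g /gx.
have [rd rc rdg] := rho_graded_op; have [id ic idg] := iota_graded_op.
have [||v hv ev] := h (rho x).
- by have := rdg _ _ _ hx; rewrite addr0.
- by rewrite -rc dx (diffop0 rd).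
exists (iota v *+ #|G|); last by rewrite linearMn ev ic.
rewrite -scaler_nat -[n]addr0; apply: cdegZ; last first.
  by have := idg _ _ _ hv; rewrite addr0.
elim: #|G| => [|k IH]; first exact: (dsum0 (@rdeg_sum S)).
by rewrite mulrS; apply: (dsumD (@rdeg_sum S)) => //; apply: rdeg1.
Qed.

Lemma Y_diffop g j : g \in G -> diffop (Y g j).
Proof. by move=> /(Y_graded_op j)[]. Qed.

(** Products of operators, indexed by sequences of pairs [(g, j)]: in [prodA h]
    the factors are [Y (h g) j], in [prodD h] they are [Y (h g) j - Y 1 j]. *)
Definition prodA h (T : seq (gT * J)) (x : C) := foldr (fun u y =>
  Y (h * u.1)%g u.2 y) x T.
Definition prodD h (U : seq (gT * J)) (x : C) :=
  foldr (fun u y => Y (h * u.1)%g u.2 y - Y 1%g u.2 y) x U.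
(** The monomial [l] in the operators [Y 1 j]. *)
Definition word (l : seq J) (x : C) := foldr (fun j y => Y 1%g j y) x l.
Definition inG (T : seq (gT * J)) := all (fun u => u.1 \in G) T.
(** Without [U] this is a sum over an orbit, hence an invariant operator. *)
Definition orbit_sum T U x := \sum_(h in G) prodA h T (prodD h U x).

Lemma prodAB h T x y : h \in G -> inG T -> prodA h T (x - y) = prodA h T x - prodA h T y.
Proof.
by move=> hG; elim: T => //= u T IH /andP[uG TG];
  rewrite IH // (diffopB (Y_diffop _ (groupM hG uG))).
Qed.

Lemma prodA_Y h T g j x : h \in G -> g \in G -> inG T ->
  prodA h T (Y g j x) = Y g j (prodA h T x).
Proof.
by move=> hG gG; elim: T => //= u T IH /andP[uG TG]; rewrite IH // YC // groupM.
Qed.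

(** Expansion of the first difference in [U]. *)
Lemma orbit_sumS T u U x : inG T -> u.1 \in G ->
  orbit_sum T (u :: U) x = orbit_sum (rcons T u) U x - Y 1%g u.2 (orbit_sum T U x).
Proof.
move=> TG uG; rewrite /orbit_sum /= (eq_bigr (fun h => prodA h (rcons T u) (prodD h U x) -
   Y 1%g u.2 (prodA h T (prodD h U x)))) => [|h hG].
  rewrite sumrB; congr (_ - _); have hd := Y_diffop u.2 (group1 G).
  by elim/big_rec2: _ => [|h a b _ ->]; rewrite ?(diffop0 hd) ?(diffopD hd).
by rewrite prodAB // (prodA_Y _ _ hG (group1 G) TG) /prodA foldr_rcons.
Qed.

Lemma prodA_Z n h T x : h \in G -> inG T -> Z n x ->
  Z (n + eps *+ size T) (prodA h T x).
Proof.
move=> hG + hx; elim: T => [|u T IH] /=; first by rewrite addr0.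
move=> /andP[uG TG]; rewrite mulrSr addrA; apply: Z_op (IH TG).
by apply/Y_graded_op/groupM.
Qed.

(** Terms with at least one factor in the orbit product are coboundaries. *)
Lemma orbit_sum_Bd n T U x : (forall k, (0 < k <= #|G|)%N -> acyc C0 p (n + eps *+ k)) ->
  Z n x -> (forall g, g \in G -> gam g x = x) ->
  inG T -> inG U -> (0 < size T)%N -> (size T + size U <= #|G|)%N ->
  B (n + eps *+ (size T + size U)) (orbit_sum T U x).
Proof.
move=> hac hx gx; elim: U T => [|u U IH] T TG /=.
  rewrite addn0 => _ T0 TN; apply: inv_Bd; first by apply: hac; rewrite T0.
    rewrite /orbit_sum; elim/big_ind: _ => [||h hG];
      [exact: Z_0|exact: Z_add|exact: prodA_Z].
  move=> k kG; rewrite /orbit_sum.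
  have -> : gam k (\sum_(h in G) prodA h T (prodD h [::] x)) = \sum_(h in G) gam k
    (prodA h T x).
    have hd := gam_diffop kG.
    by elim/big_rec2: _ => [|h a b _ <-]; rewrite ?(diffop0 hd) ?(diffopD hd).
  rewrite [RHS](reindex_inj (mulgI k)) /=; apply: eq_big => [h|h hG];
    first by rewrite groupMl.
  rewrite /prodD /=; elim: T TG {T0 TN} => [_|u T IH] /=; first exact: gx.
  by move=> /andP[uG TG]; rewrite gamY ?groupM // IH // mulgA.
move=> /andP[uG UG] T0 TN; rewrite orbit_sumS //; apply: Bd_sub.
  have := IH (rcons T u); rewrite size_rcons addSnnS; apply => //.
  by rewrite /inG all_rcons uG.
rewrite addnS mulrSr addrA; apply: Bd_op; first exact/Y_graded_op/group1.
by apply: IH => //; apply: leq_trans TN; rewrite addnS.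
Qed.

(** Up to coboundaries and sign, the full expansion leaves [#|G|] times the monomial
    of [U]. *)
Lemma orbit_sum0_Bd n U x : (forall k, (0 < k <= #|G|)%N -> acyc C0 p (n + eps *+ k)) ->
  Z n x -> (forall g, g \in G -> gam g x = x) -> inG U -> (size U <= #|G|)%N ->
  let w := word (map snd U) x *+ #|G| in
  B (n + eps *+ size U) (orbit_sum [::] U x - w) \/ B (n + eps *+ size U) (orbit_sum
    [::] U x + w).
Proof.
move=> hac hx gx; elim: U => [|u U IH] /=.
  by left; rewrite addr0 /orbit_sum /= sumr_const subrr; apply: Bd_0.
move=> /andP[uG UG] UN; have hd := Y_diffop u.2 (group1 G).
have hc := Y_graded_op u.2 (group1 G).
have hQ : B (n + eps *+ (size U).+1) (orbit_sum [:: u] U x).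
  have := @orbit_sum_Bd n [:: u] U x hac hx gx; rewrite /= andbT add1n. by move=>
    /(_ uG UG isT UN).
have wE : Y 1%g u.2 (word (map snd U) x *+ #|G|) = Y 1%g u.2 (word (map snd U) x) *+ #|G|.
  by elim: #|G| => [|k IHk]; rewrite ?mulr0n ?(diffop0 hd) // !mulrS (diffopD hd) IHk.
rewrite orbit_sumS //; have [/(Bd_op hc)|/(Bd_op hc)] := IH UG (ltnW UN).
- rewrite -addrA -mulrSr (diffopB hd) wE => h; right.
  by have := Bd_sub hQ h; congr (B _ _); rewrite opprB addrA addrAC.
- rewrite -addrA -mulrSr (diffopD hd) wE => h; left.
  by have := Bd_sub hQ h; congr (B _ _); rewrite opprD addrA.
Qed.

(** If every element of [G] occurs in [U], then for each [h] the factor at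
    [g = h^-1] is zero. *)
Lemma orbit_sum_full U x : inG U -> (forall h, h \in G -> exists2 u, u \in U & u.1 = h) ->
  orbit_sum [::] U x = 0.
Proof.
move=> UG full; apply: big1 => h hG /=.
have [u uU eu] := full _ (groupVr hG).
elim: U UG {full} uU => //= v U IH /andP[vG UG].
rewrite inE => /predU1P[<-|/(IH UG) ->]; first by rewrite eu mulgV subrr.
by rewrite (diffop0 (Y_diffop _ (groupM hG vG))) (diffop0 (Y_diffop _ (group1 G))) subrr.
Qed.

(** All monomials of degree [#|G|] send an invariant cocycle to a coboundary. *)
Lemma word_Bd n l x : (forall k, (0 < k <= #|G|)%N -> acyc C0 p (n + eps *+ k)) ->
  Z n x -> (forall g, g \in G -> gam g x = x) -> size l = #|G| ->
  B (n + eps *+ #|G|) (word l x).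
Proof.
move=> hac hx gx sl; pose U := zip (enum G) l.
have sz : size (enum G) = size l by rewrite -cardE sl.
have UG : inG U.
  apply/allP => -[g j] /= /(map_f fst); rewrite -/(unzip1 U) unzip1_zip ?sz //.
  by rewrite mem_enum.
have sU : size U = #|G| by rewrite size_zip sz minnn.
have := orbit_sum0_Bd hac hx gx UG; rewrite sU leqnn => /(_ isT) /=.
rewrite orbit_sum_full // => [|h]; last first.
  rewrite -mem_enum -[enum G](@unzip1_zip _ _ _ l) ?sz // => /mapP[u uU ->].
  by exists u.
rewrite -/(unzip2 U) unzip2_zip ?sz //.
have G0 : (0 < #|G|)%N := cardG_gt0 G.
case; rewrite ?add0r => h; apply: (Bd_div G0) => //.
exact: Bd_N.
Qed.

(** Vanishing of the cohomology of [C0] in the next [#|G|] degrees in the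
    direction of [eps] implies its vanishing in degree [n], provided the Euler
    factors do not vanish. *)
Lemma descent n : (forall k, (0 < k <= #|G|)%N -> acyc C0 p (n + eps *+ k)) ->
  (forall k, (k < #|G|)%N -> n + eps *+ k + c != 0) -> acyc C0 p n.
Proof.
move=> hac hne z hz dz; set x := iota z.
have [rd rc rdg] := rho_graded_op; have [id ic idg] := iota_graded_op.
have hx : Z n x.
  split; first by have := idg _ _ _ hz; rewrite addr0.
  by rewrite -ic dz (diffop0 id).
have gx g : g \in G -> gam g x = x by move=> gG; apply: gam_iota.
have wZ l : Z (n + eps *+ size l) (word l x).
  elim: l => [|j l IH] /=; first by rewrite addr0.
  by rewrite mulrSr addrA; apply: Z_op IH; apply/Y_graded_op/group1.
have wB k l : (size l + k = #|G|)%N -> B (n + eps *+ size l) (word l x).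
  (* descending induction on the length of the monomial *)
  elim: k l => [|k IH] l hl.
    by rewrite addn0 in hl; rewrite hl; apply: word_Bd.
  apply: (@Bd_divz _ _ (n + eps *+ size l + c)); first by apply: hne;
    rewrite -hl addnS ltnS leq_addr.
  rewrite -euler; last by case: (wZ l).
  apply: Bd_sum => j _.
  have := Bd_op (Y'_graded_op j) (IH (j :: l) _).
  by rewrite /= mulrSr addrA addrK; apply; rewrite addSnnS.
have [y hy ey] := wB #|G| [::] (add0n _); rewrite addr0 in hy.
exists (rho y); first by have := rdg _ _ _ hy; rewrite addr0.
by rewrite -(rhoK hz) -/x -[x]/(word [::] x) ey rc.
Qed.
End Benson.

(** * Derivations and the group action on the polynomial ring *)

Section MPoly.
Variables (A : comUnitRingType) (m : nat).
Implicit Types (p q : {mpoly A[m]}) (D : {mpoly A[m]} -> {mpoly A[m]}).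

(** Derivations over [A]. *)
Definition is_deriv D := [/\ forall p q, D (p + q) = D p + D q,
  forall a p, D (a *: p) = a *: D p & forall p q, D (p * q) = D p * q + p * D q].

Lemma deriv1 D : is_deriv D -> D 1 = 0.
Proof.
move=> [_ _ DM]; apply: (@addrI _ (D 1)).
by rewrite addr0 -[in RHS](mulr1 1) DM mulr1 mul1r.
Qed.

(** A derivation is determined by its values on the variables. *)
Lemma deriv_ext0 D : is_deriv D -> (forall i, D 'X_i = 0) -> forall p, D p = 0.
Proof.
move=> hD hX; have D1 := deriv1 hD; case: hD => DD DZ DM.
have DP (T : Type) (r : seq T) F : (forall i, D (F i) = 0) -> D (\prod_(i <- r) F i) = 0.
  move=> h; elim: r => [|i r IH]; first by rewrite big_nil.
  by rewrite big_cons DM h IH mul0r mulr0 addr0.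
elim/mpolyind => [|c u p _ _ IH]; first by have := DZ 0 0; rewrite !scale0r.
rewrite DD DZ IH addr0 mpolyXE_id DP ?scaler0 // => i.
elim: (u i) => [|k IHk]; first by rewrite expr0.
by rewrite exprS DM hX IHk mul0r mulr0 addr0.
Qed.

Lemma deriv_commutator D1 D2 : is_deriv D1 -> is_deriv D2 ->
  is_deriv (fun p => D1 (D2 p) - D2 (D1 p)).
Proof.
move=> [DD1 DZ1 DM1] [DD2 DZ2 DM2].
split=> [p q|a p|p q]; first by rewrite DD2 DD1 DD1 DD2 opprD addrACA.
  by rewrite DZ2 DZ1 DZ1 DZ2 scalerBr.
rewrite DM2 DD1 !DM1 DD2 !DM2.
move: (D1 (D2 p)) (D1 (D2 q)) (D2 (D1 p)) (D2 (D1 q)) (D1 p) (D1 q) (D2 p) (D2 q).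
by move=> *; ring.
Qed.

Lemma mderiv_is_deriv i : is_deriv (mderiv i : {mpoly A[m]} -> {mpoly A[m]}).
Proof. by split=> *; rewrite ?mderivD ?mderivZ ?mderivM. Qed.

Lemma mderivXU i j : mderiv i ('X_j : {mpoly A[m]}) = (i == j)%:R.
Proof.
rewrite mderivX mnm1E eq_sym; case: eqP => [->|_]; last by rewrite scale0r.
rewrite scale1r; have -> : (U_(j) - U_(j) = 0)%MM by apply/mnmP => k;
  rewrite mnmBE subnn mnm0E.
by rewrite mpolyX0.
Qed.

Lemma mderiv_homog i p d : p \is d.-homog -> mderiv i p \is d.-1.-homog.
Proof.
move=> /dhomogP h; apply/dhomogP => u; rewrite mcoeff_msupp mcoeff_mderiv => hu.
have hs : (u + U_(i))%MM \in msupp p.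
  by rewrite mcoeff_msupp; apply: contra hu => /eqP ->; rewrite mul0rn.
have e : mdeg (u + U_(i))%MM = d := h _ hs.
by move: e; rewrite mdegD mdeg1 addn1 => <-.
Qed.

(** The Euler operator. *)
Definition eulerop p := \sum_(i < m) 'X_i * mderiv i p.

Lemma eulerop_deriv : is_deriv eulerop.
Proof.
split=> [p q|a p|p q]; rewrite /eulerop.
- by rewrite -big_split; apply: eq_bigr => i _; rewrite mderivD mulrDr.
- by rewrite scaler_sumr; apply: eq_bigr => i _; rewrite mderivZ -scalerAr.
rewrite mulr_suml mulr_sumr -big_split; apply: eq_bigr => i _ /=.
by rewrite mderivM; ring.
Qed.

Lemma euleropX u : eulerop 'X_[u] = 'X_[u] *+ mdeg u.
Proof.
rewrite /eulerop mdegE -sumrMnr; apply: eq_bigr => i _.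
rewrite mderivX -scalerAr scaler_nat; case: (posnP (u i)) => [->//|hi].
rewrite -mpolyXD addmC submK //; apply/mnm_lepP => j; rewrite mnm1E.
by case: eqP => [<-|].
Qed.

Lemma eulerop_homog p d : p \is d.-homog -> eulerop p = p *+ d.
Proof.
move=> /dhomogP h; rewrite {1 2}(mpolyE p); have [DD DZ _] := eulerop_deriv.
have D0 : eulerop 0 = 0 by have := DZ 0 0; rewrite !scale0r.
rewrite -sumrMnl big_seq [RHS]big_seq; elim/big_rec2: _ => [//|u x y hu <-].
by rewrite DD DZ euleropX (h _ hu) scalerMnr.
Qed.

Lemma euler_comm p : \sum_(i < m) mderiv i ('X_i * p) = eulerop p + p *+ m.
Proof.
have -> : p *+ m = \sum_(i < m) p by rewrite sumr_const card_ord.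
rewrite /eulerop -big_split; apply: eq_bigr => i _.
by rewrite /= mderivM mderivXU eqxx mul1r addrC.
Qed.
Lemma scale_natK n p : (n%:R : A) \is a GRing.unit -> n%:R^-1 *: (p *+ n) = p.
Proof. by move=> h; rewrite -scaler_nat scalerA mulVr ?scale1r. Qed.
Lemma scale_natVK n p : (n%:R : A) \is a GRing.unit -> (n%:R^-1 *: p) *+ n = p.
Proof. by move=> h; rewrite -scaler_nat scalerA mulrV ?scale1r. Qed.
End MPoly.

Section Act.
Variables (A : comUnitRingType) (m : nat) (gT : finGroupType) (G : {group gT}).
Variable Phi : mx_representation A G m.
Notation act := (linear_act Phi).
Implicit Types (p q : {mpoly A[m]}) (g h : gT).

Lemma actD g p q : act g (p + q) = act g p + act g q. Proof. exact: comp_mpolyD. Qed.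
Lemma actZ g a p : act g (a *: p) = a *: act g p. Proof. exact: comp_mpolyZ. Qed.
Lemma actM g p q : act g (p * q) = act g p * act g q. Proof. exact: rmorphM. Qed.
Lemma act1 g : act g 1 = 1. Proof. exact: comp_mpoly1. Qed.
Lemma actC g c : act g c%:MP = c%:MP. Proof. exact: comp_mpolyC. Qed.
Lemma act_sum g (T : Type) (r : seq T) (P : pred T) F :
  act g (\sum_(i <- r | P i) F i) = \sum_(i <- r | P i) act g (F i).
Proof. exact: raddf_sum. Qed.
Lemma act_prod g (T : Type) (r : seq T) (P : pred T) F :
  act g (\prod_(i <- r | P i) F i) = \prod_(i <- r | P i) act g (F i).
Proof. exact: rmorph_prod. Qed.
Lemma actXn g n p : act g (p ^+ n) = act g p ^+ n.
Proof. exact: rmorphXn. Qed.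
Lemma actX g j : act g 'X_j = \sum_(i < m) Phi g i j *: 'X_i.
Proof. by rewrite /linear_act comp_mpolyXU -tnth_nth tnth_mktuple. Qed.

Lemma act0 g : act g 0 = 0. Proof. exact: comp_mpoly0. Qed.
Lemma act_id p : act 1%g p = p.
Proof.
rewrite /linear_act -[RHS]comp_mpoly_id; congr (_ \mPo _); apply: eq_from_tnth => j.
rewrite !tnth_mktuple repr_mx1 (bigD1 j) //= mxE eqxx scale1r big1 ?addr0 // =>
  i /negPf h.
by rewrite mxE h scale0r.
Qed.

Local Opaque linear_act comp_mpoly.

Lemma actA g h p : g \in G -> h \in G -> act g (act h p) = act (g * h)%g p.
Proof.
move=> gG hG; elim/mpolyind: p => [|c u p _ _ IH].
  by rewrite !act0.
rewrite !actD !actZ IH; suff -> : act g (act h 'X_[u]) = act (g * h)%g 'X_[u] by [].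
rewrite mpolyXE_id.
rewrite !act_prod; apply: eq_bigr => i _; rewrite !actXn.
suff -> : act g (act h 'X_i) = act (g * h)%g 'X_i by [].
rewrite !actX act_sum.
under eq_bigr => k _ do rewrite actZ actX scaler_sumr.
rewrite exchange_big; apply: eq_bigr => k _ /=.
rewrite repr_mxM // mxE scaler_suml; apply: eq_bigr => l _.
by rewrite scalerA mulrC.
Qed.

Lemma actK g p : g \in G -> act g (act g^-1%g p) = p.
Proof. by move=> gG; rewrite actA ?groupV // mulgV act_id. Qed.
Lemma act_homog g p d : p \is d.-homog -> act g p \is d.-homog.
Proof.
move=> h; have -> : act g p = pihomog mdeg d (act g p).
  by rewrite pihomog_linear_act pihomog_dE.
exact: pihomogP.
Qed.

Lemma invariantP p : reflect (forall g, g \in G ->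
  act g p = p) (p \in Defs.invariant Phi).
Proof.
apply: (iffP forall_inP) => h g gG; first exact/eqP/h.
by apply/eqP/h.
Qed.

(** The conjugate of an operator by the action of [g]. *)
Definition conj g (D : {mpoly A[m]} -> {mpoly A[m]}) p := act g (D (act g^-1%g p)).

Lemma conj_act g h D p : g \in G -> h \in G ->
  act h (conj g D p) = conj (h * g) D (act h p).
Proof.
move=> gG hG; rewrite /conj (actA _ hG gG).
suff -> : act (h * g)^-1%g (act h p) = act g^-1%g p by [].
by rewrite invMg (actA _ (groupM (groupVr gG) (groupVr hG)) hG) -mulgA mulVg mulg1.
Qed.

Lemma conj_deriv g D : g \in G -> is_deriv D -> is_deriv (conj g D).
Proof.
move=> gG [DD DZ DM]; split=> [p q|a p|p q]; rewrite /conj.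
- by rewrite actD DD actD.
- by rewrite actZ DZ actZ.
by rewrite actM DM actD !actM !actK.
Qed.

(** The action is linear, so conjugate partial derivatives have constant values on
    the variables. *)
Lemma conj_mderivX g i j : g \in G -> exists c : A, conj g (mderiv i) 'X_j = c%:MP.
Proof.
move=> gG; exists (\sum_(k < m) Phi g^-1%g k j * (i == k)%:R).
rewrite /conj actX linear_sum /= act_sum rmorph_sum; apply: eq_bigr => k _.
rewrite linearZ /= mderivXU actZ -mul_mpolyC mpolyCM; congr (_ * _).
by case: eqP => _; [rewrite act1 mpolyC1|rewrite mpolyC0 act0].
Qed.

Lemma deriv_const D (c : A) : is_deriv D -> D c%:MP_[m] = 0.
Proof.
by move=> hD; rewrite -[c%:MP_[m]]mulr1 mul_mpolyC; case: (hD) => _ -> _;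
  rewrite deriv1 ?scaler0.
Qed.

(** The commutator of two such derivations is a derivation that kills the
    variables. *)
Lemma conj_mderivC g h i j p : g \in G -> h \in G ->
  conj g (mderiv i) (conj h (mderiv j) p) = conj h (mderiv j) (conj g (mderiv i) p).
Proof.
move=> gG hG; set D1 := conj g _; set D2 := conj h _.
have h1 : is_deriv D1 by apply: conj_deriv => //; apply: mderiv_is_deriv.
have h2 : is_deriv D2 by apply: conj_deriv => //; apply: mderiv_is_deriv.
apply/eqP; rewrite -subr_eq0; apply/eqP.
apply: (@deriv_ext0 _ _ (fun p => D1 (D2 p) - D2 (D1 p))) => {p} [|k].
  exact: deriv_commutator.
have [c ec] := conj_mderivX i k gG; have [d ed] := conj_mderivX j k hG.
have -> : D2 'X_k = d%:MP by exact: ed.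
have -> : D1 'X_k = c%:MP by exact: ec.
by rewrite (deriv_const _ h1) (deriv_const _ h2) subrr.
Qed.

Lemma conj_mulXC g h i j p : g \in G -> h \in G ->
  conj g ( *%R 'X_i) (conj h ( *%R 'X_j) p) = conj h ( *%R 'X_j) (conj g ( *%R 'X_i) p).
Proof.
move=> gG hG; have cE k l q : k \in G -> conj k ( *%R 'X_l) q = act k 'X_l * q.
  by move=> kG; rewrite /conj actM (actK _ kG).
rewrite (cE g _ _ gG) (cE h _ _ hG) (cE h _ _ hG) (cE g _ _ gG); exact: mulrCA.
Qed.

End Act.

(** * The polynomial ring as a module over the invariants *)

Lemma base_graded_op (S : gradedRing) (V W : lmodType S) (D : int -> V -> Prop) (D' :
  int -> W -> Prop)
  D0 DB DZ D0' DB' DZ' e (phi : V -> W) : diffop phi ->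
  (forall n x, D n x -> D' (n + e) (phi x)) ->
  graded_op e (phi : @base S V D D0 DB DZ -> @base S W D' D0' DB' DZ').
Proof.
move=> hd hdg; split=> //; first by move=> x; apply: (diffop0 hd).
move=> p n x; rewrite /= /bdeg; case: ifP => _; first exact: hdg.
by move=> ->; apply: (diffop0 hd).
Qed.

Section PolynomialModule.
Variables (A : comUnitRingType) (m : nat) (gT : finGroupType) (G : {group gT}).
Variable Phi : mx_representation A G m.
Hypothesis unitA : forall n, (0 < n)%N -> (n%:R : A) \is a GRing.unit.
Notation S := (invariant_ring Phi).
Notation act := (linear_act Phi).

(** The polynomial ring, with scalars restricted to the invariants.  The type
    depends on [Phi] so that the module structure can be found from it. *)
Definition polyMod : Type := (fun _ : mx_representation A G m => {mpoly A[m]}) Phi.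
HB.instance Definition _ := GRing.Zmodule.copy polyMod {mpoly A[m]}.
Definition rm_scale (s : S) (p : polyMod) : polyMod := (inv_val s : {mpoly A[m]}) * p.
Fact rm_scaleA s t p : rm_scale s (rm_scale t p) = rm_scale (s * t) p.
Proof. exact: mulrA. Qed.
Fact rm_scale1 : left_id 1 rm_scale. Proof. exact: mul1r. Qed.
Fact rm_scaleDr : right_distributive rm_scale +%R.
Proof. by move=> s p q; apply: mulrDr. Qed.
Fact rm_scaleDl p : {morph rm_scale^~ p : s t / s + t}.
Proof. by move=> s t; apply: mulrDl. Qed.
HB.instance Definition _ := GRing.Zmodule_isLmodule.Build S polyMod
  rm_scaleA rm_scale1 rm_scaleDr rm_scaleDl.

Lemma rm_scaleE (s : S) (p : polyMod) : s *: p = (inv_val s :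
  {mpoly A[m]}) * p :> {mpoly A[m]}.
Proof. by []. Qed.

Lemma inv_act (s : S) g : g \in G -> act g (inv_val s) = inv_val s.
Proof. by move=> gG; case: s => p /= /invariantP; apply. Qed.

(** The grading of the polynomial ring by [int], and of its invariant elements. *)
Definition DR (n : int) (p : polyMod) : Prop :=
  match n with Posz d => (p : {mpoly A[m]}) \is d.-homog | Negz _ => p = 0 end.
Definition DS n (p : polyMod) := DR n p /\ (p : {mpoly A[m]}) \in Defs.invariant Phi.

Lemma DR0 n : DR n 0. Proof. by case: n => n //=; apply: dhomog0. Qed.
Lemma DRB n p q : DR n p -> DR n q -> DR n (p - q).
Proof. by case: n => n /=; [apply: rpredB|move=> -> ->; rewrite subrr]. Qed.
Lemma DRD n p q : DR n p -> DR n q -> DR n (p + q).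
Proof. by case: n => n /=; [apply: rpredD|move=> -> ->; rewrite addr0]. Qed.
Lemma DRZ n k (s : S) p : rdeg k s -> DR n p -> DR (n + k) (s *: p).
Proof.
move=> hs; case: n => n hp; last by rewrite hp scaler0; apply: DR0.
case: k hs => k hs; last by rewrite hs scale0r; apply: DR0.
by rewrite rm_scaleE addrC; apply: dhomogM.
Qed.
Lemma DS0 n : DS n 0. Proof. by split; [apply: DR0|apply: rpred0]. Qed.
Lemma DSB n p q : DS n p -> DS n q -> DS n (p - q).
Proof. by move=> [a b] [c d]; split; [apply: DRB|apply: rpredB]. Qed.
Lemma DSZ n k (s : S) p : rdeg k s -> DS n p -> DS (n + k) (s *: p).
Proof. by move=> hs [a b]; split; [apply: DRZ|rewrite rm_scaleE; apply: rpredM => //;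
  case: s {hs}]. Qed.

(** The polynomial ring and the invariants as complexes in cohomological degree 0,
    both on the same module. *)
Definition CR : cplx S := base DR0 DRB DRZ.
Definition CS : cplx S := base DS0 DSB DSZ.

(** The Reynolds operator. *)
Definition rho0 (p : polyMod) : polyMod := (#|G|%:R^-1 : A) *: (\sum_(g in G) act g p :
  {mpoly A[m]}).

Lemma rho0_inv p : (rho0 p : {mpoly A[m]}) \in Defs.invariant Phi.
Proof.
apply/invariantP => h hG; rewrite /rho0 actZ act_sum; congr (_ *: _).
rewrite [RHS](reindex_inj (mulgI h)); apply: eq_big => [g|g gG]; first by rewrite groupMl.
by rewrite actA.
Qed.

Lemma rho0_id p : (p : {mpoly A[m]}) \in Defs.invariant Phi -> rho0 p = p.
Proof.
move=> /invariantP hp; rewrite /rho0.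
have -> : \sum_(g in G) act g p = p *+ #|G|.
  by rewrite -sumr_const; apply: eq_bigr => g /hp.
exact: (scale_natK (p : {mpoly A[m]}) (unitA (cardG_gt0 G))).
Qed.

Lemma rho0_sum p : rho0 p *+ #|G| = \sum_(g in G) act g p.
Proof.
exact: (@scale_natVK _ _ #|G| _ (unitA (cardG_gt0 G))).
Qed.

Lemma rho0_order_lt : order_lt 1 rho0.
Proof.
split=> [p q|s p].
  rewrite /rho0; have -> : \sum_(g in G) act g (p + q) =
      \sum_(g in G) act g p + \sum_(g in G) act g q :> {mpoly A[m]}.
    by rewrite -big_split; apply: eq_bigr => g _; apply: actD.
  by rewrite [LHS](@scalerDr _ {mpoly A[m]}).
apply/eqP; rewrite subr_eq0; apply/eqP.
rewrite /rho0; have -> : \sum_(g in G) act g (s *: p) =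
    inv_val s * \sum_(g in G) act g p :> {mpoly A[m]}.
  rewrite mulr_sumr; apply: eq_bigr => g gG.
  by rewrite rm_scaleE actM (inv_act _ gG).
by rewrite [RHS]rm_scaleE [LHS](@scalerAr _ {mpoly A[m]}).
Qed.

Lemma act_order_lt g : g \in G -> order_lt 1 (act g : polyMod -> polyMod).
Proof.
move=> gG; split=> [p q|s p]; first exact: actD.
by apply/eqP; rewrite subr_eq0 !rm_scaleE actM inv_act.
Qed.

Lemma mulX_order_lt j : order_lt 1 ( *%R 'X_j : polyMod -> polyMod).
Proof.
split=> [p q|s p]; first exact: mulrDr.
by apply/eqP; rewrite subr_eq0 !rm_scaleE mulrCA.
Qed.

Lemma deriv_order_lt (D : polyMod -> polyMod) : is_deriv D -> order_lt 2 D.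
Proof.
move=> [DD DZ DM]; split=> [p q|s]; first exact: DD.
split=> [p q|t p].
  by rewrite !rm_scaleE !DM ![in RHS]addrK mulrDr DD mulrDr opprD addrACA [in
    RHS]addrC; ring.
by rewrite !rm_scaleE !DM !addrK; ring.
Qed.

Lemma DR_act n g p : DR n p -> DR n (act g p).
Proof.
by case: n => n /= h; [apply: act_homog|rewrite h /linear_act comp_mpoly0].
Qed.
Lemma DR_sum n (T : Type) (r : seq T) (P : pred T) (F : T -> polyMod) :
  (forall i, P i -> DR n (F i)) -> DR n (\sum_(i <- r | P i) F i).
Proof.
by move=> h; elim/big_ind: _ => //; [apply: DR0|apply: DRD].
Qed.
Lemma DR_rho n p : DR n p -> DR n (rho0 p).
Proof.
move=> h; have := @DR_sum n _ (index_enum gT) (mem G) (fun g => act g p) (fun g _ =>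
  DR_act g h).
by case: n {h} => n /= h; rewrite /rho0; [apply: dhomogZ|rewrite h scaler0].
Qed.
Lemma DR_mulX n j p : DR n p -> DR (n + 1) ('X_j * p).
Proof.
case: n => n /= h; last by rewrite h mulr0; exact: (DR0 (Negz n + 1)).
by rewrite addn1 -add1n; apply: dhomogM => //; rewrite dhomogX; apply/eqP/mdeg1.
Qed.
Lemma DR_mderiv n j p : DR n p -> DR (n - 1) (mderiv j p).
Proof.
case: n => [[|n]|n] /= h; last by rewrite h mderiv0; exact: (DR0 (Negz n - 1)).
  move: h => /dhomogP h; apply/mpolyP => u; rewrite mcoeff0 mcoeff_mderiv.
  case: (boolP ((u + U_(j))%MM \in msupp p)) => [/h /= e|/memN_msupp_eq0 ->];
    last by rewrite mul0rn.
  by have := mdegD u U_(j)%MM; rewrite mdeg1 [mdeg (_ + _)]e addn1.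
by rewrite subn1 /=; have := mderiv_homog j h.
Qed.

Lemma euler_scale k (s : S) p : rdeg k s ->
  eulerop (s *: p : polyMod) = s *: (eulerop p : polyMod) + (s *: p) *~ k :> polyMod.
Proof.
move=> hs; rewrite !rm_scaleE; have [_ _ ->] := eulerop_deriv A m.
have -> : eulerop (inv_val s) = inv_val s *~ k.
  case: k hs => k /= hs; first by rewrite (eulerop_homog hs).
  by rewrite hs /= mul0rz; have [_ h _] := eulerop_deriv A m; have := h 0 0;
    rewrite !scale0r.
by rewrite addrC mulrzAl.
Qed.

Lemma euler_DR n p : DR n p -> eulerop p = p *~ n :> polyMod.
Proof.
case: n => n /= h; first by rewrite (eulerop_homog h).
by rewrite h mul0rz; have [_ h' _] := eulerop_deriv A m; have := h' 0 0; rewrite !scale0r.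
Qed.
End PolynomialModule.

(** * Vanishing from a window of degrees *)

Section Window.
Variables (A : comUnitRingType) (m : nat) (gT : finGroupType) (G : {group gT}).
Variable Phi : mx_representation A G m.
Hypothesis unitA : forall n, (0 < n)%N -> (n%:R : A) \is a GRing.unit.
Notation S := (invariant_ring Phi).
Notation act := (linear_act Phi).
Notation R := (polyMod Phi).
Notation DR := (@DR A m gT G Phi).
Notation CR := (CR Phi).
Notation CS := (CS Phi).
Variable fs : seq (homElt S).
Local Opaque linear_act comp_mpoly.

Lemma conj_diffop g (D : R -> R) : g \in G -> diffop D -> diffop (conj Phi g D : R -> R).
Proof.
move=> gG hD.
have h1 : diffop (act g : R -> R) by apply/order_lt1_diffop/act_order_lt.
have h2 : diffop (act g^-1%g : R -> R) by apply/order_lt1_diffop/act_order_lt/groupVr.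
exact: diffop_comp h1 (diffop_comp hD h2).
Qed.

Lemma conj_DR g (D : R -> R) e : g \in G -> (forall n p, DR n p -> DR (n + e) (D p)) ->
  forall n p, DR n p -> DR (n + e) (conj Phi g D p : R).
Proof. by move=> gG h n p hp; apply: DR_act; apply: h; apply: DR_act. Qed.

(** The action on the Cech complex of the polynomial ring. *)
Definition cechR (phi : R -> R) : cech fs CR -> cech fs CR := cech_map (phi : CR -> CR).

Lemma cechR_comp phi psi u : diffop phi -> diffop psi ->
  cechR (phi \o psi) u = cechR phi (cechR psi u).
Proof. by move=> h h'; rewrite /cechR (cech_map_comp (C := CR) (D := CR) (E :=
  CR) h h'). Qed.

Lemma cechR_graded_op e phi : diffop phi -> (forall n p, DR n p -> DR (n + e) (phi p :
  R)) -> graded_op e (cechR phi).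
Proof. by move=> h hd; apply/graded_op_cech_map/base_graded_op. Qed.

(** The descent for the Cech complex of the invariants, where [y] is the family of
    the partial derivatives or of the multiplications by variables, and [y'] the
    other one. *)
Lemma descent_inv (y y' : 'I_m -> R -> R) (eps : int) (c : nat) (p n : int) :
  (forall j, diffop (y j)) -> (forall j, diffop (y' j)) ->
  (forall j n q, DR n q -> DR (n + eps) (y j q)) ->
  (forall j n q, DR n q -> DR (n - eps) (y' j q)) ->
  (forall g h i j q, g \in G -> h \in G ->
     conj Phi g (y i) (conj Phi h (y j) q) = conj Phi h (y j) (conj Phi g (y i) q)) ->
  (forall q : R, \sum_(j < m) y' j (y j q) = eulerop q + q *+ c :> R) ->
  (forall k, (0 < k <= #|G|)%N -> acyc (cech fs CS) p (n + eps *+ k)) ->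
  (forall k, (k < #|G|)%N -> n + eps *+ k + c%:Z != 0) ->
  acyc (cech fs CS) p n.
Proof.
move=> hy hy' dy dy' yC hE.
pose iota : cech fs CS -> cech fs CR := cech_map (rho0 (Phi := Phi) : CS -> CR).
pose rho : cech fs CR -> cech fs CS := cech_map (rho0 (Phi := Phi) : CR -> CS).
have r1 : order_lt 1 (rho0 (Phi := Phi)) := rho0_order_lt Phi.
have r2 : diffop (rho0 (Phi := Phi)) := order_lt1_diffop r1.
have actd g : g \in G -> diffop (act g : R -> R) by move=> gG;
  apply/order_lt1_diffop/act_order_lt.
have hrr q : rho0 (rho0 q : R) = rho0 q :> R by apply/rho0_id/rho0_inv.
apply: (@descent S (cech fs CR) (cech fs CS) iota rho gT G 'I_m
  (fun g => cechR (act g)) (fun g j => cechR (conj Phi g (y j))) (fun j =>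
    cechR (y' j)) eps c%:Z p).
- apply/graded_op_cech_map/base_graded_op => // k q [hq _]; rewrite addr0; exact: DR_rho.
- apply/graded_op_cech_map/base_graded_op => // k q hq; rewrite addr0.
  by split; [apply: DR_rho|apply: rho0_inv].
- move=> k z hz; rewrite /rho /iota.
  rewrite -[LHS]/((cech_map (rho0 (Phi := Phi) : CR -> CS) \o cech_map (rho0 (Phi :=
    Phi) : CS -> CR)) z).
  rewrite -(cech_map_comp (C := CS) (D := CR) (E := CS) r2 r2) -[RHS](cech_map_id z).
  apply: (cech_map_agree _ _ _ hz).
  + have /order_lt1P hl := r1; apply/order_lt1P => a x q /=; by rewrite hl hl.
  + by apply/order_lt1P.
  + move=> q l x; rewrite /= /bdeg; case: ifP => _; first by case=> _ hx;
    rewrite /= !rho0_id.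
    by move=> ->; rewrite /= (diffop0 r2) (diffop0 r2).
- move=> g z gG; rewrite /iota /cechR -[LHS]/((_ \o cech_map _) z).
  rewrite -(cech_map_comp (C := CS) (D := CR) (E := CR) (actd g gG) r2).
  congr (cech_map _ z); apply: funext => q /=.
  by have /invariantP := rho0_inv q; apply.
- by move=> g gG; apply/diffop_cech_map/actd.
- move=> u; rewrite /iota /rho.
  rewrite -[cech_map _ _]/((cech_map (rho0 (Phi := Phi) : CS ->
    CR) \o cech_map (rho0 (Phi := Phi) : CR -> CS)) u).
  rewrite -(cech_map_comp (C := CR) (D := CS) (E := CR) r2 r2).
  rewrite -(cech_map_sum (C := CR) (D := CR) (F := fun g => act g) _ (fun g gG =>
    actd g gG)).
  rewrite -scaler_nat -[LHS]add0r -[X in X + _](@cech_map_zero _ fs CR CR u).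
  rewrite -(cech_map_lincomb (C := CR) (D := CR) _ _ (diffop_zero CR CR));
    last exact: diffop_comp.
  congr (cech_map _ u); apply: funext => q /=.
  by rewrite add0r hrr scaler_nat rho0_sum.
- move=> g j gG; apply: cechR_graded_op; [exact: conj_diffop|apply: conj_DR => //;
  exact: dy].
- by move=> j; apply: cechR_graded_op => //; apply: dy'.
- move=> g h i j u gG hG.
  rewrite -!cechR_comp; try by apply: conj_diffop.
  by congr (cechR _ u); apply: funext => q /=; apply: yC.
- move=> g h j u gG hG.
  rewrite -!cechR_comp; try exact: actd; try by apply: conj_diffop => //; apply: groupM.
  by congr (cechR _ u); apply: funext => q /=; apply: conj_act.
- move=> k u hu.
  have y1 j : diffop (conj Phi 1%g (y j) : R -> R) by apply: conj_diffop => //;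
    apply: group1.
  under eq_bigr => j _ do rewrite -(cechR_comp _ (hy' j) (y1 j)).
  rewrite -(@cech_map_sum S fs _ _ _ CR CR (fun j => y' j \o conj Phi 1%g (y j)));
    last by move=> j _; apply: diffop_comp (y1 j).
  have hEu : diffop (@eulerop A m : R -> R) by exists 2%N;
    apply/deriv_order_lt/eulerop_deriv.
  have -> : (fun q : CR => \sum_(j < m) (y' j \o conj Phi 1%g (y j)) q) =
      fun q : CR => (eulerop (q : R) : CR) + (c%:R : S) *: (q : CR).
    apply: funext => q; rewrite scaler_nat -hE; apply: eq_bigr => j _ /=.
    by rewrite /conj invg1 !act_id.
  rewrite (cech_map_lincomb (C := CR) (D := CR) _ (diffop_id CR) hEu) cech_map_id.
  rewrite mulrzDr scaler_nat; congr (_ + _).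
  apply: (cech_map_euler (C := CR) hEu _ _ hu) => [l k' q|k' s q hs].
    rewrite /= /bdeg; case: ifP => _; first exact: euler_DR.
    by move=> ->; rewrite (diffop0 hEu) mul0rz.
  exact: euler_scale.
- move=> k k0; have hu := unitA k0.
  have hi : (k%:R^-1 : A)%:MP_[m] \in Defs.invariant Phi.
    by apply/invariantP => g _; apply: actC.
  exists (InvRing hi : S); split.
    by rewrite /= /inv_deg /= -[_%:MP]mulr1 mul_mpolyC; apply: dhomogZ; apply: dhomog1.
  rewrite mulr_natr; apply: val_inj.
  rewrite [LHS](raddfMn (val : inv_ring Phi -> {mpoly A[m]})) /=.
  rewrite -mpolyCMn; have -> : (k%:R : A)^-1 *+ k = 1 by rewrite -[LHS]mulr_natr mulVr.
  exact: mpolyC1.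
Qed.

(** The cohomology of the Cech complex of the invariants vanishes in every degree
    as soon as it does in the degrees between [-m - (#|G| - 1)] and
    [#|G| - 1]. *)
Lemma window_acyc (p : int) :
  (forall n : int, - m%:Z - (#|G|%:Z - 1) <= n <= #|G|%:Z - 1 -> acyc (cech fs CS) p n) ->
  forall n, acyc (cech fs CS) p n.
Proof.
move=> hw.
have G0 : (0 < #|G|)%N := cardG_gt0 G.
have dX j : diffop ( *%R 'X_j : R -> R) by apply/order_lt1_diffop/mulX_order_lt.
have dD j : diffop (mderiv j : R -> R) by exists 2%N;
  apply/deriv_order_lt/mderiv_is_deriv.
(* upwards, by the partial derivatives *)
have pos (k : nat) : acyc (cech fs CS) p k.
  have [N] := ubnP k; elim: N k => // N IH k; rewrite ltnS => hk.
  have [kG|Gk] := ltnP k #|G|; first by apply: hw; lia.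
  apply: (@descent_inv (fun j => mderiv j) (fun j => *%R 'X_j) (-1) 0).
  - exact: dD.
  - exact: dX.
  - by move=> j n q; apply: DR_mderiv.
  - by move=> j n q; rewrite opprK; apply: DR_mulX.
  - by move=> g h i j q; apply: conj_mderivC.
  - by move=> q; rewrite mulr0n addr0.
  - move=> l hl; rewrite mulNrn.
    have -> : k%:Z - 1 *+ l = (k - l)%N by rewrite -subzn ?natz //; lia.
    by apply: IH; lia.
  - by move=> l hl; rewrite mulNrn natz; lia.
(* downwards, by the variables *)
have neg (k : nat) : acyc (cech fs CS) p (- m%:Z - k%:Z).
  have [N] := ubnP k; elim: N k => // N IH k; rewrite ltnS => hk.
  have [kG|Gk] := ltnP k #|G|; first by apply: hw; lia.
  apply: (@descent_inv (fun j => *%R 'X_j) (fun j => mderiv j) 1 m).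
  - exact: dX.
  - exact: dD.
  - by move=> j n q; apply: DR_mulX.
  - by move=> j n q; apply: DR_mderiv.
  - by move=> g h i j q; apply: conj_mulXC.
  - by move=> q; apply: euler_comm.
  - move=> l hl.
    have -> : - m%:Z - k%:Z + 1 *+ l = - m%:Z - (k - l)%N%:Z by rewrite natz; lia.
    by apply: IH; lia.
  - by move=> l hl; rewrite natz; lia.
case=> n; first exact: pos.
have [h|h] := leqP n.+1 m; first by apply: hw; rewrite NegzE; lia.
by have := neg (n.+1 - m)%N; congr acyc; rewrite NegzE; lia.
Qed.
End Window.

(** * The theorem *)

Lemma invariant_ring_noetherian (A : comUnitRingType) (m : nat) (gT : finGroupType)
    (G : {group gT}) (Phi : mx_representation A G m) :
  (forall n, (0 < n)%N -> (n%:R : A) \is a GRing.unit) -> noetherian A ->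
  noetherian (invariant_ring Phi).
Proof.
move=> unitA hA.
pose f : {rmorphism invariant_ring Phi -> {mpoly A[m]}} :=
  (val : inv_ring Phi -> {mpoly A[m]}).
have r1 := rho0_order_lt Phi.
pose rho (p : {mpoly A[m]}) : invariant_ring Phi := InvRing (rho0_inv (p : polyMod Phi)).
apply: (@noetherian_retract (invariant_ring Phi) _ f rho _ _ _ (noetherian_mpoly hA)).
- by move=> x y; apply: val_inj; case: r1 => rD _; exact: (rD x y).
- by move=> s p; apply: val_inj; exact: (order_lt1Z r1 s (p : polyMod Phi)).
- by apply: val_inj; apply: (rho0_id unitA); exact: (valP (1 : inv_ring Phi)).
Qed.

Lemma window_bound (N m : nat) : (0 < N)%N -> (0 < m)%N ->
  (N%:Z - 1 <= ((N`!)%:Z - 1) ^+ m)%R.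
Proof.
move=> N0 m0.
have e1 : (N`!)%:Z - 1 = (N`!.-1)%:Z.
  by rewrite -{1}(prednK (fact_gt0 N)) intS addrAC subrr add0r.
have e2 : N%:Z - 1 = N.-1%:Z by rewrite -{1}(prednK N0) intS addrAC subrr add0r.
rewrite e1 e2 -natz -[(N`!.-1)%:Z]natz -natrX ler_nat.
have h : (N.-1 <= N`!.-1)%N.
  case: N N0 {e1 e2} => // N _ /=; rewrite -ltnS (prednK (fact_gt0 _)).
  by rewrite factS leq_pmulr // fact_gt0.
apply: leq_trans h _; case: (N`!.-1) => // k.
by rewrite -{1}(expn1 k.+1) leq_pexp2l.
Qed.

Theorem theorem1p5 (A : comUnitRingType)
    (A_noeth : noetherian A) (A_CM : cohen_macaulay A)
    (K : fieldType) (K_char0 : [pchar K] =i pred0) (incl : {rmorphism K -> A})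
    (m : nat) (m_gt0 : (0 < m)%N)
    (gT : finGroupType) (G : {group gT}) (Phi : mx_representation A G m)
    (I : invariant_ring Phi -> Prop) (I_homog : homogeneous_ideal I) (i : nat)
    (M : gradedMod (invariant_ring Phi))
    (M_coh : is_local_cohomology I i (regular_gmod (invariant_ring Phi)) M) :
  (forall j : int,
     - m%:Z - ((#|G|)`!%:Z - 1) ^+ m <= j <= ((#|G|)`!%:Z - 1) ^+ m ->
     forall x : M, mdegree j x -> x = 0) ->
  forall x : M, x = 0.
Proof.
move=> M0.
have unitA n : (0 < n)%N -> (n%:R : A) \is a GRing.unit.
  move=> n0; rewrite -(rmorph_nat incl); apply: rmorph_unit; rewrite unitfE.
  by rewrite ((pcharf0P _).1 K_char0) -lt0n.
have hS : noetherian (invariant_ring Phi) by exact: invariant_ring_noetherian.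
have [fs hfs] := homog_gens hS I_homog.
case: M_coh => E [pi [pi_lin pi_surj pi_ker pi_deg]].
have r1 := rho0_order_lt Phi.
(* the Reynolds operator identifies [CS] with the regular module *)
pose rhoS (p : polyMod Phi) : regular_gmod (invariant_ring Phi) := InvRing (rho0_inv p).
have hw : quasi_iso (aug_map E rhoS : CS Phi -> Tot E).
  apply: aug_quasi_iso.
  - by move=> a p q; apply: val_inj; have /order_lt1P := r1; exact.
  - move=> n p [hp _]; rewrite /= /inv_deg; have := DR_rho hp.
    case: n {hp} => n //= h; exact: val_inj.
  - move=> n p hp; exists (inv_val p); last by apply/val_inj/(rho0_id unitA)/(valP p).
    split; last exact: (valP p).
    by case: n hp => n //= ->.
  - move=> n p [_ hp] /(congr1 (@inv_val _ _ _ _ _)) /=.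
    by rewrite rho0_id.
have equiv j : acyc (cech fs (CS Phi)) i j <-> gamma_acyc fs (Tot E) i j.
  rewrite (quasi_iso_acyc i j (cech_map_quasi_iso fs hw)) -gamma_acycE;
    apply: cech_acyc_gamma.
  exact: Tot_soft.
apply: (gamma_acyc_coh hfs pi_ker pi_deg) => j.
apply/equiv/(window_acyc unitA) => n hn.
apply/equiv/(coh_gamma_acyc hfs pi_ker pi_deg)/M0.
have hb := window_bound (cardG_gt0 G) m_gt0.
by lia.
Qed.
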